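(* Let $\xi>0$ be a constant, $\delta=\xi m$, and $r=r_0=n^{-1/2}(\ln n)^{c_0}$, where $c_0=c_0(\xi)$ is a sufficiently large constant. There is a constant $K_2(\xi)$ depending on $\xi$ such that if $m=m(n)\ge K_2(\xi)\ln n$, then both the hybrid model $G_n^{\mathrm H}$ and the self-loop model $G_n^{\mathrm S}$ have the small-community phenomenon; that is, there are constants $\alpha,\beta,\gamma>0$ independent of $n$ such that, in each model, with high probability, for every vertex $v\in V_n$ there exists an $(\alpha,\beta,\gamma)$-community containing $v$.
   Context: ''With high probability'' means with probability $1-o(1)$ as $n\to\infty$. Communities. In a graph $G=(V,E)$, $\mathrm{vol}(S)=\sum_{v\in S}\deg_G(v)$, $e(S,T)$ is the set of edges with one endpoint in $S$ and the other in $T$, and the conductance of $S\subset V$ is $\Phi(S)=\frac{|e(S,\bar S)|}{\min\{\mathrm{vol}(S),\mathrm{vol}(\bar S)\}}$ with $\bar S=V\setminus S$. For a graph on $n$ vertices, an $(\alpha,\beta,\gamma)$-community is a connected set $S\subset V$ (i.e. inducing a connected subgraph) with $|S|=\omega(1)$, $|S|=O((\ln n)^\gamma)$ and $\Phi(S)\le \alpha/|S|^\beta$. (The asymptotic size bounds are as $n\to\infty$, uniform over the communities considered: sizes are at least some function of $n$ tending to infinity and at most a constant times $(\ln n)^\gamma$.) Models. Let $S$ be a sphere of unit area (radius $\frac1{2\sqrt\pi}$), $\|\cdot\|$ the angular distance on $S$, and $B_R(v)=\{u\in S:\|u-v\|\le R\}$. A self-loop counts as degree $1$. All graphs are multigraphs;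 $V_t=\{x_1,\dots,x_t\}$ is the vertex set at time $t$. $n$ is the number of vertices generated; $m$ is a positive integer. Base model. $G_1$ consists of a uniformly random point $x_1\in S$ with $2m$ self-loops. At time $t+1$ ($t\ge1$), a new vertex $x_{t+1}$ is drawn uniformly from $S$ (independently of the past). If $B_r(x_{t+1})\cap V_t=\emptyset$, then $2m$ self-loops are added to $x_{t+1}$. Otherwise $m$ contacts $y_1^{t+1},\dots,y_m^{t+1}$ are chosen independently (with replacement) from $B_r(x_{t+1})\cap V_t$, with $$\Pr[y_i^{t+1}=v]=\frac{\deg_t(v)+\delta}{\sum_{w\in B_r(x_{t+1})\cap V_t}(\deg_t(w)+\delta)},$$ where $\deg_t(v)$ is the degree of $v$ in $G_t$, and the edges $(x_{t+1},y_i^{t+1})$ are added. Hybrid model $G_t^{\mathrm H}$. Edges are either local or long. $G_1^{\mathrm H}=G_1$ with all its self-loops local. At time $t+1$, a uniform vertex $x_{t+1}$ is added, its local edges are created as in the base model with $\deg_t(v)$ denoting the local-degree of $v$ (number of local edges at $v$), and then one long edge $(x_{t+1},z)$ is added with $z$ uniform in $\{x_1,\dots,x_t\}$. Self-loop model $G_t^{\mathrm S}$ (here $\delta\ge2$ is an integer). $G_1^{\mathrm S}$ consists of a uniform point $x_1\in S$ with $2m+\delta$ self-loops, $\delta$ of which are marked flexible. At time $t+1$, a uniform vertex $x_{t+1}$ is added together with $\delta$ flexible self-loops; its non-flexible edges are created as in the base model with $\deg_t(v)$ denoting the number of non-flexible edges incident to $v$; then a vertex $z$ is chosen uniformly from the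 vertices among $x_1,\dots,x_t$ that have at least one flexible self-loop, one flexible self-loop is deleted from each of $x_{t+1}$ and $z$, and an edge $(x_{t+1},z)$, marked flexible, is added. *)

(* Defs.v *)
From HB Require Import structures.
From mathcomp Require Import all_boot all_order all_algebra.
From mathcomp Require Import all_classical all_reals all_analysis.
From mathcomp Require Import measurable_realfun ring.

Set Implicit Arguments.
Unset Strict Implicit.
Unset Printing Implicit Defensive.

Import Order.TTheory GRing.Theory Num.Theory.
Import numFieldNormedType.Exports.

Local Open Scope classical_set_scope.
Local Open Scope ring_scope.

(** * The sphere of unit area and its uniform measure *)

Notation vec3 R :=
  (measurableTypeR R * measurableTypeR R * measurableTypeR R)%type.

Section sphere.
Variable R : realType.

Definition radius : R := (2 * Num.sqrt pi)^-1.

(* p.1 is the polar angle and p.2 the azimuth. *)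
Definition spherical (p : measurableTypeR R * measurableTypeR R) : vec3 R :=
  (radius * sin p.1 * cos p.2, radius * sin p.1 * sin p.2, radius * cos p.1).

Definition spherical_dom : set (measurableTypeR R * measurableTypeR R) :=
  `[0, pi]%classic `*` `[0, 2 * pi]%classic.

Definition area_density (p : measurableTypeR R * measurableTypeR R) : R :=
  radius ^+ 2 * sin p.1.

(* Surface measure; its total mass is 4 pi radius^2 = 1, so it is also the law
   of a uniform point of the sphere. *)
Definition sphere_area (A : set (vec3 R)) : \bar R :=
  (\int[(@lebesgue_measure R) \x (@lebesgue_measure R)]_(p in
     spherical_dom `&` spherical @^-1` A) (area_density p)%:E)%E.

(* The angle at the centre. *)
Definition angle (u v : vec3 R) : R :=
  acos ((u.1.1 * v.1.1 + u.1.2 * v.1.2 + u.2 * v.2) / radius ^+ 2).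

Let meas1 (f : R -> R) : continuous f -> measurable_fun setT
  (fun p : measurableTypeR R * measurableTypeR R => f p.1).
Proof.
move=> cf; apply: (@measurableT_comp _ _ _ _ _ _ f) => //.
exact: continuous_measurable_fun.
Qed.

Let meas2 (f : R -> R) : continuous f -> measurable_fun setT
  (fun p : measurableTypeR R * measurableTypeR R => f p.2).
Proof.
move=> cf; apply: (@measurableT_comp _ _ _ _ _ _ f) => //.
exact: continuous_measurable_fun.
Qed.

Lemma measurable_spherical : measurable_fun setT spherical.
Proof.
have ms1 := meas1 (@continuous_sin R); have mc1 := meas1 (@continuous_cos R).
have ms2 := meas2 (@continuous_sin R); have mc2 := meas2 (@continuous_cos R).
apply: measurable_fun_pair; first apply: measurable_fun_pair.
- by apply: measurable_funM => //; exact: measurable_funM.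
- by apply: measurable_funM => //; exact: measurable_funM.
- exact: measurable_funM.
Qed.

Lemma measurable_spherical_dom : measurable spherical_dom.
Proof. exact: measurableX. Qed.

Lemma measurable_area_density : measurable_fun setT area_density.
Proof. by apply: measurable_funM => //; exact: meas1 (@continuous_sin R). Qed.

Lemma area_density_ge0 p : spherical_dom p -> 0 <= area_density p.
Proof.
move=> [/= p1 _]; apply: mulr_ge0; first exact: sqr_ge0.
by apply: sin_ge0_pi; move: p1; rewrite /= in_itv.
Qed.

Let sphere_area0 : sphere_area set0 = 0%E.
Proof. by rewrite /sphere_area preimage_set0 setI0 integral_set0. Qed.

Let sphere_area_ge0 A : (0 <= sphere_area A)%E.
Proof.
by apply: integral_ge0 => p [pD _]; rewrite lee_fin area_density_ge0.
Qed.

Let sphere_area_sigma_additive : semi_sigma_additive sphere_area.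
Proof.
move=> /= F mF tF mUF; rewrite /sphere_area; apply: cvg_toP.
  apply: ereal_nondecreasing_is_cvgn => i j ij.
  by apply: lee_sum_nneg_natr => // k _ _; exact: sphere_area_ge0.
rewrite preimage_bigcup setI_bigcupr ge0_integral_bigcup//=.
- move=> k; apply: measurableI; first exact: measurable_spherical_dom.
  by rewrite -[X in measurable X]setTI; exact: measurable_spherical.
- apply: measurable_funTS; apply/measurable_EFinP.
  exact: measurable_area_density.
- by move=> p [k _ [pD _]]; rewrite lee_fin area_density_ge0.
- apply/trivIsetP => i j _ _ ij.
  rewrite setIACA setIid -preimage_setI.
  by move/trivIsetP : tF => /(_ i j I I ij) ->; rewrite preimage_set0 setI0.
Qed.

HB.instance Definition _ := isMeasure.Build _ _ _
  sphere_area sphere_area0 sphere_area_ge0 sphere_area_sigma_additive.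

Let sphere_area_setT : sphere_area setT = 1%E.
Proof.
have pi0 : 0 < pi :> R by exact: pi_gt0.
have r2 : 2 * (radius ^+ 2 * (2 * pi)) = 1 :> R.
  rewrite /radius exprVn exprMn sqr_sqrtr ?ltW//.
  by move: pi pi0 => p p0; field; rewrite lt0r_neq0.
rewrite /sphere_area (_ : _ `&` _ = spherical_dom); last first.
  by apply/seteqP; split=> [p []|p pD].
rewrite integral_mkcond.
set g := (X in integral _ _ X).
have mg : measurable_fun setT g.
  apply/(measurable_restrictT _ measurable_spherical_dom)/measurable_EFinP.
  exact: measurable_funTS measurable_area_density.
have g0 p : (0 <= g p)%E.
  by apply: erestrict_ge0 => q qD; rewrite lee_fin area_density_ge0.
rewrite fubini_tonelli1//.
rewrite (_ : fubini_F _ g = (fun x : R =>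
    (2 * pi * (radius ^+ 2 * sin x))%:E) \_ `[0, pi]%classic); last first.
  apply/funext => x; rewrite /fubini_F /g !patchE.
  case: ifPn => [x0pi|x0pi].
  - rewrite (_ : (fun y => _) = (fun=> (radius ^+ 2 * sin x)%:E)
        \_ `[0, 2 * pi]%classic); last first.
      apply/funext => y; rewrite !patchE /=.
      by congr (if _ then _ else _); rewrite in_setX x0pi.
    rewrite -integral_mkcond integral_cst//= lebesgue_measure_itv/= lte_fin.
    by rewrite mulr_gt0// sube0 -EFinM mulrC.
  - rewrite (eq_integral (fun=> 0%E)) ?integral0// => y _.
    by rewrite patchE in_setX (negbTE x0pi).
rewrite -integral_mkcond.
rewrite (@continuous_FTC2 _ _ (fun x => - (2 * pi * radius ^+ 2) * cos x))//.
- rewrite cos0 cospi -EFinB; congr EFin; rewrite -[RHS]r2; ring.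
- apply: continuous_subspaceT => x.
  apply: cvgM; first exact: cvg_cst.
  by apply: cvgM; [exact: cvg_cst|exact: continuous_sin].
- split => [x _||].
  + by [].
  + apply: cvgM; first exact: cvg_cst.
    exact/cvg_at_right_filter/continuous_cos.
  + apply: cvgM; first exact: cvg_cst.
    exact/cvg_at_left_filter/continuous_cos.
- move=> x _; rewrite derive1E.
  have dc : is_derive x 1 ((- (2 * pi * radius ^+ 2)) \*: (cos : R -> R))
    (- (2 * pi * radius ^+ 2) *: - sin x) by exact: is_deriveZ.
  by rewrite [LHS](@derive_val _ _ _ _ _ _ _ dc) /GRing.scale/=; ring.
Qed.

HB.instance Definition _ :=
  @Measure_isProbability.Build _ _ R sphere_area sphere_area_setT.

End sphere.

(** * Independent samples *)

Section iid.
Context d (T : measurableType d) (R : realType).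

Definition tuple_cons n (p : T * n.-tuple T) : n.+1.-tuple T :=
  [tuple of p.1 :: p.2].

Lemma measurable_tuple_cons n : measurable_fun setT (@tuple_cons n).
Proof. exact: measurable_cons. Qed.

HB.instance Definition _ n := isMeasurableFun.Build _ _ _ _ (@tuple_cons n)
  (@measurable_tuple_cons n).

(* The n-fold product of P, as a law on n-tuples. *)
Fixpoint iid (P : probability T R) n : probability (n.-tuple T) R :=
  match n with
  | 0 => \d_ [tuple]
  | n'.+1 => distribution (P \x iid P n')%E (@tuple_cons n')
  end.

End iid.

(** * Finitely supported random choices *)

(* A list of (probability, outcome) pairs; an outcome may be repeated, its
   probabilities then add up. *)
Definition dist (R : realType) (A : Type) := seq (R * A).

Section dist.
Variable R : realType.

Definition dret A (a : A) : dist R A := [:: (1, a)].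

Definition dbind A B (D : dist R A) (f : A -> dist R B) : dist R B :=
  [seq (p.1 * q.1, q.2) | p <- D, q <- f p.2].

(* One element of s, chosen with probability proportional to w. *)
Definition dpick A (w : A -> R) (s : seq A) : dist R A :=
  [seq (w a / \sum_(b <- s) w b, a) | a <- s].

(* k independent samples of D. *)
Definition drepeat A (D : dist R A) (k : nat) : dist R (seq A) :=
  iter k (fun Ds => dbind D (fun a => dbind Ds (fun s => dret (a :: s))))
    (dret [::]).

Definition dprob A (D : dist R A) (E : pred A) : R :=
  \sum_(p <- D | E p.2) p.1.

End dist.

(** * Multigraphs and communities *)

(* Edges are unordered: (u, v) and (v, u) play the same role throughout, and
   (v, v) is a self-loop. *)
Definition mgraph n := seq ('I_n * 'I_n).

Section graph.
Variable n : nat.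
Implicit Types (G : mgraph n) (S : {set 'I_n}) (v : 'I_n).

(* A self-loop counts once. *)
Definition deg G v : nat := count (fun e => (e.1 == v) || (e.2 == v)) G.

Definition vol G S : nat := \sum_(v in S) deg G v.

Definition cut G S : nat := count (fun e => (e.1 \in S) != (e.2 \in S)) G.

(* Where the denominator vanishes (S empty or the whole vertex set, in the
   graphs at hand) the quotient is 0; such S are not of polylogarithmic size. *)
Definition conductance (R : realType) G S : R :=
  (cut G S)%:R / (minn (vol G S) (vol G (~: S)))%:R.

Definition adjacent_in G S : rel 'I_n := [rel u v |
  [&& u \in S, v \in S & ((u, v) \in G) || ((v, u) \in G)]].

Definition connected_set G S : bool :=
  (S != finset.set0) &&
  [forall u in S, forall v in S, connect (adjacent_in G S) u v].

(* lo and hi are the values at n of the lower and upper bounds on the size. *)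
Definition community (R : realType) (alpha beta lo hi : R) G S : bool :=
  [&& connected_set G S, lo <= #|S|%:R <= hi &
      conductance R G S <= alpha / #|S|%:R `^ beta].

End graph.

(** * The three models *)

Section models.
Variables (R : realType) (n : nat).
(* Vertex t : 'I_n is the (t+1)-st to arrive and sits at tnth x t. *)
Variables (x : n.-tuple (vec3 R)) (r : R) (m : nat).

Definition earlier (t : 'I_n) : seq 'I_n :=
  [seq v : 'I_n <- enum 'I_n | (v < t)%N].

Definition nearby (t : 'I_n) : seq 'I_n :=
  [seq v <- earlier t | angle (tnth x v) (tnth x t) <= r].

(* The arrival of vertex t in the base model. The first vertex has no
   predecessor, hence gets 2m self-loops. *)
Definition base_step (delta : R) (t : 'I_n) (G : mgraph n) :
    dist R (mgraph n) :=
  if nearby t is [::] then dret R (nseq (2 * m) (t, t) ++ G)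
  else dbind (drepeat (dpick (fun v => (deg G v)%:R + delta) (nearby t)) m)
    (fun ys => dret R ([seq (t, y) | y <- ys] ++ G)).

(* States are pairs (local edges, long edges). The first vertex gets no long
   edge. *)
Definition hybrid_step (delta : R) (t : 'I_n) (G : mgraph n * mgraph n) :
    dist R (mgraph n * mgraph n) :=
  dbind (base_step delta t G.1) (fun L =>
    if earlier t is [::] then dret R (L, G.2)
    else dbind (dpick (fun=> 1) (earlier t)) (fun z =>
      dret R (L, (t, z) :: G.2))).

(* States are pairs (non-flexible edges, flexible edges). No flexible self-loop
   of the first vertex is replaced at its arrival. *)
Definition selfloop_step (delta : nat) (t : 'I_n) (G : mgraph n * mgraph n) :
    dist R (mgraph n * mgraph n) :=
  dbind (base_step delta%:R t G.1) (fun L =>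
    let F := nseq delta (t, t) ++ G.2 in
    if earlier t is [::] then dret R (L, F)
    else dbind (dpick (fun=> 1) [seq z <- earlier t | (z, z) \in F]) (fun z =>
      dret R (L, (t, z) :: seq.rem (t, t) (seq.rem (z, z) F)))).

Definition run (step : 'I_n -> mgraph n * mgraph n ->
    dist R (mgraph n * mgraph n)) : dist R (mgraph n) :=
  dbind (foldl (fun D t => dbind D (step t)) (dret R ([::], [::]))
    (enum 'I_n)) (fun G => dret R (G.1 ++ G.2)).

Definition hybrid_model (delta : R) : dist R (mgraph n) :=
  run (hybrid_step delta).

Definition selfloop_model (delta : nat) : dist R (mgraph n) :=
  run (selfloop_step delta).

End models.

(** * The small-community phenomenon *)

Section phenomenon.
Variable R : realType.

(* Law of the final multigraph given the positions. *)
Definition model_on n := n.-tuple (vec3 R) -> dist R (mgraph n).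

(* The positions being i.i.d. and independent of all other choices made before
   each arrival, they can all be drawn first. *)
Definition model_prob n (M : model_on n) (E : pred (mgraph n)) : \bar R :=
  (\int[iid (@sphere_area R) n]_(x in setT) (dprob (M x) E)%:E)%E.

Definition small_communities (alpha beta gamma : R)
    (M : forall n, model_on n) : Prop :=
  exists (f : nat -> R) (C : R),
    f i @[i --> \oo] --> +oo /\
    model_prob (M n) (fun G => [forall v : 'I_n, exists S : {set 'I_n},
      (v \in S) &&
      community alpha beta (f n) (C * ln n%:R `^ gamma) G S])
      @[n --> \oo] --> 1%:E.

End phenomenon.

(* Main.v *)
(** Put [L = ln n] and cover the sphere by polynomially many cubes of side about
    [r / 8]. By Chernoff bounds, with high probability every such cube, and every
    concentric enlargement of it by [j r], holds the expected number of sample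
    points up to constant factors, at every time from some [T0] on, where
    [r^2 T0] is of order [L].

    Each vertex owns between [m] and [2m] local edges, so the local degrees seen
    by a newcomer sum to at most [4m] times the number of vertices around it, and
    each of its contacts is uniform up to a constant factor. Since [m >= K L], a
    vertex arriving in a cube after [T0] misses all earlier vertices of that cube
    with probability at most [n^-5], and any two vertices from before [T0] get a
    common neighbour in the cube soon after [T0]. Hence each cube induces a
    connected graph.

    Let [S_j] be the set of vertices within [j] local edges of a cube. It lies in
    the cube enlarged by [j r], so its size is at most a polynomial in [j] times
    that of [S_0], and if [l] is about [L^(1/8)], some [j = 2 i <= 2 l^2]
    satisfies [|S_(j+2)| <= (1 + 1/l) |S_j|]. A local edge leaving [S_(j+1)] was
    created by a vertex of [S_(j+2)] outside [S_j], so there are at most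
    [2m |S_(j+1)| / l] of them, whereas the volume of [S_(j+1)] is at least
    [m |S_(j+1)|]. The number of long edges at a set has a bounded exponential
    moment, hence is linear in the size of the enlarged cube, with no factor
    [m]. *)

(* No upper bound on degrees is available, since an old vertex may receive many local edges. Edges
   are therefore charged to their creator, the younger endpoint, which makes at most [2 * m] of
   them. The creator of a boundary edge may lie on either side of the boundary, which is why growth
   is measured over two steps. Once the positions are fixed, every one-step estimate holds for all
   histories that satisfy an invariant, so such estimates multiply along the process although the
   steps are dependent. The exponent 1/8 has the following origin. The enlarged cube exceeds the
   inner one by a factor of order l^4, so the long edges contribute l^4 / m to the conductance, and
   m >= L makes this at most 1/l as soon as l^5 <= L. A slow step exists because 2^l eventually
   exceeds any multiple of l^4. Sizes are at most of order L^(2 c0 + 1), so a conductance of order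
   L^(-1/8) is a negative power of the size. *)
Require Import Defs.
From mathcomp Require Import all_boot all_order all_algebra.
From mathcomp Require Import all_classical all_reals all_analysis.
From mathcomp Require Import measurable_realfun ring lra zify.

Set Implicit Arguments.
Unset Strict Implicit.
Unset Printing Implicit Defensive.

Import Order.TTheory GRing.Theory Num.Theory.
Import numFieldNormedType.Exports.
Local Open Scope classical_set_scope.
Local Open Scope ring_scope.

(** * Finitely supported distributions *)

Section dist_expectation.
Variable R : realType.

Definition dexp A (D : dist R A) (f : A -> R) : R := \sum_(p <- D) p.1 * f p.2.

(** A recursive form that needs no decidable equality on outcomes. It ranges over all listed
    outcomes, including those of probability 0. *)
Definition dall A (P : A -> Prop) (D : dist R A) : Prop :=
  foldr (fun p Q => P p.2 /\ Q) True D.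

Definition is_dist A (D : dist R A) : Prop :=
  foldr (fun p Q => 0 <= p.1 /\ Q) True D /\ dexp D (fun=> 1) = 1.

Lemma dprobE A (D : dist R A) (E : pred A) :
  dprob D E = dexp D (fun a => (E a)%:R).
Proof.
rewrite /dprob /dexp big_mkcond; apply: eq_bigr => p _.
by case: (E p.2); rewrite ?mulr1 ?mulr0.
Qed.

Lemma dexp_nil A (f : A -> R) : dexp [::] f = 0.
Proof. by rewrite /dexp big_nil. Qed.

Lemma dexp_cons A p (D : dist R A) (f : A -> R) :
  dexp (p :: D) f = p.1 * f p.2 + dexp D f.
Proof. by rewrite /dexp big_cons. Qed.

Lemma dexp_ret A (a : A) (f : A -> R) : dexp (dret R a) f = f a.
Proof. by rewrite dexp_cons dexp_nil mul1r addr0. Qed.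

Lemma dexp_bind A B (D : dist R A) (k : A -> dist R B) f :
  dexp (dbind D k) f = dexp D (fun a => dexp (k a) f).
Proof.
rewrite /dexp /dbind big_allpairs_dep/=; apply: eq_bigr => p _.
by rewrite mulr_sumr; apply: eq_bigr => q _; rewrite mulrA.
Qed.

Lemma dexp_eq A (D : dist R A) (f g : A -> R) :
  (forall a, f a = g a) -> dexp D f = dexp D g.
Proof. by move=> fg; apply: eq_bigr => p _; rewrite fg. Qed.

Lemma dexpZ A (D : dist R A) c (f : A -> R) :
  dexp D (fun a => c * f a) = c * dexp D f.
Proof. by rewrite /dexp mulr_sumr; apply: eq_bigr => p _; ring. Qed.

Lemma dexpD A (D : dist R A) (f g : A -> R) :
  dexp D (fun a => f a + g a) = dexp D f + dexp D g.
Proof. by rewrite /dexp -big_split; apply: eq_bigr => p _; rewrite mulrDr. Qed.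

Lemma dexp_cst A (D : dist R A) c : is_dist D -> dexp D (fun=> c) = c.
Proof.
by move=> [_ D1]; rewrite -[in LHS](mulr1 c) (dexpZ D c (fun=> 1)) D1 mulr1.
Qed.

Lemma dall_true A (P : A -> Prop) D : (forall a, P a) -> dall P D.
Proof. by move=> PT; elim: D => //= p D IH; split. Qed.

Lemma dall_imp A (P Q : A -> Prop) D :
  (forall a, P a -> Q a) -> dall P D -> dall Q D.
Proof. by move=> PQ; elim: D => //= p D IH [] /PQ ? /IH. Qed.

Lemma dexp_le A (D : dist R A) (P : A -> Prop) (f g : A -> R) :
  is_dist D -> dall P D -> (forall a, P a -> f a <= g a) ->
  dexp D f <= dexp D g.
Proof.
move=> [+ _] + fg; elim: D => [|p D IH]; first by rewrite !dexp_nil.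
move=> [p0 D0] [Pp PD]; rewrite !dexp_cons lerD ?IH//.
by rewrite ler_wpM2l// fg.
Qed.

Lemma dexp_ge0 A (D : dist R A) (f : A -> R) :
  is_dist D -> (forall a, 0 <= f a) -> 0 <= dexp D f.
Proof.
move=> D1 f0; rewrite -(dexp_cst 0 D1).
by apply: (dexp_le (P := fun=> True)) => //; exact: dall_true.
Qed.

Lemma is_dist_ret A (a : A) : is_dist (dret R a).
Proof. by split; rewrite ?dexp_ret//=. Qed.

Lemma dall_cat A (P : A -> Prop) D1 D2 :
  dall P (D1 ++ D2) <-> dall P D1 /\ dall P D2.
Proof.
elim: D1 => [|p D1 IH] /=; first by split=> [|[]].
by rewrite /dall /= in IH *; tauto.
Qed.

Lemma dbind_cons A B p (D : dist R A) (k : A -> dist R B) :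
  dbind (p :: D) k = [seq (p.1 * q.1, q.2) | q <- k p.2] ++ dbind D k.
Proof. by []. Qed.

Lemma dall_bind A B (P : A -> Prop) (Q : B -> Prop) D (k : A -> dist R B) :
  dall P D -> (forall a, P a -> dall Q (k a)) -> dall Q (dbind D k).
Proof.
move=> PD Qk; elim: D PD => //= p D IH [Pp PD].
rewrite dbind_cons; apply/dall_cat; split; last exact: IH.
by move/Qk: Pp; elim: (k p.2) => //= q K IHK [Qq QK]; split => //; exact: IHK.
Qed.

Lemma is_dist_bind A B (P : A -> Prop) D (k : A -> dist R B) :
  is_dist D -> dall P D -> (forall a, P a -> is_dist (k a)) ->
  is_dist (dbind D k).
Proof.
move=> dD PD dk; split; last first.
  rewrite dexp_bind; apply/eqP; rewrite eq_le; apply/andP; split.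
    rewrite -[leRHS](dexp_cst 1 dD); apply: (dexp_le dD PD) => a Pa.
    by rewrite (dexp_cst _ (dk _ Pa)).
  rewrite -[leLHS](dexp_cst 1 dD); apply: (dexp_le dD PD) => a Pa.
  by rewrite (dexp_cst _ (dk _ Pa)).
case: dD => + _; elim: D PD => //= p D IH [Pp PD] [p0 D0].
rewrite dbind_cons.
have [K0 _] := dk _ Pp.
elim: (k p.2) K0 => [|q K IHK] /= => [_|[q0 K0]]; first exact: IH.
by split; [exact: mulr_ge0|exact: IHK].
Qed.

Lemma dexp_pick (A : Type) (w : A -> R) s f :
  dexp (dpick w s) f = (\sum_(a <- s) w a * f a) / \sum_(a <- s) w a.
Proof.
rewrite /dexp /dpick big_map mulr_suml; apply: eq_bigr => a _ /=.
by rewrite mulrAC.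
Qed.

Lemma is_dist_pick (A : Type) (w : A -> R) s :
  (forall a, 0 < w a) -> (0 < size s)%N -> is_dist (dpick w s).
Proof.
move=> w0 s0; have sw0 : 0 < \sum_(a <- s) w a.
  case: s s0 => // a s _; rewrite big_cons ltr_pwDl//.
  by apply: sumr_ge0 => b _; exact: ltW.
split; last first.
  by rewrite dexp_pick (eq_bigr w) ?divff ?gt_eqF// => a _; rewrite mulr1.
rewrite /dpick; move: (\sum_(b <- s) w b) sw0 => W W0.
by elim: s {s0} => //= a s IH; split=> //; rewrite divr_ge0 ?ltW.
Qed.

Lemma dall_pick (A : eqType) (w : A -> R) (s : seq A) :
  dall (fun a => a \in s) (dpick w s).
Proof.
rewrite /dpick; move: (\sum_(b <- s) w b) => W.
suff : forall u : seq A, {subset u <= s} ->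
    dall (fun a => a \in s) [seq (w a / W, a) | a <- u] by apply.
elim=> //= a u IH us; split; first by apply: us; rewrite mem_head.
by apply: IH => b bu; apply: us; rewrite inE bu orbT.
Qed.

Lemma is_dist_repeat A (D : dist R A) k : is_dist D -> is_dist (drepeat D k).
Proof.
move=> dD; elim: k => [|k IH]; first exact: is_dist_ret.
rewrite /drepeat iterS.
apply: (is_dist_bind (P := fun=> True)) => //; first exact: dall_true.
move=> a _; apply: (is_dist_bind (P := fun=> True)) => //; first exact: dall_true.
by move=> s _; exact: is_dist_ret.
Qed.

Lemma dall_repeat A (P : A -> Prop) (D : dist R A) k : dall P D ->
  dall (fun s => size s = k /\ foldr (fun a Q => P a /\ Q) True s) (drepeat D k).
Proof.
move=> PD; elim: k => [|k IH]; first by [].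
rewrite /drepeat iterS; apply: dall_bind PD _ => a Pa.
apply: dall_bind IH _ => s [sk Ps] /=.
by rewrite sk.
Qed.

Lemma dexp_repeat_all A (D : dist R A) k (E : pred A) :
  dexp (drepeat D k) (fun s => (all E s)%:R) = dexp D (fun a => (E a)%:R) ^+ k.
Proof.
elim: k => [|k IH]; first by rewrite dexp_ret.
rewrite /drepeat iterS dexp_bind exprS -IH mulrC -dexpZ.
apply: dexp_eq => a; rewrite dexp_bind -/(drepeat D k) mulrC -dexpZ.
by apply: dexp_eq => s; rewrite dexp_ret/= -natrM mulnb.
Qed.

End dist_expectation.

(** * Chains of random steps *)

Section chain.
Variables (R : realType) (n : nat) (S : Type).
Variable step : 'I_n -> S -> dist R S.
Variable s0 : S.

Definition chain : dist R S :=
  foldl (fun D t => dbind D (step t)) (dret R s0) (enum 'I_n).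

Variable Inv : nat -> S -> Prop.
Hypothesis Inv0 : Inv 0 s0.
Hypothesis step_dist : forall (t : 'I_n) s, Inv t s -> is_dist (step t s).
Hypothesis step_inv : forall (t : 'I_n) s, Inv t s ->
  dall (Inv t.+1) (step t s).

Let prefix k := foldl (fun D t => dbind D (step t)) (dret R s0)
  (take k (enum 'I_n)).

Let prefixS (t : 'I_n) : prefix t.+1 = dbind (prefix t) (step t).
Proof.
rewrite /prefix (take_nth t) ?size_enum_ord// nth_ord_enum.
by rewrite -cats1 foldl_cat.
Qed.

Let chainE : chain = prefix n.
Proof. by rewrite /chain /prefix take_oversize// size_enum_ord. Qed.

Let prefix_inv k : (k <= n)%N -> is_dist (prefix k) /\ dall (Inv k) (prefix k).
Proof.
elim: k => [_|k IH kn].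
  by rewrite /prefix take0; split; [exact: is_dist_ret|split].
have [dk Ik] := IH (ltnW kn); rewrite (prefixS (Ordinal kn)); split.
  exact: is_dist_bind Ik (@step_dist (Ordinal kn)).
exact: dall_bind Ik (@step_inv (Ordinal kn)).
Qed.

Lemma chain_dist : is_dist chain.
Proof. by rewrite chainE; have [] := prefix_inv (leqnn n). Qed.

Lemma chain_inv : dall (Inv n) chain.
Proof. by rewrite chainE; have [] := prefix_inv (leqnn n). Qed.

(** The supermartingale principle: both the missed contacts and the long edges are controlled by a
    suitable time-dependent potential [Phi]. *)
Lemma chain_dexp_le (Phi : nat -> S -> R) :
  (forall (t : 'I_n) s, Inv t s -> dexp (step t s) (Phi t.+1) <= Phi t s) ->
  dexp chain (Phi n) <= Phi 0%N s0.
Proof.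
move=> stepPhi; rewrite chainE.
suff : forall k, (k <= n)%N -> dexp (prefix k) (Phi k) <= Phi 0%N s0 by apply.
elim=> [_|k IH kn]; first by rewrite /prefix take0 dexp_ret.
apply: le_trans (IH (ltnW kn)); rewrite (prefixS (Ordinal kn)) dexp_bind.
have [dk Ik] := prefix_inv (ltnW kn).
exact: dexp_le dk Ik (stepPhi (Ordinal kn)).
Qed.

End chain.

(** * Local edges *)

Definition cnt n (A : pred 'I_n) (t : nat) : nat :=
  #|[pred v : 'I_n | A v && (v < t)%N]|.

Lemma card_ord_lt n t : (t <= n)%N -> #|[pred v : 'I_n | (v < t)%N]| = t.
Proof.
by move=> tn; rewrite -sum1_card -(big_ord_widen _ (fun=> 1%N)) // sum1_card card_ord.
Qed.

Lemma cntE n (A : pred 'I_n) t : cnt A t = \sum_(v < n | A v && (v < t)%N) 1%N.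
Proof. by rewrite sum1_card. Qed.

Lemma sub_cnt n (A B : pred 'I_n) t :
  (forall v, A v -> B v) -> (cnt A t <= cnt B t)%N.
Proof.
move=> AB; apply: subset_leq_card; apply/fintype.subsetP => v.
by rewrite !inE => /andP[/AB -> ->].
Qed.

Lemma leq_cnt n (A : pred 'I_n) s t : (s <= t)%N -> (cnt A s <= cnt A t)%N.
Proof.
move=> st; apply: subset_leq_card; apply/fintype.subsetP => v.
by rewrite !inE => /andP[-> /leq_trans] /=; apply.
Qed.

Section local_edges.
Variables (R : realType) (n : nat) (x : n.-tuple (vec3 R)) (r : R) (m : nat).
Variable delta : R.
Hypothesis delta_gt0 : 0 < delta.

Definition near (v t : 'I_n) : bool := (v < t)%N && (angle (tnth x v) (tnth x t) <= r).

Lemma mem_nearby v t : (v \in nearby x r t) = near v t.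
Proof. by rewrite mem_filter mem_filter mem_enum andbT andbC. Qed.

Lemma nearby_uniq t : uniq (nearby x r t).
Proof. by do 2 apply: filter_uniq; exact: enum_uniq. Qed.

(** Edges carry their creator first. Only the edges that a vertex creates are bounded, not those
    that it receives. *)
Definition local_inv (t : nat) (L : mgraph n) : Prop :=
  (forall e, e \in L -> (e.1 < t)%N && ((e.2 == e.1) || near e.2 e.1)) /\
  (forall v : 'I_n, (v < t)%N ->
     (m <= count (fun e => e.1 == v) L <= 2 * m)%N).

Definition adds_at (t : 'I_n) (L L' : mgraph n) : Prop :=
  exists ys : seq 'I_n, [/\ L' = [seq (t, y) | y <- ys] ++ L,
    (m <= size ys <= 2 * m)%N & all (fun y => (y == t) || near y t) ys].

Lemma base_step_dist t L : is_dist (base_step x r m delta t L).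
Proof.
rewrite /base_step; case E : (nearby x r t) => [|v s]; first exact: is_dist_ret.
apply: (is_dist_bind (P := fun=> True)).
- apply/is_dist_repeat/is_dist_pick => // w.
  by rewrite ltr_wpDl.
- exact: dall_true.
- by move=> *; exact: is_dist_ret.
Qed.

Lemma base_step_adds t L : dall (adds_at t L) (base_step x r m delta t L).
Proof.
rewrite /base_step; case E : (nearby x r t) => [|v s].
  split=> //; exists (nseq (2 * m) t); split.
  - by rewrite map_nseq.
  - by rewrite size_nseq leqnn andbT leq_pmull.
  - by rewrite all_nseq eqxx orbT.
rewrite -E; apply: (dall_bind (P := fun s : seq 'I_n => size s = m /\
    foldr (fun a Q => (a \in nearby x r t) /\ Q) True s)).
  by apply: dall_repeat; exact: dall_pick.
move=> ys [sm ysN]; split=> //; exists ys; split => //.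
  by rewrite sm leqnn leq_pmull.
elim: ys ysN {sm} => //= y ys IH [yN /IH ->].
by rewrite -mem_nearby yN orbT.
Qed.

Lemma adds_at_inv (t : 'I_n) L L' : local_inv t L -> adds_at t L L' ->
  local_inv t.+1 L'.
Proof.
move=> [L1 L2] [ys [-> sz yN]]; split.
  move=> e; rewrite mem_cat => /orP[/mapP[y ys_y ->]/=|/L1 /andP[et ->]].
    by rewrite ltnSn (allP yN).
  by rewrite andbT ltnS ltnW.
move=> v; rewrite ltnS leq_eqVlt count_cat count_map => /orP[|vt].
  move=> /eqP/ord_inj ->.
  rewrite (@eq_count _ _ xpredT); last by move=> y /=; rewrite eqxx.
  rewrite count_predT (_ : count _ L = 0%N) ?addn0//.
  apply/eqP; rewrite -leqn0 leqNgt -has_count; apply/hasPn => e /L1.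
  by case/andP => et _; rewrite -val_eqE /= ltn_eqF.
rewrite (@eq_count _ _ pred0) ?count_pred0 ?add0n; first exact: L2.
by move=> y /=; rewrite -val_eqE/= gtn_eqF.
Qed.

Lemma local_inv_count t L (B : pred 'I_n) : local_inv t L ->
  (count (fun e => B e.1) L <= 2 * m * cnt B t)%N.
Proof.
move=> [L1 L2].
have -> : count (fun e => B e.1) L = \sum_(v < n | B v) count (fun e => e.1 == v) L.
  rewrite -sum1_count; under [RHS]eq_bigr do rewrite -sum1_count big_mkcond/=.
  rewrite [RHS]exchange_big /= [LHS]big_mkcond; apply: eq_bigr => e _ /=.
  rewrite -big_mkcondr/=; case: ifPn => Be.
    rewrite (big_pred1 e.1)// => v /=.
    by rewrite eq_sym; case: eqP => [->|]; rewrite ?Be ?andbF.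
  by rewrite big1// => v /andP[Bv /eqP ev]; rewrite ev Bv in Be.
rewrite cntE big_distrr/= [leqRHS]big_mkcondr /=.
apply: leq_sum => v Bv; rewrite muln1; case: ifPn => vt.
  by have /andP[] := L2 _ vt.
rewrite leqn0 eqn0Ngt -has_count; apply/hasPn => e /L1 /andP[et _].
by apply/eqP => ev; rewrite -ev et in vt.
Qed.

(** An edge adds at most 2 to the sum, and only if one of its ends is near [t]. Its creator is then
    in [B]: either it is near [t] itself, or its contact is, and the second closure hypothesis
    applies. The vertices of [B] create at most [2 * m] edges each. *)
Lemma sum_deg_nearby (t : 'I_n) L (B : pred 'I_n) : local_inv t L ->
  (forall v, near v t -> B v) ->
  (forall v w, near v t -> near v w -> B w) ->
  (\sum_(v <- nearby x r t) deg L v <= 4 * m * cnt B t)%N.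
Proof.
move=> LI B1 B2.
rewrite (_ : (4 * m * _ = 2 * (2 * m * cnt B t))%N); last by ring.
apply: leq_trans (_ : (_ <= 2 * count (fun e => B e.1) L)%N) _; last first.
  by rewrite leq_mul2l; exact: local_inv_count LI.
rewrite /deg; under eq_bigr do rewrite -sum1_count big_mkcond/=.
rewrite exchange_big /= -sum1_count [X in (_ <= 2 * X)%N]big_mkcond big_distrr/=.
rewrite [leqLHS]big_seq [leqRHS]big_seq; apply: leq_sum => e eL.
have one a : (\sum_(v <- nearby x r t) (a == v) <= (a \in nearby x r t))%N.
  rewrite -count_uniq_mem ?nearby_uniq// -sum1_count [leqRHS]big_mkcond/=.
  by apply: leq_sum => v _; rewrite eq_sym; case: eqP.
have := one e.1; have := one e.2; rewrite !mem_nearby => o2 o1.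
apply: leq_trans (_ : (_ <= near e.1 t + near e.2 t)%N) _.
  apply: leq_trans (leq_add o1 o2); rewrite -big_split /=.
  by apply: leq_sum => v _; case: (e.1 == v); case: (e.2 == v).
have Be : near e.1 t || near e.2 t -> B e.1.
  case/orP => [/B1//|e2t]; case: LI => /(_ _ eL) /andP[_ /orP[/eqP e12|e21] _].
    by rewrite -e12; exact: B1.
  exact: B2 e2t e21.
by case: (near e.1 t) (near e.2 t) Be => [] [] // ->.
Qed.

Definition misses (t : 'I_n) (E : pred 'I_n) (L : mgraph n) : bool :=
  all (fun e => (e.1 == t) ==> ~~ E e.2) L.

Lemma misses_cat t u E ys L : u != t ->
  misses t E ([seq (u, y) | y <- ys] ++ L) = misses t E L.
Proof.
move=> ut; rewrite /misses all_cat all_map (@eq_all _ _ xpredT) ?all_predT//.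
by move=> y /=; rewrite (negbTE ut).
Qed.

(* Every nearby vertex has degree at least [m], while the degrees of the nearby
   vertices sum to at most [4 m] times the number of vertices in [B]; so each
   contact is, up to the factor [4], at least uniform over [B]. *)
Lemma base_step_misses (t : 'I_n) L (B E : pred 'I_n) : (0 < m)%N ->
  local_inv t L ->
  (forall v, near v t -> B v) ->
  (forall v w, near v t -> near v w -> B w) ->
  (forall v, E v -> (v < t)%N -> near v t) ->
  dexp (base_step x r m delta t L) (fun L' => (misses t E L')%:R) <=
    (1 - (cnt E t)%:R / (4 * (cnt B t)%:R)) ^+ m.
Proof.
move=> m0 LI B1 B2 E1.
(* If no earlier vertex lies in [E] the bound is 1. Otherwise some vertex is nearby, which excludes
   the self-loop branch of [base_step]. *)
have [cE0|cE0] := eqVneq (cnt E t) 0%N.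
  rewrite cE0 mul0r subr0 expr1n.
  rewrite -[leRHS](dexp_cst 1 (base_step_dist t L)).
  apply: (dexp_le (P := fun=> True)) => //; first exact: base_step_dist.
    exact: dall_true.
  by move=> L' _; case: misses.
have cEn : cnt E t = count E (nearby x r t).
  have /card_uniqP : uniq [seq v <- nearby x r t | E v].
    by rewrite filter_uniq// nearby_uniq.
  rewrite size_filter => <-.
  apply: eq_card => v; rewrite !inE mem_filter mem_nearby.
  case: (boolP (E v)) => //= Ev; apply/idP/idP => [/E1 -> //|].
  by case/andP.
have cnB : (size (nearby x r t) <= cnt B t)%N.
  rewrite -(card_uniqP (nearby_uniq t)); apply: subset_leq_card.
  apply/fintype.subsetP => v; rewrite mem_nearby !inE => vt.
  by rewrite B1//=; case/andP: vt.
have Bt0 : (0 < cnt B t)%N.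
  apply: leq_trans cnB; apply: leq_trans (count_size E _).
  by rewrite -cEn lt0n.
rewrite /base_step; case S : (nearby x r t) => [|v0 s0].
  by move: cE0; rewrite cEn S.
rewrite -S {v0 s0 S}; set s := nearby x r t in cEn cnB *.
pose w v := (deg L v)%:R + delta; rewrite -/w.
rewrite dexp_bind; under dexp_eq => ys do rewrite dexp_ret.
apply: (@le_trans _ _ (dexp (drepeat (dpick w s) m)
    (fun ys => (all (fun y => ~~ E y) ys)%:R))).
  apply: (dexp_le (P := fun=> True)); [|exact: dall_true|].
    apply/is_dist_repeat/is_dist_pick => [a|]; first by rewrite ltr_wpDl.
    by apply: leq_trans (count_size E _); rewrite -cEn lt0n.
  move=> ys _; rewrite ler_nat /misses all_cat all_map.
  rewrite (@eq_all _ _ (fun y => ~~ E y)); last by move=> y /=; rewrite eqxx.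
  by case: all => //=; case: all.
rewrite dexp_repeat_all; apply: lerXn2r.
- rewrite nnegrE; apply: dexp_ge0 => //; apply: is_dist_pick => [a|].
    by rewrite ltr_wpDl.
  by apply: leq_trans (count_size E _); rewrite -cEn lt0n.
- rewrite nnegrE subr_ge0 ler_pdivrMr ?mul1r.
    rewrite -natrM ler_nat cEn (leq_trans (count_size _ _))//.
    by rewrite (leq_trans cnB)// leq_pmull.
  by rewrite mulr_gt0// ltr0n.
have w0 a : 0 < w a by rewrite ltr_wpDl.
have W0 : 0 < \sum_(a <- s) w a.
  move: cE0; rewrite cEn; case: s {cEn cnB} => // a s _.
  by rewrite big_cons ltr_pwDl// sumr_ge0// => b _; exact: ltW.
rewrite dexp_pick ler_pdivrMr// mulrBl mul1r lerBrDr.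
have -> : \sum_(a <- s) w a =
    \sum_(a <- s) w a * (~~ E a)%:R + \sum_(a <- s) w a * (E a)%:R.
  rewrite -big_split /=; apply: eq_bigr => a _.
  by case: (E a); rewrite ?mulr0 ?mulr1 ?addr0 ?add0r.
rewrite lerD2l.
have -> : \sum_(a <- s) w a * (~~ E a)%:R + \sum_(a <- s) w a * (E a)%:R =
    \sum_(a <- s) w a.
  rewrite -big_split /=; apply: eq_bigr => a _.
  by case: (E a); rewrite ?mulr0 ?mulr1 ?addr0 ?add0r.
(* This bound and [Ege] share the factor [m%:R + delta], so [delta] disappears from the ratio. *)
have Wle : \sum_(a <- s) w a <= 4 * (cnt B t)%:R * (m%:R + delta).
  rewrite /w big_split /= -natr_sum.
  have := sum_deg_nearby LI B1 B2; rewrite -/s -(ler_nat R) => dle.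
  have sle : \sum_(i <- s) delta <= (cnt B t)%:R * delta.
    rewrite big_const_seq count_predT iter_addr_0.
    rewrite mulr_natl; apply: ler_wpMn2l => //; exact: ltW.
  have : 0 <= (cnt B t)%:R * delta by rewrite mulr_ge0// ltW.
  rewrite !natrM in dle; nra.
have Ege : (cnt E t)%:R * (m%:R + delta) <= \sum_(a <- s) w a * (E a)%:R.
  rewrite cEn -sum1_count natr_sum mulr_suml [leLHS]big_mkcond /=.
  rewrite [leLHS]big_seq [leRHS]big_seq; apply: ler_sum => a; rewrite mem_nearby => at_.
  case: ifPn => Ea; last by rewrite mulr0.
  rewrite mul1r mulr1 /w lerD2r ler_nat.
  case: LI => _ /(_ a); case/andP: at_ => -> _ /(_ isT) /andP[+ _].
  by move=> /leq_trans; apply; apply: sub_count => e /= ->.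
apply: le_trans Ege; rewrite mulrAC ler_pdivrMr; last by rewrite mulr_gt0 ?ltr0n.
by rewrite -mulrA ler_wpM2l// mulrC.
Qed.

End local_edges.

(** Loops are left out: they cross no cut, and the flexible loops that come and go in the self-loop
    model then do not change the count. *)
Definition touching n (A : pred 'I_n) (F : mgraph n) : nat :=
  count (fun e => (e.1 != e.2) && (A e.1 || A e.2)) F.

(** * Estimates common to both models *)

Section two_layers.
Variables (R : realType) (n : nat) (x : n.-tuple (vec3 R)) (r : R) (m : nat).
Variable delta : R.
Hypothesis delta_gt0 : 0 < delta.

(* What the two models have in common. The last field makes the number of long
   edges at [A] exponentially integrable; at [t = 0] its quotient is [0]. *)
Record layered (step : 'I_n -> mgraph n * mgraph n -> dist R (mgraph n * mgraph n))
    (Inv : nat -> mgraph n * mgraph n -> Prop) : Prop := Layered {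
  layered0 : Inv 0 ([::], [::]);
  layered_dist : forall (t : 'I_n) s, Inv t s -> is_dist (step t s);
  layered_inv : forall (t : 'I_n) s, Inv t s -> dall (Inv t.+1) (step t s);
  layered_local : forall t s, Inv t s -> local_inv x r m t s.1;
  layered_adds : forall (t : 'I_n) s, Inv t s ->
    dall (fun s' => adds_at x r m t s.1 s'.1) (step t s);
  layered_marg : forall (t : 'I_n) s f, Inv t s ->
    dexp (step t s) (fun s' => f s'.1) = dexp (base_step x r m delta t s.1) f;
  layered_long : forall (t : 'I_n) s (A : pred 'I_n), Inv t s ->
    dexp (step t s) (fun s' => 2 ^+ touching A s'.2) <=
    2 ^+ A t * (1 + 2 * (cnt A t)%:R / t%:R) * 2 ^+ touching A s.2 }.

Section layered_bounds.
Variable step : 'I_n -> mgraph n * mgraph n -> dist R (mgraph n * mgraph n).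
Variable Inv : nat -> mgraph n * mgraph n -> Prop.
Hypothesis H : layered step Inv.

Let D := chain step ([::], [::]).

Lemma layered_chain_dist : is_dist D.
Proof. exact: chain_dist (layered0 H) (layered_dist H) (layered_inv H). Qed.

Lemma layered_chain_local : dall (fun s => local_inv x r m n s.1) D.
Proof.
apply: dall_imp (chain_inv (layered0 H) (layered_dist H) (layered_inv H)).
by move=> s /(layered_local H).
Qed.

(** The potential is the indicator that all arrivals of [I] so far have failed, times one factor [b]
    for each arrival of [I] still to come. Later arrivals do not alter an earlier failure, so each
    arrival has only its own conditional bound to supply. *)
Lemma layered_chain_fail (I : pred 'I_n) (fail : 'I_n -> pred (mgraph n)) b :
  0 <= b ->
  (forall t u ys L, u != t ->
     fail t ([seq (u, y) | y <- ys] ++ L) = fail t L) ->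
  (forall t L, I t -> local_inv x r m t L ->
     dexp (base_step x r m delta t L) (fun L' => (fail t L')%:R) <= b) ->
  dexp D (fun s => [forall t, I t ==> fail t s.1]%:R) <= b ^+ #|I|.
Proof.
move=> b0 floc fb.
pose Phi k (s : mgraph n * mgraph n) : R :=
  [forall u : 'I_n, (I u && (u < k)%N) ==> fail u s.1]%:R *
  b ^+ #|[pred u : 'I_n | I u && (k <= u)%N]|.
have := chain_dexp_le (layered0 H) (layered_dist H) (layered_inv H) (Phi := Phi).
have -> : Phi 0%N ([::], [::]) = b ^+ #|I|.
  rewrite /Phi (_ : [forall u, _] = true) ?mul1r; last first.
    by apply/forallP => u; rewrite andbF.
  by congr (_ ^+ _); apply: eq_card => u; rewrite !inE andbT.
rewrite (dexp_eq _ (g := fun s => [forall t, I t ==> fail t s.1]%:R)); last first.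
  move=> s; rewrite /Phi (_ : #|_| = 0%N) ?expr0 ?mulr1; last first.
    by apply: eq_card0 => u; rewrite !inE leqNgt ltn_ord andbF.
  by congr (nat_of_bool _)%:R; apply: eq_forallb => u; rewrite ltn_ord andbT.
apply => t s Is.
pose c : R := [forall u : 'I_n, (I u && (u < t)%N) ==> fail u s.1]%:R *
  b ^+ #|[pred u : 'I_n | I u && (t.+1 <= u)%N]|.
have c0 : 0 <= c by rewrite mulr_ge0// exprn_ge0.
apply: (@le_trans _ _ (dexp (step t s) (fun s' => c * (I t ==> fail t s'.1)%:R))).
  apply: (dexp_le (layered_dist H Is) (layered_adds H Is)) => s' [ys [Es' _ _]].
  rewrite /Phi mulrAC ler_wpM2r ?exprn_ge0// -natrM ler_nat mulnb.
  set a := [forall u, _]; case: (boolP a) => // /forallP aT.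
  rewrite (_ : _ && _ = true)//; apply/andP; split.
    apply/forallP => u; apply/implyP => /andP[Iu ut].
    have := aT u; rewrite Iu ltnS (ltnW ut) Es' floc//.
    by rewrite -val_eqE/= gtn_eqF.
  apply/implyP => It; have := aT t; by rewrite It ltnSn.
rewrite dexpZ (layered_marg H (fun L => (I t ==> fail t L)%:R) Is).
have -> : Phi t s = c * b ^+ I t.
  rewrite /Phi /c -mulrA -exprD; congr (_ * _ ^+ _).
  rewrite addnC (cardD1 t) inE leqnn andbT; congr (_ + _)%N.
  apply: eq_card => u; rewrite !inE -val_eqE/=.
  by case: (I u); rewrite ?andbF//= ltn_neqAle eq_sym.
rewrite ler_wpM2l//; case: (boolP (I t)) => It /=; last first.
  by rewrite expr0 dexp_cst//; exact: base_step_dist.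
by rewrite expr1; apply: fb => //; exact: (layered_local H Is).
Qed.

(** The growth factors in [layered_long] depend on the positions alone, so the potential is the
    current value times the product of the factors still to come. *)
Lemma layered_chain_long (A : pred 'I_n) :
  dexp D (fun s => 2 ^+ touching A s.2) <=
  2 ^+ cnt A n * \prod_(t < n) (1 + 2 * (cnt A t)%:R / t%:R).
Proof.
pose g (t : 'I_n) : R := 2 ^+ A t * (1 + 2 * (cnt A t)%:R / t%:R).
have g0 t : 0 <= g t by rewrite mulr_ge0 ?exprn_ge0// addr_ge0// divr_ge0// mulr_ge0.
pose Phi k (s : mgraph n * mgraph n) : R :=
  2 ^+ touching A s.2 * \prod_(t < n | (k <= t)%N) g t.
have := chain_dexp_le (layered0 H) (layered_dist H) (layered_inv H) (Phi := Phi).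
have -> : Phi 0%N ([::], [::]) =
    2 ^+ cnt A n * \prod_(t < n) (1 + 2 * (cnt A t)%:R / t%:R).
  rewrite /Phi /= mul1r /g big_split/=; congr (_ * _).
  rewrite prodrXr; congr (_ ^+ _); rewrite cntE [RHS]big_mkcond/=.
  by apply: eq_bigr => v _; rewrite ltn_ord andbT; case: (A v).
rewrite (dexp_eq _ (g := fun s => 2 ^+ touching A s.2)); last first.
  by move=> s; rewrite /Phi big1 ?mulr1// => u; rewrite leqNgt ltn_ord.
apply => t s Is; rewrite /Phi.
rewrite [in leRHS](bigD1 t)//= mulrA.
under dexp_eq => s' do rewrite mulrC.
rewrite dexpZ [in leRHS]mulrC.
rewrite (eq_bigl (fun u : 'I_n => (t <= u)%N && (u != t))); last first.
  by move=> u; rewrite ltn_neqAle eq_sym andbC -val_eqE.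
have P0 : 0 <= \prod_(i < n | (t <= i)%N && (i != t)) g i.
  by apply: prodr_ge0 => i _; exact: g0.
by rewrite ler_wpM2l// mulrC; exact: (layered_long H).
Qed.

Lemma layered_prob_ge (I : finType) (bad : I -> pred (mgraph n * mgraph n))
    (eps : I -> R) (E : pred (mgraph n * mgraph n)) :
  (forall i, dexp D (fun s => (bad i s)%:R) <= eps i) ->
  (forall s, local_inv x r m n s.1 -> (forall i, ~~ bad i s) -> E s) ->
  1 - \sum_i eps i <= dprob D E.
Proof.
move=> bade impE; rewrite dprobE.
have dD := layered_chain_dist.
apply: le_trans (_ : 1 - \sum_i dexp D (fun s => (bad i s)%:R) <= _).
  by rewrite lerD2l lerN2 ler_sum.
rewrite lerBlDr -[leLHS](dexp_cst 1 dD).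
have -> : \sum_i dexp D (fun s => (bad i s)%:R) =
    dexp D (fun s => \sum_i (bad i s)%:R).
  rewrite /dexp exchange_big /=; apply: eq_bigr => s _.
  by rewrite mulr_sumr.
rewrite -dexpD; apply: (dexp_le dD layered_chain_local) => s Ls.
case: (boolP [exists i, bad i s]) => [/existsP[i bi]|/existsPn nb].
  by rewrite (bigD1 i)//= bi addrCA lerDl addr_ge0// sumr_ge0.
by rewrite impE// lerDl sumr_ge0.
Qed.

End layered_bounds.
End two_layers.

(** * The hybrid model *)

Section hybrid.
Variables (R : realType) (n : nat) (x : n.-tuple (vec3 R)) (r : R) (m : nat).
Variable delta : R.
Hypothesis delta_gt0 : 0 < delta.

Lemma mem_earlier (v t : 'I_n) : (v \in earlier t) = (v < t)%N.
Proof. by rewrite mem_filter mem_enum andbT. Qed.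

Lemma earlier_uniq (t : 'I_n) : uniq (earlier t).
Proof. by rewrite filter_uniq// enum_uniq. Qed.

Lemma size_earlier (t : 'I_n) : size (earlier t) = t.
Proof.
rewrite -(card_uniqP (earlier_uniq t)) -[RHS](card_ord_lt (ltnW (ltn_ord t))).
by apply: eq_card => v; rewrite mem_earlier inE.
Qed.

Lemma dexp_pick_uniform (t : 'I_n) (s : seq 'I_n) (A : pred 'I_n) :
  uniq s -> {subset s <= earlier t} -> (t <= 2 * size s)%N -> (0 < size s)%N ->
  dexp (dpick (fun=> 1) s) (fun z => 2 ^+ A z) <=
    1 + 2 * (cnt A t)%:R / t%:R :> R.
Proof.
move=> us st ts s0.
have t0 : (0 < t)%N.
  by case: s s0 st {us ts} => // z s _ /(_ z (mem_head _ _)); rewrite mem_earlier; case: t => -[].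
rewrite dexp_pick big_const_seq count_predT iter_addr_0.
have -> : \sum_(a <- s) 1 * 2 ^+ A a = (size s)%:R + (count A s)%:R :> R.
  rewrite -sum1_size -sum1_count !natr_sum [in RHS](big_mkcond A)/= -big_split/=.
  by apply: eq_bigr => a _; rewrite mul1r; case: (A a); rewrite ?expr1 ?expr0 ?addr0.
rewrite -/(_%:R) mulrDl divff ?pnatr_eq0 -?lt0n// lerD2l.
have cA : (count A s <= cnt A t)%N.
  rewrite -size_filter -(card_uniqP (filter_uniq A us)).
  apply: subset_leq_card; apply/fintype.subsetP => v.
  by rewrite mem_filter !inE => /andP[-> /st]; rewrite mem_earlier.
rewrite ler_pdivrMr ?ltr0n// mulrAC ler_pdivlMr ?ltr0n//.
rewrite -!natrM ler_nat mulnAC mulnC leq_mul//.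
Qed.

Definition hybrid_inv (t : nat) (s : mgraph n * mgraph n) : Prop :=
  local_inv x r m t s.1.

Lemma hybrid_layered :
  layered x r m delta (hybrid_step x r m delta) hybrid_inv.
Proof.
have pd (t : 'I_n) : (0 < size (earlier t))%N ->
    is_dist (dpick (fun=> 1 : R) (earlier t)) by exact: is_dist_pick.
have tail_dist (t : 'I_n) (L F : mgraph n) : is_dist
    (if earlier t is [::] then dret R (L, F)
     else dbind (dpick (fun=> 1) (earlier t)) (fun z => dret R (L, (t, z) :: F))).
  case E : (earlier t) => [|z s]; first exact: is_dist_ret.
  rewrite -E; apply: (is_dist_bind (P := fun=> True)).
  - by apply: pd; rewrite E.
  - exact: dall_true.
  - by move=> *; exact: is_dist_ret.
have adds (t : 'I_n) s : dall (fun s' => adds_at x r m t s.1 s'.1)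
    (hybrid_step x r m delta t s).
  apply: dall_bind (base_step_adds _ _ _ _ _ _) _ => L' LL'.
  case: (earlier t) => [|z u]; first by split.
  by apply: (dall_bind (P := fun=> True)); [exact: dall_true|split].
split.
- by split.
- move=> t s _; apply: (is_dist_bind (P := fun=> True)) => //.
    exact: base_step_dist.
  exact: dall_true.
- move=> t s Is; apply: dall_imp (adds t s) => s'; exact: adds_at_inv.
- by [].
- by move=> t s _; exact: adds.
- move=> t s f _; rewrite dexp_bind; apply: dexp_eq => L.
  case E : (earlier t) => [|z u]; first by rewrite dexp_ret.
  rewrite -E dexp_bind; under dexp_eq => a do rewrite dexp_ret/=.
  by rewrite dexp_cst//; apply: pd; rewrite E.
- move=> t s A _; rewrite dexp_bind.
  rewrite -[leRHS](dexp_cst _ (base_step_dist x r m delta_gt0 t s.1)).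
  apply: (dexp_le (P := fun=> True)); [exact: base_step_dist|exact: dall_true|].
  move=> L _; case E : (earlier t) => [|z u].
    rewrite dexp_ret/= ler_peMl ?exprn_ge0//.
    by rewrite mulr_ege1 ?exprn_ege1 ?ler1n// lerDl divr_ge0// mulr_ge0.
  rewrite -E dexp_bind; under dexp_eq => a do rewrite dexp_ret.
  apply: (@le_trans _ _ (dexp (dpick (fun=> 1) (earlier t))
      (fun z => 2 ^+ (A t + touching A s.2) * 2 ^+ A z))).
    apply: (dexp_le (P := fun=> True)); [|exact: dall_true|].
      by apply: pd; rewrite E.
    move=> a _; rewrite -exprD ler_weXn2l ?ler1n//= /touching /=.
    rewrite addnAC leq_add2r; case: (A t) (A a) (t != a) => [] [] [] //.
  rewrite dexpZ exprD -mulrA -[leRHS]mulrA ler_wpM2l ?exprn_ge0// mulrC.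
  rewrite ler_wpM2r ?exprn_ge0//.
  apply: dexp_pick_uniform => //.
  + exact: earlier_uniq.
  + by rewrite size_earlier leq_pmull.
  + by rewrite E.
Qed.

End hybrid.

(** * The self-loop model *)

Section selfloop.
Variables (R : realType) (n : nat) (x : n.-tuple (vec3 R)) (r : R) (m : nat).
Variable delta : nat.
Hypothesis delta_ge4 : (4 <= delta)%N.

Definition loops (v : 'I_n) (F : mgraph n) : nat := count_mem (v, v) F.

(** The last clause is the loop budget: every arrival brings [delta] flexible loops and every
    arrival but the first destroys two. *)
Definition selfloop_inv (t : nat) (s : mgraph n * mgraph n) : Prop :=
  [/\ local_inv x r m t s.1,
    (forall v, (loops v s.2 <= delta)%N),
    (forall v : 'I_n, (t <= v)%N -> loops v s.2 = 0%N) &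
    (\sum_v loops v s.2 + 2 * t.-1 = delta * t)%N].

Let avail (t : 'I_n) (F : mgraph n) :=
  [seq z <- earlier t | (z, z) \in nseq delta (t, t) ++ F].

Let avail_uniq t F : uniq (avail t F).
Proof. by rewrite filter_uniq// earlier_uniq. Qed.

Let mem_avail t F (z : 'I_n) : (z \in avail t F) = (z < t)%N && (0 < loops z F)%N.
Proof.
rewrite mem_filter mem_earlier andbC mem_cat mem_nseq; case: ltnP => //= zt.
rewrite (_ : (z, z) == (t, t) = false) ?andbF /=.
  by rewrite -has_count has_pred1.
by apply/eqP => -[zt']; rewrite zt' ltnn in zt.
Qed.

(** The [delta * t - 2 * (t - 1)] remaining loops are spread with at most [delta] per vertex. As
    [delta >= 4], at least half of the earlier vertices still own one. *)
Let size_avail (t : 'I_n) s : selfloop_inv t s -> (t <= 2 * size (avail t s.2))%N.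
Proof.
case=> _ l1 l2 l3.
have : (\sum_v loops v s.2 <= delta * size (avail t s.2))%N.
  rewrite -(card_uniqP (avail_uniq t s.2)) -sum1_card big_distrr/=.
  rewrite [leqRHS]big_mkcond/=; apply: leq_sum => v _; rewrite muln1 mem_avail.
  case: (ltnP v t) => vt /=; last by rewrite l2.
  by case: ifPn => [_|]; [exact: l1|rewrite -eqn0Ngt => /eqP ->].
move: l3 delta_ge4; case: (t : nat) => [|k] //=.
move: (size _) (\sum_v _)%N => a b; nia.
Qed.

Let loops_rem (u v : ordinal n) F : loops u (seq.rem (v, v) F) = (loops u F - (u == v) * ((v, v) \in F))%N.
Proof.
by rewrite /loops count_rem /= xpair_eqE andbb eq_sym mulnb andbC.
Qed.

Let touching_rem (A : pred (ordinal n)) v F : touching A (seq.rem (v, v) F) = touching A F.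
Proof. by rewrite /touching count_rem /= eqxx andbF subn0. Qed.

Lemma selfloop_layered :
  layered x r m delta%:R (selfloop_step x r m delta) selfloop_inv.
Proof.
have d0 : 0 < delta%:R :> R by rewrite ltr0n; case: delta delta_ge4.
have pd (t : 'I_n) s : selfloop_inv t s -> (0 < t)%N ->
    is_dist (dpick (fun=> 1 : R) (avail t s.2)).
  move=> /size_avail ts t0; apply: is_dist_pick => //.
  by move: ts; case: (size _) => //; rewrite muln0 leqNgt t0.
have tail_dist (t : 'I_n) s (L : mgraph n) : selfloop_inv t s -> is_dist
    (let F := nseq delta (t, t) ++ s.2 in
     if earlier t is [::] then dret R (L, F)
     else dbind (dpick (fun=> 1 : R) [seq z <- earlier t | (z, z) \in F]) (fun z =>
      dret R (L, (t, z) :: seq.rem (t, t) (seq.rem (z, z) F)))).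
  move=> Is /=; case E : (earlier t) => [|z u]; first exact: is_dist_ret.
  rewrite -E; apply: (is_dist_bind (P := fun=> True)).
  - by apply: pd => //; rewrite -(size_earlier t) E.
  - exact: dall_true.
  - by move=> *; exact: is_dist_ret.
have adds (t : 'I_n) s : dall (fun s' => adds_at x r m t s.1 s'.1)
    (selfloop_step x r m delta t s).
  apply: dall_bind (base_step_adds _ _ _ _ _ _) _ => L' LL'.
  case: (earlier t) => [|z u]; first by split.
  by apply: (dall_bind (P := fun=> True)); [exact: dall_true|split].
split.
- by split => //=; rewrite big1 ?muln0.
- move=> t s Is; apply: (is_dist_bind (P := fun=> True)).
  + exact: base_step_dist.
  + exact: dall_true.
  + by move=> L _; exact: tail_dist.
- move=> t s Is; have [l0 l1 l2 l3] := Is.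
  apply: dall_bind (base_step_adds _ _ _ _ _ _) _ => L' /(adds_at_inv l0) LI.
  have lnew v : loops v (nseq delta (t, t) ++ s.2) = ((v == t) * delta + loops v s.2)%N.
    by rewrite /loops count_cat count_nseq /= xpair_eqE andbb eq_sym.
  case E : (earlier t) => [|z u].
    have t0 : t = 0%N :> nat by rewrite -(size_earlier t) E.
    split=> //; split => //=.
    + move=> v; rewrite lnew; case: eqP => [->|_]; last exact: l1.
      by rewrite l2// mul1n addn0.
    + move=> v tv; rewrite lnew l2 ?(ltnW tv)// addn0.
      by case: eqP tv => // ->; rewrite ltnn.
    + under eq_bigr => v _ do rewrite lnew.
      rewrite big_split /= (bigD1 t)//= eqxx big1 => [|v /negbTE ->//].
      by move: l3; rewrite t0 /=; lia.
  rewrite -E; have t0 : (0 < t)%N by rewrite -(size_earlier t) E.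
  apply: dall_bind (dall_pick _ _) _ => {z u E} z.
  rewrite -/(avail t s.2) mem_avail => /andP[zt lz].
  have zNt : (z == t) = false by rewrite -val_eqE /= ltn_eqF.
  have tz : (t == z) = false by rewrite eq_sym.
  (* The newcomer keeps [delta - 1] loops and [z] loses one. The truncated subtraction is exact
     because [z] was chosen among the vertices with a loop. *)
  have lnew' v : loops v ((t, z) :: seq.rem (t, t) (seq.rem (z, z)
      (nseq delta (t, t) ++ s.2))) =
      ((v == t) * delta.-1 + (loops v s.2 - (v == z)))%N.
    rewrite {1}/loops /= -/(loops _ _) xpair_eqE.
    rewrite (_ : (t == v) && (z == v) = false) ?add0n; last first.
      by apply/negP => /andP[/eqP <-]; rewrite zNt.
    rewrite loops_rem loops_rem lnew.
    have -> : (z, z) \in nseq delta (t, t) ++ s.2.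
      by rewrite mem_cat -[X in _ || X]has_pred1 has_count lz orbT.
    have -> : (t, t) \in seq.rem (z, z) (nseq delta (t, t) ++ s.2).
      rewrite -has_pred1 has_count -/(loops _ _) loops_rem lnew eqxx eq_sym zNt.
      by rewrite mul0n subn0 mul1n addn_gt0; case: delta delta_ge4.
    rewrite !muln1; case: (eqVneq v t) => [->|vt].
      rewrite l2// tz; lia.
    by rewrite !mul0n !add0n subn0.
  move: ((t, z) :: _) lnew' => F' lnew'; split=> //; split => //=.
  + move=> v; rewrite lnew'; case: eqP => [->|_].
      by rewrite l2//; lia.
    by rewrite mul0n add0n (leq_trans (leq_subr _ _)).
  + move=> v tv; rewrite lnew' l2 ?(ltnW tv)// addn0.
    by case: eqP tv => // ->; rewrite ltnn.
  + under eq_bigr => v _ do rewrite lnew'.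
    have sz : (\sum_(v < n) (loops v s.2 - (v == z)) + 1 = \sum_v loops v s.2)%N.
      rewrite (bigD1 z)//= [RHS](bigD1 z)//= eqxx addnAC subnK//; congr (_ + _)%N.
      by apply: eq_bigr => v /negbTE ->; rewrite subn0.
    rewrite big_split /= (bigD1 t)//= eqxx big1 => [|v /negbTE ->//].
    move: l3 t0 delta_ge4; rewrite -sz; move: (\sum_(v < n) _)%N (t : nat) => a b.
    case: b => // k /=; nia.
- by move=> t s [].
- by move=> t s _; exact: adds.
- move=> t s f Is; rewrite dexp_bind; apply: dexp_eq => L /=.
  case E : (earlier t) => [|z u]; first by rewrite dexp_ret.
  rewrite -E dexp_bind; under dexp_eq => a do rewrite dexp_ret/=.
  by rewrite dexp_cst//; apply: pd => //; rewrite -(size_earlier t) E.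
- move=> t s A Is; rewrite dexp_bind.
  rewrite -[leRHS](dexp_cst _ (base_step_dist x r m d0 t s.1)).
  have tnew : touching A (nseq delta (t, t) ++ s.2) = touching A s.2.
    by rewrite /touching count_cat count_nseq /= eqxx.
  apply: (dexp_le (P := fun=> True)); [exact: base_step_dist|exact: dall_true|].
  move=> L _ /=; case E : (earlier t) => [|z u].
    rewrite dexp_ret/= tnew ler_peMl ?exprn_ge0//.
    by rewrite mulr_ege1 ?exprn_ege1 ?ler1n// lerDl divr_ge0// mulr_ge0.
  have t0 : (0 < t)%N by rewrite -(size_earlier t) E.
  rewrite -E dexp_bind; under dexp_eq => a do rewrite dexp_ret.
  rewrite -/(avail t s.2).
  apply: (@le_trans _ _ (dexp (dpick (fun=> 1) (avail t s.2))
      (fun z => 2 ^+ (A t + touching A s.2) * 2 ^+ A z))).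
    apply: (dexp_le (P := fun=> True)); [exact: pd|exact: dall_true|].
    move=> a _; rewrite -exprD ler_weXn2l ?ler1n//= {1}/touching /=.
    rewrite -/(touching A _) !touching_rem tnew.
    by rewrite addnAC leq_add2r; case: (A t) (A a) (t != a) => [] [] [].
  rewrite dexpZ exprD -mulrA -[leRHS]mulrA ler_wpM2l ?exprn_ge0// mulrC.
  rewrite ler_wpM2r ?exprn_ge0//.
  apply: dexp_pick_uniform => //.
  + by move=> v; rewrite mem_avail mem_earlier => /andP[].
  + exact: size_avail Is.
  + by move: (size_avail Is); case: (size _) => //; rewrite muln0 leqNgt t0.
Qed.

End selfloop.

(** * Growing a community around a cell *)

(** Otherwise every increment exceeds a fraction [1 / l] of the current value, hence of the value at
    the start of its block of [l] steps. Each block then doubles the sequence, and [q] blocks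
    contradict the hypothesis. *)
Lemma slow_growth_step (a : nat -> nat) (l q : nat) :
  (0 < l)%N -> (forall i, (a i <= a i.+1)%N) -> (a (q * l)%N < 2 ^ q * a 0%N)%N ->
  exists2 i, (i < q * l)%N & (l * a i.+1 <= l.+1 * a i)%N.
Proof.
move=> l0 amono alq.
have [/existsP[i Hi]|/existsPn nH] :=
    boolP [exists i : 'I_(q * l), (l * a i.+1 <= l.+1 * a i)%N].
  by exists i.
have {}nH i : (i < q * l)%N -> (l.+1 * a i < l * a i.+1)%N.
  by move=> il; rewrite ltnNge (nH (Ordinal il)).
have block i k : (i + k <= q * l)%N -> (l * a i + k * a i <= l * a (i + k))%N.
  elim: k => [|k IH] ikl; first by rewrite mul0n !addn0.
  have aik : (a i <= a (i + k))%N.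
    by elim: k {IH ikl} => [|k IH]; rewrite ?addn0// addnS (leq_trans IH).
  rewrite addnS in ikl *; have := nH _ ikl; have := IH (ltnW ikl); lia.
suff : (2 ^ q * a 0 <= a (q * l))%N by rewrite leqNgt alq.
suff : forall j, (j <= q)%N -> (2 ^ j * a 0 <= a (j * l))%N by apply.
elim=> [_|j IH jq]; first by rewrite expn0 mul1n mul0n.
have := block (j * l)%N l; rewrite -mulSnr leq_mul2r jq orbT => /(_ isT).
rewrite -mulnDr leq_pmul2l// expnS => ?; have := IH (ltnW jq); lia.
Qed.

Lemma leq_count_in (T : eqType) (a b : pred T) (s : seq T) :
  {in s, forall e, a e -> b e} -> (count a s <= count b s)%N.
Proof.
elim: s => //= e s IH ab; apply: leq_add.
  by have := ab e (mem_head _ _); case: (a e) => // ->.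
by apply: IH => u us; apply: ab; rewrite inE us orbT.
Qed.

Section grow.
Variables (R : realType) (n : nat) (x : n.-tuple (vec3 R)) (r : R) (m : nat).
Variables (L F : mgraph n) (Q : nat -> pred 'I_n) (T0 : nat).
Hypothesis LI : local_inv x r m n L.
Hypothesis QS : forall j u w, Q j u ->
  [|| u == w, near x r u w | near x r w u] -> Q j.+1 w.
Hypothesis late : forall t : 'I_n, Q 0 t -> (T0 <= t)%N ->
  ~~ misses t [pred y : 'I_n | Q 0 y && (y < t)%N] L.
Hypothesis early : forall u w : 'I_n, Q 0 u -> Q 0 w -> (u < T0)%N -> (w < T0)%N ->
  exists2 t : 'I_n, Q 0 t & ~~ misses t (pred1 u) L && ~~ misses t (pred1 w) L.

Let G := L ++ F.

Let nbrs (S : {set 'I_n}) : {set 'I_n} :=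
  [set w | (w \in S) || [exists u in S, ((u, w) \in L) || ((w, u) \in L)]]%SET.

Let S0 : {set 'I_n} := [set v | Q 0 v]%SET.
(** Growth follows local edges rather than the regions [Q j]: connectedness is then inherited from
    the cell, while [QS] keeps [grown j] inside [Q j]. *)
Let grown j := iter j nbrs S0.

Let adj_sym S : symmetric (adjacent_in G S).
Proof.
by move=> u v; rewrite /adjacent_in/= andbCA orbC.
Qed.

Let adj_csym S : connect_sym (adjacent_in G S).
Proof. exact/sym_connect_sym/adj_sym. Qed.

Let adj_edge (S : {set 'I_n}) u v : u \in S -> v \in S -> (u, v) \in L ->
  connect (adjacent_in G S) u v.
Proof. by move=> uS vS uvL; apply: connect1; rewrite /adjacent_in/= uS vS mem_cat uvL. Qed.

Let adj_sub (S S' : {set 'I_n}) u v : (S \subset S') ->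
  connect (adjacent_in G S) u v -> connect (adjacent_in G S') u v.
Proof.
move=> /fintype.subsetP SS'; apply: connect_sub => a b; rewrite /adjacent_in => /and3P[aS bS ab].
by apply: connect1; rewrite /= !SS'.
Qed.

Let hit (t : 'I_n) (E : pred 'I_n) : ~~ misses t E L -> exists2 y, E y & (t, y) \in L.
Proof.
move=> /allPn[[a y] /= ayL]; rewrite negb_imply negbK => /andP[/eqP <- Ey].
by exists y.
Qed.

(** By [late], each vertex descends through ever earlier vertices of the cell to one older than
    [T0]. Two such old vertices are joined through the common neighbour given by [early]. *)
Let cell_connected u w : Q 0 u -> Q 0 w -> connect (adjacent_in G S0) u w.
Proof.
have down k (v : 'I_n) : (v < k)%N -> Q 0 v -> exists2 v', Q 0 v' && (v' < T0)%N &
    connect (adjacent_in G S0) v v'.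
  elim: k v => // k IH v; rewrite ltnS => vk Qv.
  case: (ltnP v T0) => [vT|Tv]; first by exists v; rewrite ?Qv.
  have [y /= /andP[Qy yv] vy] := hit (late Qv Tv).
  have [v' Hv' yv'] := IH y (leq_trans yv vk) Qy.
  exists v' => //; apply: connect_trans yv'; apply: adj_edge => //; by rewrite inE.
move=> Qu Qw.
have [u' /andP[Qu' u'T] uu'] := down n u (ltn_ord u) Qu.
have [w' /andP[Qw' w'T] ww'] := down n w (ltn_ord w) Qw.
apply: connect_trans uu' _; rewrite adj_csym; apply: connect_trans ww' _.
have [t Qt /andP[/hit[_ /eqP -> tu] /hit[_ /eqP -> tw]]] := early Qu' Qw' u'T w'T.
apply: (connect_trans (y := t)).
  by rewrite adj_csym; apply: adj_edge; rewrite ?inE.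
by apply: adj_edge; rewrite ?inE.
Qed.

Let grownS j : grown j \subset grown j.+1.
Proof. by apply/fintype.subsetP => v; rewrite /grown iterS inE => ->. Qed.

Let grown_mono i j : (i <= j)%N -> grown i \subset grown j.
Proof.
move=> /subnK <-; elim: (j - i)%N => [|k IH]; first by rewrite add0n.
exact: fintype.subset_trans IH (grownS _).
Qed.

Let grown_nbr j u w : u \in grown j -> ((u, w) \in L) || ((w, u) \in L) ->
  w \in grown j.+1.
Proof.
move=> uj uw; rewrite /grown iterS inE; apply/orP; right.
by apply/existsP; exists u; rewrite uj.
Qed.

Let grown_Q j v : v \in grown j -> Q j v.
Proof.
elim: j v => [|j IH] v; first by rewrite inE.
rewrite /grown iterS inE => /orP[/IH Qv|/existsP[u /andP[/IH Qu]]].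
  by apply: QS Qv _; rewrite eqxx.
have /(_ _ _) edge := LI.1.
case/orP => /edge /andP[_ /= /orP[/eqP E|E]]; apply: QS Qu _.
- by rewrite E eqxx.
- by rewrite E !orbT.
- by rewrite E eqxx.
- by rewrite E orbT.
Qed.

Let grown_connected j u w : u \in grown j -> w \in grown j ->
  connect (adjacent_in G (grown j)) u w.
Proof.
suff base v : v \in grown j ->
    exists2 v0, Q 0 v0 & connect (adjacent_in G (grown j)) v v0.
  move=> /base[u0 Qu0 uu0] /base[w0 Qw0 ww0].
  apply: connect_trans uu0 _; rewrite adj_csym; apply: connect_trans ww0 _.
  by apply: adj_sub (cell_connected Qw0 Qu0); exact: (@grown_mono 0%N).
elim: j v => [|j IH] v; first by rewrite inE => Qv; exists v.
have up v0 : v \in grown j.+1 -> v0 \in grown j ->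
    ((v0, v) \in L) || ((v, v0) \in L) ->
    exists2 v0, Q 0 v0 & connect (adjacent_in G (grown j.+1)) v v0.
  move=> vj v0j vv0; have [w0 Qw0 /(adj_sub (grownS j)) v0w0] := IH _ v0j.
  exists w0 => //; apply: connect_trans v0w0.
  have v0j' := fintype.subsetP (grownS j) _ v0j.
  by case/orP: vv0 => [|] H; [rewrite adj_csym|]; exact: adj_edge.
move=> vj; move: (vj); rewrite {1}/grown iterS inE => /orP[/IH[v0 Qv0 vv0]|].
  by exists v0 => //; exact: adj_sub (grownS j) vv0.
by move=> /existsP[a /andP[aj av]]; exact: up aj av.
Qed.

Let vol_ge (S : {set 'I_n}) : (m * #|S| <= vol G S)%N.
Proof.
rewrite mulnC -sum_nat_const; apply: leq_sum => v _.
have /andP[+ _] := LI.2 v (ltn_ord v); move=> /leq_trans; apply.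
rewrite /deg /G count_cat; apply: leq_trans (leq_addr _ _).
by apply: sub_count => e /= ->.
Qed.

(** The creator of a crossing edge is not in [grown i.*2], since its contact would then be in
    [grown i.*2.+1]. If it is outside [grown i.*2.+1], its contact is inside, which puts it in the
    next set. *)
Let cut_grown i : (Defs.cut G (grown i.*2.+1) <=
  2 * m * (#|grown i.+1.*2| - #|grown i.*2|) + touching (Q i.*2.+1) F)%N.
Proof.
rewrite /Defs.cut /G count_cat; apply: leq_add; last first.
  apply: sub_count => e /= eS; apply/andP; split.
    by apply: contraNneq eS => ->.
  have := @grown_Q i.*2.+1 e.1; have := @grown_Q i.*2.+1 e.2.
  by case: (e.1 \in _) eS => [_ _ -> //|]; case: (e.2 \in _) => // _ -> //; rewrite orbT.
pose B : pred 'I_n := [pred v | (v \in grown i.+1.*2) && (v \notin grown i.*2)].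
apply: leq_trans (_ : (_ <= 2 * m * cnt B n)%N) _; last first.
  rewrite leq_mul2l; apply/orP; right.
  have sub : grown i.*2 \subset grown i.+1.*2 by apply: grown_mono; lia.
  rewrite -(cardsDS sub); apply: subset_leq_card; apply/fintype.subsetP => v.
  by move=> /andP[/andP[v1 v2] _]; rewrite finset.in_setD v2.
apply: leq_trans (local_inv_count B LI); apply: leq_count_in => e eL /=.
have eL' : (e.1, e.2) \in L by case: e eL.
have n1 := @grown_nbr i.*2 e.1 e.2; rewrite eL' in n1.
have n2 := @grown_nbr i.*2.+1 e.2 e.1; rewrite eL' orbT in n2.
have s1 := fintype.subsetP (grownS i.*2) e.1.
have s2 := fintype.subsetP (grownS i.*2.+1) e.1.
change ((e.1 \in grown i.*2.+1) != (e.2 \in grown i.*2.+1) ->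
  (e.1 \in grown i.*2.+2) && (e.1 \notin grown i.*2)).
move: n1 n2 s1 s2.
case: (e.1 \in grown i.*2) => [/(_ isT isT) -> _ /(_ isT) -> //|_ n2 _ s2].
case: (boolP (e.1 \in grown i.*2.+1)) s2 => [_ /(_ isT) -> //|_ _].
by case: (e.2 \in _) n2 => // /(_ isT isT) ->.
Qed.

Lemma grow_community (l : nat) : (0 < l)%N -> (0 < m)%N ->
  (cnt (Q (l * l).*2) n < 2 ^ l * cnt (Q 0) n)%N ->
  (2 * cnt (Q (l * l).*2) n <= n)%N ->
  exists S : {set 'I_n}, [/\ forall v, Q 0 v -> v \in S, connected_set G S,
    (cnt (Q 0) n <= #|S| <= cnt (Q (l * l).*2) n)%N &
    conductance R G S <= 2 / l%:R +
      (touching (Q (l * l).*2) F)%:R / (m%:R * (cnt (Q 0) n)%:R)].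
Proof.
move=> l0 m0 Ql Qn.
have c0 : cnt (Q 0) n = #|grown 0|.
  by apply: eq_card => v; rewrite !inE ltn_ord andbT.
have cj j : (#|grown j| <= cnt (Q j) n)%N.
  apply: subset_leq_card; apply/fintype.subsetP => v /grown_Q Qv.
  by rewrite !inE Qv ltn_ord.
have Qmono i j v : (i <= j)%N -> Q i v -> Q j v.
  move=> /subnK <-; elim: (j - i)%N => // k IH /IH Qv.
  by apply: QS Qv _; rewrite eqxx.
(* There are [l] blocks of [l] double steps, hence the outer index [(l * l).*2]. *)
have [||i il li] := @slow_growth_step (fun i => #|grown i.*2|) l l l0.
- by move=> i; apply/subset_leq_card/grown_mono; lia.
- by apply: leq_ltn_trans (cj _) _; rewrite -c0.
have iJ : (i.*2.+1 <= (l * l).*2)%N by lia.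
exists (grown i.*2.+1).
have S0S : (cnt (Q 0) n <= #|grown i.*2.+1|)%N.
  by rewrite c0; apply/subset_leq_card/grown_mono.
have SJ : (#|grown i.*2.+1| <= cnt (Q (l * l).*2) n)%N.
  apply: leq_trans (cj _) _; apply: sub_cnt => v; exact: Qmono.
have c00 : (0 < cnt (Q 0) n)%N.
  by rewrite lt0n; apply: contraTneq Ql => ->; rewrite muln0.
split.
- move=> v Qv; apply: (fintype.subsetP (@grown_mono 0%N _ _)) => //.
  by rewrite inE.
- apply/andP; split.
    by rewrite -card_gt0 (leq_trans c00).
  by apply/forall_inP => u uS; apply/forall_inP => v vS; exact: grown_connected.
- by rewrite S0S.
set S := grown i.*2.+1 in S0S SJ *.
have sl : (l * (#|grown i.+1.*2| - #|grown i.*2|) <= #|S|)%N.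
  have : (#|grown i.*2| <= #|S|)%N by apply/subset_leq_card/grown_mono.
  move: li => /=; lia.
(* As [S] has at most half of the vertices, its complement is at least as large, and every vertex
   has degree at least [m]. *)
have volm : (m * #|S| <= minn (vol G S) (vol G (~: S)%SET))%N.
  rewrite leq_min vol_ge (leq_trans _ (vol_ge _))// leq_mul2l.
  by rewrite -(leq_add2l #|S|) cardsC card_ord; lia.
have S_gt0 : (0 < #|S|)%N by exact: leq_trans S0S.
have mS0 : 0 < m%:R * #|S|%:R :> R by rewrite mulr_gt0 ?ltr0n.
rewrite /conductance; apply: (@le_trans _ _ ((Defs.cut G S)%:R / (m%:R * #|S|%:R))).
  rewrite ler_wpM2l// lef_pV2 ?posrE//.
    by rewrite -natrM ler_nat.
  by rewrite ltr0n; apply: leq_trans volm; rewrite muln_gt0 m0.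
apply: (@le_trans _ _ ((2 * m * (#|grown i.+1.*2| - #|grown i.*2|))%:R /
    (m%:R * #|S|%:R) + (touching (Q (l * l).*2) F)%:R / (m%:R * #|S|%:R))).
  rewrite -mulrDl ler_wpM2r ?invr_ge0 ?(ltW mS0)// -natrD ler_nat.
  apply: leq_trans (cut_grown i) _; rewrite leq_add2l.
  apply: sub_count => e /andP[/= -> /=].
  by case/orP => /(Qmono _ _ _ iJ) ->; rewrite ?orbT.
apply: lerD.
  rewrite ler_pdivrMr// mulrAC ler_pdivlMr ?ltr0n// -!natrM ler_nat.
  move: sl; move: (_ - _)%N => a; nia.
rewrite ler_wpM2l// lef_pV2 ?posrE//.
  by rewrite ler_wpM2l// ler_nat.
by rewrite mulr_gt0 ?ltr0n.
Qed.

End grow.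

(** * Cubes centred on the sphere *)

Section trigonometry.
Variable R : realType.
Implicit Types a b x : R.

Lemma sin_mvt a b : a <= b -> exists2 c, a <= c <= b & sin b - sin a = cos c * (b - a).
Proof.
move=> ab; have [|c] := @MVT_segment R sin cos a b ab.
  exact/continuous_subspaceT/continuous_sin.
by rewrite in_itv /=; exists c.
Qed.

Lemma dist_sin a b : `|sin a - sin b| <= `|a - b|.
Proof.
wlog ab : a b / a <= b => [H|].
  by have [/H//|/ltW/H] := leP a b; rewrite distrC [leRHS]distrC.
have [c _ E] := sin_mvt ab.
by rewrite distrC E normrM [leRHS]distrC ler_piMl// cos_max.
Qed.

Lemma sqr_sin_le x : sin x ^+ 2 <= x ^+ 2.
Proof.
have := dist_sin x 0; rewrite sin0 !subr0 => H.
by rewrite -[leLHS]real_normK ?num_real// -[leRHS]real_normK ?num_real// lerXn2r.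
Qed.

Lemma cos_half_ge x : - (pi / 2) <= x <= pi / 2 -> 2^-1 <= cos (x / 2).
Proof.
move=> /andP[x1 x2]; have := @pihalf_lt2 R; have p1 := @pihalf_ge1 R => p2.
have c0 : 0 <= cos (x / 2) by apply: cos_ge0_pihalf; lra.
have c1 : 0 <= cos x by apply: cos_ge0_pihalf; lra.
have e : cos x = 2 * cos (x / 2) ^+ 2 - 1.
  by rewrite [in LHS](_ : x = x / 2 + x / 2) ?cosD; [|by field]; rewrite -!expr2 sin2cos2; ring.
rewrite leNgt; apply/negP => lt; move: c1; rewrite e; nra.
Qed.

(** The mean value theorem on [0, x / 2], where cosine is at least 1/2, followed by the duplication
    formula. *)
Lemma sin_ge_quarter x : 0 <= x <= pi / 2 -> x / 4 <= sin x.
Proof.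
move=> /andP[x0 x1]; have p2 := @pihalf_lt2 R; have p1 := @pihalf_ge1 R.
have hx : x / 4 <= sin (x / 2).
  have [|c /andP[c0 c1] E] := @sin_mvt 0 (x / 2); first by lra.
  have /cos_half_ge : - (pi / 2) <= 2 * c <= pi / 2 by apply/andP; split; lra.
  rewrite [2 * c]mulrC mulfK ?pnatr_eq0// => cc.
  move: E; rewrite sin0 !subr0 => ->; nra.
have -> : sin x = 2 * (sin (x / 2) * cos (x / 2)).
  by rewrite [in LHS](_ : x = x / 2 + x / 2) ?sinD; [|by field]; ring.
have : 2^-1 <= cos (x / 2) by apply: cos_half_ge; apply/andP; split; lra.
nra.
Qed.

Lemma oneBcos x : 1 - cos x = 2 * sin (x / 2) ^+ 2.
Proof.
rewrite [in LHS](_ : x = x / 2 + x / 2) ?cosD; last by field.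
by rewrite -!expr2 cos2sin2; ring.
Qed.

Lemma oneBcos_le x : 1 - cos x <= x ^+ 2 / 2.
Proof. by rewrite oneBcos; have := sqr_sin_le (x / 2); lra. Qed.

Lemma sin_pi_sub x : sin (pi - x) = sin x.
Proof. by rewrite sinB sinpi cospi; ring. Qed.

End trigonometry.

Section cubes.
Variable R : realType.
Implicit Types (u v w p : vec3 R) (e : R).

Local Notation rad := (@Defs.radius R).

(** The sup distance of the ambient space stands in for the angle: its triangle inequality is
    coordinatewise. *)
Definition box u v e : bool :=
  [&& `|u.1.1 - v.1.1| <= e, `|u.1.2 - v.1.2| <= e & `|u.2 - v.2| <= e].

Definition cube u e : set (vec3 R) := [set v | box u v e].

Definition on_sphere u : Prop := u.1.1 ^+ 2 + u.1.2 ^+ 2 + u.2 ^+ 2 = rad ^+ 2.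

Lemma box_sym u v e : box u v e = box v u e.
Proof. by rewrite /box !(distrC _ v.1.1) !(distrC _ v.1.2) !(distrC _ v.2). Qed.

Lemma box_trans u v w e e' : box u v e -> box v w e' -> box u w (e + e').
Proof.
move=> /and3P[a1 a2 a3] /and3P[b1 b2 b3]; apply/and3P; split.
- by apply: le_trans (ler_distD v.1.1 _ _) _; exact: lerD.
- by apply: le_trans (ler_distD v.1.2 _ _) _; exact: lerD.
- by apply: le_trans (ler_distD v.2 _ _) _; exact: lerD.
Qed.

Lemma box_le u v e e' : e <= e' -> box u v e -> box u v e'.
Proof.
by move=> ee /and3P[a1 a2 a3]; apply/and3P; split; exact: le_trans ee.
Qed.

Lemma boxxx u e : 0 <= e -> box u u e.
Proof. by move=> e0; rewrite /box !subrr normr0 e0. Qed.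

Lemma radius_gt0 : 0 < rad.
Proof. by rewrite invr_gt0 mulr_gt0// sqrtr_gt0 pi_gt0. Qed.

Lemma sqr_radius : rad ^+ 2 = (4 * pi)^-1.
Proof.
by rewrite exprVn exprMn sqr_sqrtr ?pi_ge0//; congr (_ * _)^-1; ring.
Qed.

Lemma measurable_cube u e : measurable (cube u e).
Proof.
have -> : cube u e =
    ((fun v : vec3 R => v.1.1) @^-1` `[u.1.1 - e, u.1.1 + e]) `&`
    ((fun v : vec3 R => v.1.2) @^-1` `[u.1.2 - e, u.1.2 + e]) `&`
    ((fun v : vec3 R => v.2) @^-1` `[u.2 - e, u.2 + e]).
  apply/seteqP; split=> v /=; rewrite /cube /box /= !in_itv /= !ler_distlC.
    by move=> /and3P[].
  by move=> [[-> ->] ->].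
have mf : measurable_fun setT (fun v : vec3 R => v.1.1) by exact: measurableT_comp.
have mg : measurable_fun setT (fun v : vec3 R => v.1.2) by exact: measurableT_comp.
have mpre (f : vec3 R -> R) a b : measurable_fun setT f -> measurable (f @^-1` `[a, b]).
  by move=> m; rewrite -[X in measurable X]setTI; exact: m.
apply: measurableI; last exact: (mpre _ _ _ measurable_snd).
by apply: measurableI; [exact: (mpre _ _ _ mf)|exact: (mpre _ _ _ mg)].
Qed.

(** The squared chord length, the link between angles and coordinates. *)
Lemma cos_angle u v : on_sphere u -> on_sphere v ->
  2 * rad ^+ 2 * (1 - cos (angle u v)) =
    (u.1.1 - v.1.1) ^+ 2 + (u.1.2 - v.1.2) ^+ 2 + (u.2 - v.2) ^+ 2.
Proof.
rewrite /on_sphere => su sv; have r0 := radius_gt0.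
have r20 : 0 < rad ^+ 2 by rewrite exprn_gt0.
set d := u.1.1 * v.1.1 + u.1.2 * v.1.2 + u.2 * v.2.
have dr : -1 <= d / rad ^+ 2 <= 1.
  rewrite ler_pdivlMr// ler_pdivrMr//; apply/andP; split.
    have := sqr_ge0 (u.1.1 + v.1.1); have := sqr_ge0 (u.1.2 + v.1.2).
    have := sqr_ge0 (u.2 + v.2); rewrite /d; lra.
  have := sqr_ge0 (u.1.1 - v.1.1); have := sqr_ge0 (u.1.2 - v.1.2).
  have := sqr_ge0 (u.2 - v.2); rewrite /d; lra.
rewrite /angle -/d acosK ?in_itv//= mulrBr mulr1 -mulrA [rad ^+ 2 * _]mulrC.
by rewrite divfK ?gt_eqF// /d; lra.
Qed.

Lemma angle_itv u v : on_sphere u -> on_sphere v -> 0 <= angle u v <= pi.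
Proof.
rewrite /on_sphere => su sv; have r0 := radius_gt0.
have r20 : 0 < rad ^+ 2 by rewrite exprn_gt0.
have dr : -1 <= (u.1.1 * v.1.1 + u.1.2 * v.1.2 + u.2 * v.2) / rad ^+ 2 <= 1.
  rewrite ler_pdivlMr// ler_pdivrMr//; apply/andP; split.
    have := sqr_ge0 (u.1.1 + v.1.1); have := sqr_ge0 (u.1.2 + v.1.2).
    have := sqr_ge0 (u.2 + v.2); lra.
  have := sqr_ge0 (u.1.1 - v.1.1); have := sqr_ge0 (u.1.2 - v.1.2).
  have := sqr_ge0 (u.2 - v.2); lra.
by rewrite /angle acos_ge0// acos_lepi.
Qed.

Lemma angle_box u v r : on_sphere u -> on_sphere v ->
  angle u v <= r -> box u v (rad * r).
Proof.
move=> su sv ar; have /andP[a0 _] := angle_itv su sv.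
have E := cos_angle su sv; have C := oneBcos_le (angle u v).
have r0 := radius_gt0.
have H : 2 * rad ^+ 2 * (1 - cos (angle u v)) <= (rad * r) ^+ 2.
  have : angle u v ^+ 2 <= r ^+ 2 by rewrite lerXn2r// nnegrE (le_trans a0).
  have := sqr_ge0 rad; rewrite exprMn; nra.
have rr0 : 0 <= rad * r by rewrite mulr_ge0 ?(ltW r0) ?(le_trans a0).
have key a : a ^+ 2 <= (rad * r) ^+ 2 -> `|a| <= rad * r.
  by move=> ?; rewrite -(ler_pXn2r (n := 2)) ?nnegrE// real_normK ?num_real.
have s1 := sqr_ge0 (u.1.1 - v.1.1); have s2 := sqr_ge0 (u.1.2 - v.1.2).
have s3 := sqr_ge0 (u.2 - v.2).
by apply/and3P; split; apply: key; lra.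
Qed.

(** An angle above [r] makes the squared chord exceed [4 * (rad * r / 8) ^+ 2], because sin (r / 2)
    >= r / 8, whereas the three coordinates account for at most 3 such squares. *)
Lemma box_angle u v r : on_sphere u -> on_sphere v -> 0 <= r <= 1 ->
  box u v (rad * r / 8) -> angle u v <= r.
Proof.
move=> su sv /andP[r0 r1] /and3P[b1 b2 b3].
have /andP[a0 api] := angle_itv su sv; have R0 := radius_gt0.
have p1 := @pihalf_ge1 R.
rewrite leNgt; apply/negP => ra.
have : cos (angle u v) < cos r.
  by rewrite ltr_cos// in_itv/= ?a0 ?api// r0; lra.
have E := cos_angle su sv.
have key a e : `|a| <= e -> a ^+ 2 <= e ^+ 2.
  by move=> ae; rewrite -[leLHS]real_normK ?num_real// lerXn2r// nnegrE (le_trans _ ae).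
have k1 := key _ _ b1; have k2 := key _ _ b2; have k3 := key _ _ b3.
have : (r / 8) ^+ 2 <= sin (r / 2) ^+ 2.
  rewrite lerXn2r// ?nnegrE ?divr_ge0//; last first.
    by rewrite (_ : r / 8 = r / 2 / 4) ?sin_ge_quarter//; [apply/andP; split; lra|field].
  by apply: sin_ge0_pi; apply/andP; split; lra.
have := oneBcos r; have R2 : 0 < rad ^+ 2 by rewrite exprn_gt0.
move=> C1 C2 C3.
have : 2 * rad ^+ 2 * (1 - cos (angle u v)) <= 3 * (rad * r / 8) ^+ 2 by rewrite E; lra.
have : r ^+ 2 / 32 < 1 - cos (angle u v) by lra.
move=> H1 H2; have : 2 * rad ^+ 2 * (r ^+ 2 / 32) < 3 * (rad * r / 8) ^+ 2.
  apply: lt_le_trans H2; rewrite ltr_pM2l//; lra.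
have -> : 3 * (rad * r / 8) ^+ 2 = rad ^+ 2 * r ^+ 2 * (3 / 64) by field.
have : 0 <= rad ^+ 2 * r ^+ 2 by rewrite mulr_ge0// sqr_ge0.
lra.
Qed.

Lemma on_sphere_spherical (p : R * R) : on_sphere (spherical p).
Proof.
rewrite /on_sphere /spherical /=; have := cos2Dsin2 p.1; have := cos2Dsin2 p.2.
move: (cos p.1) (sin p.1) (cos p.2) (sin p.2) => c s c' s' h' h.
transitivity (rad ^+ 2 * (s ^+ 2 * (c' ^+ 2 + s' ^+ 2) + c ^+ 2)); first by ring.
by rewrite h' mulr1 addrC h mulr1.
Qed.

(** The haversine formula. *)
Lemma spherical_dist (p q : R * R) :
  let u := spherical p in let v := spherical q in
  (u.1.1 - v.1.1) ^+ 2 + (u.1.2 - v.1.2) ^+ 2 + (u.2 - v.2) ^+ 2 =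
  (2 * rad) ^+ 2 * (sin ((p.1 - q.1) / 2) ^+ 2 +
    sin p.1 * sin q.1 * sin ((p.2 - q.2) / 2) ^+ 2).
Proof.
move=> /=; rewrite exprMn -[_ * rad ^+ 2]mulrC.
have -> : rad ^+ 2 * 2 ^+ 2 * (sin ((p.1 - q.1) / 2) ^+ 2 +
    sin p.1 * sin q.1 * sin ((p.2 - q.2) / 2) ^+ 2) =
  2 * rad ^+ 2 * ((1 - cos (p.1 - q.1)) + sin p.1 * sin q.1 * (1 - cos (p.2 - q.2))).
  by rewrite !oneBcos; ring.
rewrite !cosB; have := cos2Dsin2 p.1; have := cos2Dsin2 q.1.
have := cos2Dsin2 p.2; have := cos2Dsin2 q.2.
move: (cos p.1) (sin p.1) (cos p.2) (sin p.2) (cos q.1) (sin q.1) (cos q.2) (sin q.2).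
move=> c s c' s' d t d' t' h1 h2 h3 h4.
apply/eqP; rewrite -subr_eq0; apply/eqP.
transitivity (rad ^+ 2 * ((s ^+ 2 * (c' ^+ 2 + s' ^+ 2) + t ^+ 2 * (d' ^+ 2 + t' ^+ 2)
  + c ^+ 2 + d ^+ 2) - 2)); first by ring.
rewrite h1 h2 !mulr1 (_ : _ + _ - 2 = (c ^+ 2 + s ^+ 2) + (d ^+ 2 + t ^+ 2) - 2); last by ring.
by rewrite h3 h4; ring.
Qed.

Lemma cube_spherical (p q : R * R) (eta : R) : 0 <= eta ->
  0 <= sin p.1 * sin q.1 ->
  (p.1 - q.1) ^+ 2 + sin p.1 * sin q.1 * (p.2 - q.2) ^+ 2 <= eta ^+ 2 ->
  cube (spherical p) (rad * eta) (spherical q).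
Proof.
move=> e0 s0 H; have R0 := radius_gt0.
have E := spherical_dist p q; cbv zeta in E.
have h1 := sqr_sin_le ((p.1 - q.1) / 2); have h2 := sqr_sin_le ((p.2 - q.2) / 2).
have B : (2 * rad) ^+ 2 * (sin ((p.1 - q.1) / 2) ^+ 2 +
    sin p.1 * sin q.1 * sin ((p.2 - q.2) / 2) ^+ 2) <= (rad * eta) ^+ 2.
  rewrite [leRHS]exprMn; set X := _ + _.
  rewrite (_ : (2 * rad) ^+ 2 * X = rad ^+ 2 * (4 * X)); last by ring.
  apply: ler_wpM2l; first exact: sqr_ge0.
  apply: le_trans H; rewrite /X mulrDr lerD//; first by lra.
  by rewrite mulrCA ler_wpM2l//; lra.
have rr0 : 0 <= rad * eta by rewrite mulr_ge0 ?(ltW R0).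
have key a : a ^+ 2 <= (rad * eta) ^+ 2 -> `|a| <= rad * eta.
  by move=> ?; rewrite -(ler_pXn2r (n := 2)) ?nnegrE// real_normK ?num_real.
set u := spherical p in E *; set v := spherical q in E *.
have s1 := sqr_ge0 (u.1.1 - v.1.1); have s2 := sqr_ge0 (u.1.2 - v.1.2).
have s3 := sqr_ge0 (u.2 - v.2).
by apply/and3P; split; apply: key; lra.
Qed.

Lemma cube_spherical_inv (p q : R * R) (eta : R) : 0 <= eta ->
  cube (spherical p) (rad * eta) (spherical q) ->
  sin ((p.1 - q.1) / 2) ^+ 2 + sin p.1 * sin q.1 * sin ((p.2 - q.2) / 2) ^+ 2
    <= 3 / 4 * eta ^+ 2.
Proof.
move=> e0 /and3P[b1 b2 b3]; have R0 := radius_gt0.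
have R2 : 0 < rad ^+ 2 by rewrite exprn_gt0.
have E := spherical_dist p q; cbv zeta in E.
have key a e : `|a| <= e -> a ^+ 2 <= e ^+ 2.
  by move=> ae; rewrite -[leLHS]real_normK ?num_real// lerXn2r// nnegrE (le_trans _ ae).
have k1 := key _ _ b1; have k2 := key _ _ b2; have k3 := key _ _ b3.
rewrite -(ler_pM2l R2); move: E k1 k2 k3; rewrite !exprMn; lra.
Qed.

End cubes.

(** * Area of a cube from below *)

Section cube_area.
Variable R : realType.
Implicit Types (A : set (vec3 R)) (I J : set (measurableTypeR R)).

Local Notation rad := (@Defs.radius R).
Local Notation leb := (@lebesgue_measure R).

Let mpre A : measurable A -> measurable (@spherical_dom R `&` @spherical R @^-1` A).
Proof.
move=> mA; apply: measurableI; first exact: measurable_spherical_dom.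
by rewrite -[X in measurable X]setTI; exact: measurable_spherical.
Qed.

Let mdens (D : set (measurableTypeR R * measurableTypeR R)) :
  measurable_fun D (EFin \o @area_density R).
Proof.
apply: measurable_funTS; apply/measurable_EFinP; exact: measurable_area_density.
Qed.

Let prodE I J : measurable I -> measurable J ->
  (leb \x leb)%E (I `*` J) = (leb I * leb J)%E.
Proof. by move=> mI mJ; exact: product_measure1E. Qed.

Lemma sphere_area_ge A (M a1 a2 b1 b2 : R) : measurable A -> 0 <= M ->
  a1 <= a2 -> b1 <= b2 ->
  (forall p : R * R, a1 <= p.1 <= a2 -> b1 <= p.2 <= b2 ->
    [/\ 0 <= p.1 <= pi, 0 <= p.2 <= 2 * pi, A (spherical p) & M <= area_density p]) ->
  ((M * ((a2 - a1) * (b2 - b1)))%:E <= sphere_area A)%E.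
Proof.
move=> mA M0 a12 b12 H.
pose B : set (measurableTypeR R * measurableTypeR R) :=
  `[a1, a2]%classic `*` `[b1, b2]%classic.
have mB : measurable B by exact: measurableX.
have BD : B `<=` @spherical_dom R `&` @spherical R @^-1` A.
  move=> p [/=]; rewrite !in_itv/= => p1 p2.
  by have [q1 q2 qA _] := H p p1 p2; split=> //; split; rewrite /= in_itv.
apply: (@le_trans _ _ (\int[leb \x leb]_(p in B) (area_density p)%:E)%E); last first.
  apply: ge0_subset_integral => //; first exact: mpre.
  by move=> p [pD _]; rewrite lee_fin area_density_ge0.
apply: (@le_trans _ _ (\int[leb \x leb]_(p in B) cst M%:E p)%E).
  rewrite integral_cst//.
  change ((M * ((a2 - a1) * (b2 - b1)))%:E <= M%:E * (leb \x leb)%E B)%E.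
  have -> : (leb \x leb)%E B = (leb `[a1, a2]%classic * leb `[b1, b2]%classic)%E.
    by apply: prodE; exact: measurable_itv.
  rewrite !lebesgue_measure_itv/= !lte_fin.
  rewrite EFinM lee_wpmul2l ?lee_fin//.
  have itvE (u v : R) : u <= v -> (if (u < v)%R then v%:E - u%:E else 0)%E = (v - u)%:E.
    by rewrite le_eqVlt => /predU1P[->|->]; rewrite ?ltxx ?subrr ?EFinB.
  by rewrite !itvE// -EFinM.
apply: ge0_le_integral => //.
move=> p [/=]; rewrite !in_itv/= => p1 p2; rewrite lee_fin.
by have [] := H p p1 p2.
Qed.

Lemma sphere_area_le A I J (M a b : R) : measurable A -> measurable I ->
  measurable J -> 0 <= M -> (leb I <= a%:E)%E -> (leb J <= b%:E)%E ->
  (forall p : R * R, 0 <= p.1 <= pi -> 0 <= p.2 <= 2 * pi -> A (spherical p) ->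
    [/\ I p.1, J p.2 & area_density p <= M]) ->
  (sphere_area A <= (M * (a * b))%:E)%E.
Proof.
move=> mA mI mJ M0 Ia Jb H.
have HD p : (@spherical_dom R `&` @spherical R @^-1` A) p ->
    [/\ I p.1, J p.2 & area_density p <= M].
  by move=> [[/=]]; rewrite !in_itv/= => *; exact: H.
rewrite /sphere_area.
apply: (@le_trans _ _ (\int[leb \x leb]_(p in @spherical_dom R `&` @spherical R @^-1` A)
    cst M%:E p)%E).
  apply: ge0_le_integral => //.
  - exact: mpre.
  - by move=> p [pD _]; rewrite lee_fin area_density_ge0.
  - by move=> p /HD[_ _]; rewrite lee_fin.
rewrite integral_cst; last exact: mpre.
rewrite EFinM lee_wpmul2l ?lee_fin//.
apply: (@le_trans _ _ ((leb \x leb)%E (I `*` J))); last first.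
  by rewrite (prodE mI mJ) EFinM lee_pmul.
apply: le_measure; rewrite ?inE; [exact: mpre|exact: measurableX|].
by move=> p /HD[].
Qed.

(** Moving away from the pole by a length of order [eta] keeps the sine at least of order
    [sin a + eta], even when [a] is at the pole. *)
Lemma sin_shift_ge (a d eta : R) : 0 <= a <= pi / 2 -> 0 <= eta <= 1 ->
  eta / 4 <= d <= eta / 2 ->
  [/\ 0 <= a + d <= pi, sin a / 4 + eta / 32 <= sin (a + d) &
      sin (a + d) <= sin a + eta / 2].
Proof.
move=> /andP[a0 a1] /andP[e0 e1] /andP[d0 d1]; have p1 := @pihalf_ge1 R.
split; first by apply/andP; split; lra.
  have s1 : sin a / 2 <= sin (a + d).
    rewrite sinD.
    have sa : 0 <= sin a by apply: sin_ge0_pi; apply/andP; split; lra.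
    have sd : 0 <= sin d by apply: sin_ge0_pi; apply/andP; split; lra.
    have ca : 0 <= cos a by apply: cos_ge0_pihalf; apply/andP; split; lra.
    have : 2^-1 <= cos (2 * d / 2) by apply: cos_half_ge; apply/andP; split; lra.
    rewrite [2 * d]mulrC mulfK ?pnatr_eq0// => cd.
    have := mulr_ge0 ca sd; nra.
  suff s2 : eta / 16 <= sin (a + d) by lra.
  have [h|h] := leP (a + d) (pi / 2).
    by apply: le_trans (sin_ge_quarter _); [lra|apply/andP; split; lra].
  rewrite -sin_pi_sub.
  by apply: le_trans (sin_ge_quarter _); [lra|apply/andP; split; lra].
have := dist_sin (a + d) a; rewrite addrAC subrr add0r [leRHS]ger0_norm; last by lra.
by move=> H; have := le_trans (ler_norm _) H; lra.
Qed.

Lemma cube_area_ge (p : R * R) (eta : R) : 0 <= p.1 <= pi -> 0 <= p.2 <= 2 * pi ->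
  0 < eta <= 1 ->
  ((eta ^+ 2 / 1024)%:E <= sphere_area (cube (spherical p) (rad * eta)))%E.
Proof.
move=> /andP[t0 t1] /andP[f0 f1] /andP[e0 e1].
have p2 := @pihalf_lt2 R; have p1 := @pihalf_ge1 R.
have s0 : 0 <= sin p.1 by apply: sin_ge0_pi; rewrite t0.
(* [b] bounds the sine from below on a strip of polar angles shifted towards the equator, and [w] is
   the matching width in azimuth: the product [b * w] is the same at all latitudes. Since w <= 2 <=
   pi, an interval of that width fits on one side of [p.2]. *)
pose b := sin p.1 / 4 + eta / 32; have b0 : 0 < b by rewrite /b; lra.
pose w := eta / (16 * b).
have w0 : 0 < w by rewrite divr_gt0// mulr_gt0.
have w2 : w <= 2 by rewrite /w ler_pdivrMr ?mulr_gt0// /b; lra.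
have bw : b * w = eta / 16 by rewrite /w; field; rewrite gt_eqF.
have [a1 [a2 [a12 aH]]] : exists a1 a2 : R, a2 - a1 = eta / 4 /\
    forall x, a1 <= x <= a2 -> [/\ 0 <= x <= pi, `|p.1 - x| <= eta / 2,
      b <= sin x & sin x <= sin p.1 + eta / 2].
  have [h|h] := leP p.1 (pi / 2).
    exists (p.1 + eta / 4), (p.1 + eta / 2); split; first by lra.
    move=> x /andP[x1 x2].
    have [|||] := @sin_shift_ge p.1 (x - p.1) eta.
    + by rewrite t0.
    + by rewrite ltW.
    + by apply/andP; split; lra.
    rewrite addrC subrK => ? ? ?; split=> //.
    by rewrite ler_norml; apply/andP; split; lra.
  exists (p.1 - eta / 2), (p.1 - eta / 4); split; first by lra.
  move=> x /andP[x1 x2].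
  have [|||] := @sin_shift_ge (pi - p.1) (p.1 - x) eta.
  + by apply/andP; split; lra.
  + by rewrite ltW.
  + by apply/andP; split; lra.
  rewrite (_ : pi - p.1 + (p.1 - x) = pi - x) ?sin_pi_sub; last by ring.
  move=> /andP[? ?] ? ?; split=> //; first by apply/andP; split; lra.
  by rewrite ler_norml; apply/andP; split; lra.
have [b1 [b2 [b12 bH]]] : exists b1 b2 : R, b2 - b1 = w /\
    forall x, b1 <= x <= b2 -> 0 <= x <= 2 * pi /\ `|p.2 - x| <= w.
  have [h|h] := leP p.2 pi.
    exists p.2, (p.2 + w); split; first by lra.
    move=> x /andP[x1 x2]; split; first by apply/andP; split; lra.
    by rewrite ler_norml; apply/andP; split; lra.
  exists (p.2 - w), p.2; split; first by lra.
  move=> x /andP[x1 x2]; split; first by apply/andP; split; lra.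
  by rewrite ler_norml; apply/andP; split; lra.
have r0 := @sqr_radius R; have R2 : 0 < rad ^+ 2 by rewrite exprn_gt0 ?radius_gt0.
apply: le_trans (@sphere_area_ge _ (rad ^+ 2 * b) a1 a2 b1 b2 _ _ _ _ _).
- rewrite lee_fin a12 b12.
  have -> : rad ^+ 2 * b * (eta / 4 * w) = rad ^+ 2 * (eta / 4) * (b * w) by ring.
  rewrite bw (_ : _ * _ * _ = rad ^+ 2 * (eta ^+ 2 / 64)); last by field.
  have : 16^-1 <= rad ^+ 2 by rewrite r0 lef_pV2 ?posrE; lra.
  have := sqr_ge0 eta; nra.
- exact: measurable_cube.
- by rewrite mulr_ge0 ?ltW.
- by lra.
- by lra.
move=> q /aH[q1 q2 q3 q4] /bH[q5 q6]; split=> //; last first.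
  by rewrite /area_density ler_wpM2l// ltW.
have sq0 : 0 <= sin q.1 by lra.
apply: cube_spherical; [exact: ltW|exact: mulr_ge0|].
have key (a c : R) : `|a| <= c -> a ^+ 2 <= c ^+ 2.
  by move=> ae; rewrite -[leLHS]real_normK ?num_real// lerXn2r// nnegrE (le_trans _ ae).
have k1 := key _ _ q2; have k2 := key _ _ q6.
have h1 : sin p.1 * sin q.1 * (p.2 - q.2) ^+ 2 <= (4 * b) * (16 * b) * w ^+ 2.
  have ss : sin p.1 * sin q.1 <= (4 * b) * (16 * b).
    by apply: ler_pM => //; rewrite /b; lra.
  by apply: ler_pM => //; [exact: mulr_ge0|exact: sqr_ge0].
have h2 : 4 * b * (16 * b) * w ^+ 2 = eta ^+ 2 / 4.
  transitivity (64 * (b * w) ^+ 2); first by ring.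
  by rewrite bw; field.
rewrite h2 in h1; have h3 : (eta / 2) ^+ 2 = eta ^+ 2 / 4 by field.
by rewrite h3 in k1; have := sqr_ge0 eta; lra.
Qed.

End cube_area.

(** * Area of a cube from above *)

Section cube_area_upper.
Variable R : realType.

Local Notation rad := (@Defs.radius R).
Local Notation leb := (@lebesgue_measure R).

Let abs_sin_ge (x : R) : `|x| <= pi / 2 -> `|x| / 4 <= `|sin x|.
Proof.
move=> xp; have := @sin_ge_quarter R `|x|; rewrite normr_ge0 xp => /(_ isT).
move=> /le_trans; apply; case: (ger0P x) => _; first exact: ler_norm.
by rewrite sinN -normrN ler_norm.
Qed.

(** Applied to half a difference of azimuths; the zeros at pi and -pi account for the azimuth
    wrapping around. *)
Lemma abs_sin_le_cases (x k : R) : `|x| <= pi -> `|sin x| <= k ->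
  [\/ `|x| <= 4 * k, `|x - pi| <= 4 * k | `|x + pi| <= 4 * k].
Proof.
move=> xpi sk; have [c1|c1] := leP `|x| (pi / 2).
  by apply: Or31; have := le_trans (abs_sin_ge c1) sk; lra.
move: xpi c1; have [c2|c2] := ger0P x => xpi c1.
  have c3 : `|x - pi| <= pi / 2 by rewrite ler_norml; apply/andP; split; lra.
  apply: Or32; have := abs_sin_ge c3.
  by rewrite -[x - pi]opprB sinN sin_pi_sub !normrN => /le_trans /(_ sk); lra.
have c3 : `|x + pi| <= pi / 2 by rewrite ler_norml; apply/andP; split; lra.
apply: Or33; have := abs_sin_ge c3.
by rewrite sinDpi normrN => /le_trans /(_ sk); lra.
Qed.

(** Near a pole the whole circle of azimuths is allowed, and the density is itself of order [eta].
    Elsewhere the polar angle moves by at most [8 * eta], less than half of [sin p.1], so the sine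
    stays within constant factors and confines the azimuth. The two cases give 192 and at most 288
    times [eta ^+ 2]. *)
Lemma cube_area_le (p : R * R) (eta : R) : 0 <= p.1 <= pi -> 0 <= p.2 <= 2 * pi ->
  0 < eta ->
  (sphere_area (cube (spherical p) (rad * eta)) <= (300 * eta ^+ 2)%:E)%E.
Proof.
move=> /andP[t0 t1] /andP[f0 f1] e0.
have p2 := @pihalf_lt2 R; have p1 := @pihalf_ge1 R.
have s0 : 0 <= sin p.1 by apply: sin_ge0_pi; rewrite t0.
have key (a c : R) : 0 <= c -> a ^+ 2 <= c ^+ 2 -> `|a| <= c.
  by move=> c0 ?; rewrite -(ler_pXn2r (n := 2)) ?nnegrE// real_normK ?num_real.
have mc := measurable_cube (spherical p) (rad * eta).
have r0 := @sqr_radius R; have R2 : 0 < rad ^+ 2 by rewrite exprn_gt0 ?radius_gt0.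
have r1 : rad ^+ 2 * pi = 4^-1 by rewrite r0 invfM -mulrA mulVf ?mulr1// gt_eqF// pi_gt0.
have r2 : rad ^+ 2 <= 8^-1 by rewrite r0 lef_pV2 ?posrE; [lra|lra|lra].
have theta (q : R * R) : 0 <= q.1 <= pi -> 0 <= q.2 <= 2 * pi ->
    cube (spherical p) (rad * eta) (spherical q) ->
    [/\ `|p.1 - q.1| <= 8 * eta, 0 <= sin q.1 &
      sin p.1 * sin q.1 * sin ((p.2 - q.2) / 2) ^+ 2 <= 3 / 4 * eta ^+ 2].
  move=> /andP[q0 q1] _ /(cube_spherical_inv (ltW e0)) H.
  have sq0 : 0 <= sin q.1 by apply: sin_ge0_pi; rewrite q0.
  have H2 : 0 <= sin p.1 * sin q.1 * sin ((p.2 - q.2) / 2) ^+ 2.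
    by apply: mulr_ge0; [exact: mulr_ge0|exact: sqr_ge0].
  have H1 : `|sin ((p.1 - q.1) / 2)| <= eta.
    by apply: key; [exact: ltW|have := sqr_ge0 eta; lra].
  have hp : `|p.1 - q.1| <= pi by rewrite ler_norml; apply/andP; split; lra.
  have H3 : `|p.1 - q.1| / 2 / 4 <= `|sin ((p.1 - q.1) / 2)|.
    have := @abs_sin_ge ((p.1 - q.1) / 2); rewrite normrM (ger0_norm (_ : 0 <= 2^-1))//.
    by apply; lra.
  split=> //; last by have := sqr_ge0 (sin ((p.1 - q.1) / 2)); lra.
  by have := le_trans H3 H1; lra.
have I16 : (leb `[(p.1 - 8 * eta)%R, (p.1 + 8 * eta)%R]%classic <= (16 * eta)%:E)%E.
  rewrite lebesgue_measure_itv/= lte_fin ifT; last by lra.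
  by rewrite -EFinB lee_fin; lra.
have inI q1 : `|p.1 - q1| <= 8 * eta -> `[p.1 - 8 * eta, p.1 + 8 * eta]%classic q1.
  by rewrite ler_norml /= in_itv/= => /andP[? ?]; apply/andP; split; lra.
have [sl|sg] := leP (sin p.1) (16 * eta).
  apply: le_trans (@sphere_area_le R _ `[p.1 - 8 * eta, p.1 + 8 * eta]%classic
    `[0, 2 * pi]%classic (rad ^+ 2 * (24 * eta)) (16 * eta) (2 * pi) _ _ _ _ _ _ _) _ => //.
  - by apply: mulr_ge0; [exact: ltW|lra].
  - rewrite lebesgue_measure_itv/= lte_fin ifT; last by lra.
    by rewrite sube0.
  - move=> q q1 q2 /(theta _ q1 q2)[h1 h2 _]; split; [exact: inI|by rewrite /= in_itv|].
    rewrite /area_density ler_wpM2l ?(ltW R2)//.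
    have := le_trans (ler_norm _) (dist_sin q.1 p.1); rewrite [leRHS]distrC; lra.
  - rewrite lee_fin (_ : _ * _ = rad ^+ 2 * pi * (768 * eta ^+ 2)); last by ring.
    by rewrite r1; have := sqr_ge0 eta; lra.
set s := sin p.1 in s0 sg theta.
have s_gt0 : 0 < s by lra.
pose h := 16 * eta / s; have h0 : 0 < h by rewrite divr_gt0// mulr_gt0.
(* One window of azimuths and its two translates by a full turn. *)
pose J : set (measurableTypeR R) := `[p.2 - h, p.2 + h]%classic `|`
  (`[p.2 + 2 * pi - h, p.2 + 2 * pi + h]%classic `|`
   `[p.2 - 2 * pi - h, p.2 - 2 * pi + h]%classic).
have mJ : measurable J by apply: measurableU => //; exact: measurableU.
have lJ : (leb J <= (6 * h)%:E)%E.
  have one x : (leb `[(x - h)%R, (x + h)%R]%classic <= (2 * h)%:E)%E.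
    rewrite lebesgue_measure_itv/= lte_fin ifT; last by lra.
    by rewrite -EFinB lee_fin; lra.
  rewrite (_ : 6 * h = 2 * h + (2 * h + 2 * h)); last by ring.
  rewrite !EFinD; apply: le_trans (measureU2 _ _ _) _ => //; first exact: measurableU.
  apply: leeD; first exact: one.
  by apply: le_trans (measureU2 _ _ _) _ => //; apply: leeD; exact: one.
apply: le_trans (@sphere_area_le R _ `[p.1 - 8 * eta, p.1 + 8 * eta]%classic
    J (rad ^+ 2 * (3 / 2 * s)) (16 * eta) (6 * h) _ _ _ _ _ _ _) _ => //.
- by apply: mulr_ge0; [exact: ltW|lra].
- move=> q q1 q2 /(theta _ q1 q2)[h1 h2 h3].
  have ds : `|s - sin q.1| <= 8 * eta by apply: le_trans (dist_sin _ _) h1.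
  move: ds; rewrite ler_norml => /andP[ds1 ds2].
  split; [exact: inI| |]; last first.
    by rewrite /area_density ler_wpM2l ?(ltW R2)//; lra.
  have h4 : `|sin ((p.2 - q.2) / 2)| <= 2 * eta / s.
    apply: key; first by rewrite divr_ge0 ?mulr_ge0 ?ltW.
    rewrite expr_div_n ler_pdivlMr ?exprn_gt0//.
    have : s ^+ 2 / 2 <= s * sin q.1.
      by rewrite expr2 -mulrA; apply: ler_wpM2l; lra.
    have := sqr_ge0 (sin ((p.2 - q.2) / 2)); move: h3.
    move: (sin _ ^+ 2) (s * sin q.1) => y z; rewrite exprMn; clear; nra.
  have hE : h = 8 * (2 * eta / s) by rewrite /h; field; rewrite gt_eqF.
  rewrite /J /= !in_itv/=.
  move: q2 => /andP[q20 q21].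
  clear -abs_sin_ge h4 hE f0 f1 q20 q21.
  have xpi : `|(p.2 - q.2) / 2| <= pi by rewrite ler_norml; apply/andP; split; lra.
  case: (abs_sin_le_cases xpi h4); rewrite ler_norml => /andP[? ?];
    [left|right; right|right; left]; apply/andP; split; lra.
rewrite lee_fin (_ : _ * _ = rad ^+ 2 * (2304 * eta ^+ 2)); last first.
  by rewrite /h; field; rewrite gt_eqF.
by have := sqr_ge0 eta; nra.
Qed.

End cube_area_upper.

(** * Occupation counts of independent samples *)

Section iid_counts.
Context d (T : measurableType d) (R : realType) (P : probability T R).

Lemma measurable_prod_tnth n (g : nat -> T -> R) :
  (forall i, measurable_fun setT (g i)) ->
  measurable_fun setT (fun x : n.-tuple T => \prod_(i < n) g i (tnth x i)).
Proof.
move=> mg; apply: measurable_prod => i _.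
by apply: (measurableT_comp (mg i)); exact: measurable_tnth.
Qed.

(** Tonelli splits off the first coordinate. The factors are indexed by [nat] so that the induction
    can shift them. *)
Lemma iid_expectation n (g : nat -> T -> R) (c : nat -> R) :
  (forall i, measurable_fun setT (g i)) -> (forall i x, 0 <= g i x) ->
  (forall i, \int[P]_x (g i x)%:E = (c i)%:E)%E ->
  (\int[iid P n]_x (\prod_(i < n) g i (tnth x i))%:E = (\prod_(i < n) c i)%:E)%E.
Proof.
elim: n g c => [|n IH] g c mg g0 gc.
  rewrite (eq_integral (cst 1%:E)); last by move=> x _; rewrite big_ord0.
  rewrite integral_cst// big_ord0 mul1e.
  exact: (probability_setT (iid P 0)).
have mG : measurable_fun setT
    (EFin \o (fun x : n.+1.-tuple T => \prod_(i < n.+1) g i (tnth x i))).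
  by apply/measurable_EFinP; exact: measurable_prod_tnth.
rewrite /= ge0_integral_pushforward//=; last first.
  by move=> x _; rewrite lee_fin prodr_ge0.
rewrite preimage_setT fubini_tonelli1//=; last 2 first.
- exact: (measurableT_comp mG (@measurable_tuple_cons _ T n)).
- by move=> x; rewrite lee_fin prodr_ge0.
have consE a (y : n.-tuple T) : \prod_(i < n.+1) g i (tnth (tuple_cons (a, y)) i) =
    g 0%N a * \prod_(i < n) g i.+1 (tnth y i).
  rewrite big_ord_recl tnth0; congr (_ * _).
  by apply: eq_bigr => i _; rewrite tnthS.
rewrite /fubini_F /=.
rewrite (eq_integral (fun a => (\prod_(i < n) c i.+1)%:E * (g 0%N a)%:E))%E; last first.
  move=> a _.
  under eq_integral => y _ do rewrite consE EFinM.
  rewrite ge0_integralZl ?lee_fin//=.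
  - by rewrite (IH (fun i => g i.+1) (fun i => c i.+1))// muleC.
  - apply/measurable_EFinP.
    exact: (@measurable_prod_tnth n (fun i => g i.+1)).
  - by move=> y _; rewrite lee_fin prodr_ge0.
rewrite ge0_integralZl ?lee_fin//=.
- by rewrite gc big_ord_recl mulrC EFinM.
- exact/measurable_EFinP.
- by move=> a _; rewrite lee_fin.
- apply: prodr_ge0 => i _; rewrite -lee_fin -gc; apply: integral_ge0 => a _.
  by rewrite lee_fin.
Qed.

Lemma measure_ge_le d' (X : measurableType d') (mu : {measure set X -> \bar R})
    (f : X -> R) (B : R) : measurable_fun setT f -> (forall x, 0 <= f x) -> 0 < B ->
  (B%:E * mu [set x | (B <= f x)%R] <= \int[mu]_x (f x)%:E)%E.
Proof.
move=> mf f0 B0.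
have mE : measurable [set x | B <= f x].
  have -> : [set x | B <= f x] = f @^-1` `[B, +oo[.
    by apply/seteqP; split=> x /=; rewrite in_itv /= andbT.
  by rewrite -[X in measurable X]setTI; exact: mf.
rewrite -integral_cst//.
apply: (@le_trans _ _ (\int[mu]_(x in [set x | (B <= f x)%R]) (f x)%:E)%E).
  apply: ge0_le_integral => //.
  - by move=> x _; rewrite lee_fin ltW.
  - by apply: measurable_funTS; exact/measurable_EFinP.
apply: ge0_subset_integral => //; first exact/measurable_EFinP.
by move=> x _; rewrite lee_fin.
Qed.

Definition occ (A : set T) n (x : n.-tuple T) (t : nat) : nat :=
  cnt (fun v => `[< A (tnth x v) >]) t.

Lemma exp_occ (A : set T) n (x : n.-tuple T) t (s : R) :
  expR (s * (occ A x t)%:R) =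
  \prod_(i < n) (if (i < t)%N then 1 + (expR s - 1) * \1_A (tnth x i) else 1).
Proof.
rewrite /occ cntE natr_sum.
rewrite [X in expR X](_ : _ = \sum_(i < n)
   if (i < t)%N then s * \1_A (tnth x i) else 0); last first.
  rewrite big_mkcond mulr_sumr /=; apply: eq_bigr => i _.
  have -> : \1_A (tnth x i) = `[< A (tnth x i) >]%:R :> R.
    by rewrite indicE; congr (nat_of_bool _)%:R; apply/idP/asboolP => /[!inE].
  by case: asboolP => Ai; case: (i < t)%N; rewrite /= ?mulr1 ?mulr0.
rewrite expR_sum; apply: eq_bigr => i _; case: ifP => // _; rewrite ?expR0//.
by rewrite indicE; case: (_ \in A); rewrite ?mulr1 ?mulr0 ?expR0 ?addr0//; ring.
Qed.

Lemma measurable_exp_occ (A : set T) n t (s : R) : measurable A ->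
  measurable_fun setT (fun x : n.-tuple T => expR (s * (occ A x t)%:R)).
Proof.
move=> mA; pose g (i : nat) (y : T) : R :=
  if (i < t)%N then 1 + (expR s - 1) * \1_A y else 1.
have E (x : n.-tuple T) :
  expR (s * (occ A x t)%:R) = \prod_(i < n) g i (tnth x i) by exact: exp_occ.
rewrite (funext E).
apply: measurable_prod_tnth => i.
by rewrite /g; case: (i < t)%N => //; apply: measurable_funD => //; exact: measurable_funM.
Qed.

(* Negative values of [s] give the lower tail. *)
Lemma iid_chernoff (A : set T) n t (s B p : R) : measurable A -> (t <= n)%N ->
  P A = p%:E ->
  (iid P n [set x | (B <= s * (occ A x t)%:R)%R] <=
    (expR ((expR s - 1) * p * t%:R - B))%:E)%E.
Proof.
move=> mA tn Ap.
have p0 : 0 <= p by rewrite -lee_fin -Ap.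
have p1 : p <= 1 by rewrite -lee_fin -Ap probability_le1.
pose g (i : nat) (y : T) : R := if (i < t)%N then 1 + (expR s - 1) * \1_A y else 1.
have mg i : measurable_fun setT (g i).
  by rewrite /g; case: (i < t)%N => //; apply: measurable_funD => //; exact: measurable_funM.
have g0 i y : 0 <= g i y.
  rewrite /g; case: ifP => _; last exact: ler01.
  have : (\1_A y : R) = 0 \/ (\1_A y : R) = 1.
    by rewrite indicE; case: (_ \in A); [right|left].
  by case=> ->; have := expR_ge0 s; lra.
pose c (i : nat) : R := if (i < t)%N then 1 + (expR s - 1) * p else 1.
have gc i : (\int[P]_y (g i y)%:E = (c i)%:E)%E.
  rewrite /g /c; case: (i < t)%N; last first.
    by rewrite integral_cst// mul1e; exact: probability_setT.
  have -> : (\int[P]_y (1 + (expR s - 1) * \1_A y)%R%:E =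
      \int[P]_y ((\1_(~` A) y)%:E + (expR s)%:E * (\1_A y)%:E))%E.
    apply: eq_integral => y _; rewrite -EFinM -EFinD; congr EFin.
    rewrite !indicE in_setC; case: (_ \in A); rewrite /= ?mulr1 ?mulr0 ?addr0 ?add0r//.
    by rewrite addrC subrK.
  have mI (D : set T) : measurable D -> measurable_fun setT (fun y => (\1_D y : R)%:E).
    by move=> mD; exact/measurable_EFinP.
  have mcA := measurableC mA.
  rewrite ge0_integralD//; [|exact: mI|]; last first.
    by apply: emeasurable_funM => //; exact: mI.
  rewrite ge0_integralZl//; last exact: mI.
  rewrite !integral_indic ?setIT//.
  have PC : P (~` A) = (1 - p)%:E by rewrite probability_setC// Ap EFinB.
  transitivity ((1 - p)%:E + (expR s)%:E * p%:E)%E.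
    by congr (_ + _ * _)%E; [exact: PC|exact: Ap].
  by rewrite -EFinM -EFinD; congr EFin; ring.
have := measure_ge_le (iid P n) (@measurable_exp_occ A n t s mA)
  (fun x => expR_ge0 _) (expR_gt0 B).
under eq_integral => x _ do rewrite exp_occ.
rewrite (iid_expectation n mg g0 gc) => H.
have -> : [set x : n.-tuple T | B <= s * (occ A x t)%:R] =
    [set x | expR B <= expR (s * (occ A x t)%:R)].
  by apply/seteqP; split=> x /=; rewrite ler_expR.
rewrite expRB EFinM -(@lee_pmul2l _ (expR B)%:E) ?lte_fin ?expR_gt0//.
apply: le_trans H _; rewrite -!EFinM lee_fin mulrCA mulfV ?mulr1 ?gt_eqF ?expR_gt0//.
rewrite (_ : \prod_(i < n) c i = (1 + (expR s - 1) * p) ^+ t); last first.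
  rewrite -big_mkcond /= prodr_const; congr (_ ^+ _).
  exact: card_ord_lt.
rewrite expRM_natr lerXn2r ?nnegrE ?expR_ge0// ?expR_ge1Dx//.
by have := expR_ge0 s; nra.
Qed.

End iid_counts.

(** * Communities around a fixed configuration of points *)

Lemma expR1_ge2 (R : realType) : 2 <= expR 1 :> R.
Proof. by have := expR_ge1Dx (1 : R); lra. Qed.

Lemma expR_half_le2 (R : realType) : expR 2^-1 <= 2 :> R.
Proof.
have := expR_ge1Dx (- 2^-1 : R); rewrite expRN => h.
have : 2^-1 <= (expR 2^-1)^-1 :> R by lra.
by rewrite lef_pV2 ?posrE ?expR_gt0.
Qed.

Lemma exprBn_le_expR (R : realType) (y : R) (q : nat) : 0 <= y <= 1 -> (1 - y) ^+ q <= expR (- (y * q%:R)).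
Proof.
move=> /andP[y0 y1]; rewrite -mulNr expRM_natr lerXn2r ?nnegrE ?expR_ge0//.
  by rewrite subr_ge0.
exact: expR_ge1Dx.
Qed.

(** The bound 1 - u <= exp (- u) at u = 1 / (j + 1) makes the sum telescope against the logarithm.
    The term at 0 vanishes by the convention on inverses. *)
Lemma harmonic_le (R : realType) (q : nat) (M : R) : 0 <= M -> q%:R <= expR M ->
  \sum_(t < q) t%:R^-1 <= 1 + M.
Proof.
move=> M0; case: q => [|q]; first by rewrite big_ord0; lra.
suff h j : (0 < j)%N -> \sum_(t < j.+1) t%:R^-1 <= 1 + ln j%:R :> R.
  case: q => [|q] qM; first by rewrite big_ord1 invr0; lra.
  apply: le_trans (h q.+1 isT) _; rewrite lerD2l -(expRK M).
  by rewrite ler_ln ?posrE ?ltr0n ?expR_gt0//; apply: le_trans qM; rewrite ler_nat.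
elim: j => // j IH _; have [->|j0] := posnP j.
  by rewrite !big_ord_recr big_ord0 /= invr0 ln1 invr1; lra.
rewrite big_ord_recr /=; have := IH j0.
have j0R : 0 < j%:R :> R by rewrite ltr0n.
have j1R : 0 < j.+1%:R :> R by rewrite ltr0n.
suff : j.+1%:R^-1 <= ln j.+1%:R - ln j%:R :> R.
  by move: (ln j.+1%:R) (ln j%:R) (j.+1%:R^-1) => u v w; lra.
have := expR_ge1Dx (- (j.+1%:R^-1) : R).
have -> : 1 + - j.+1%:R^-1 = j%:R / j.+1%:R :> R.
  by rewrite -[j%:R](addrK 1) natr1 mulrBl divff ?gt_eqF// mul1r.
move=> h; have : ln (j%:R / j.+1%:R) <= - (j.+1%:R^-1) :> R.
  by rewrite -[leRHS]expRK ler_ln ?posrE ?divr_gt0 ?expR_gt0.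
rewrite ln_div ?posrE//.
by move: (ln j.+1%:R) (ln j%:R) (j.+1%:R^-1) => u v w; lra.
Qed.

(** The exponents collected in [bad_long_le], with [y] the value [rho * n%:R]. *)
Lemma exponent_le (R : realFieldType) (L y : R) : L <= L ^+ 2 -> 20 * L ^+ 2 <= y ->
  - (6 * y) + (y + 10 * L + (2 * y + 20 * L * (1 + L))) <= - (5 * L).
Proof. by have := sqr_ge0 L; lra. Qed.

Section fixed_configuration.
Variables (R : realType) (n : nat) (x : n.-tuple (vec3 R)) (r : R) (m : nat).

Local Notation rad := (@Defs.radius R).

(** The mesh is of order 1 / n, far below [r], so the grid need not depend on [r] and a union bound
    over it costs only (n + 1)^2. *)
Definition grid (ij : 'I_n.+1 * 'I_n.+1) : R * R :=
  (pi * ij.1%:R / n%:R, 2 * pi * ij.2%:R / n%:R).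

(* Two sample points of the innermost cube [j = 0] are within angular distance
   [r] of each other, and a local edge leads from cube [j] into cube [j.+1]. *)
Definition cell (ij : 'I_n.+1 * 'I_n.+1) (j : nat) : set (vec3 R) :=
  cube (spherical (grid ij)) (rad * (r * (16^-1 + j%:R))).

(** The slack [10 * L] lets the upper bounds hold at all times. The lower bound is asked only from
    [T0] on, when the expected count has reached order [L]. *)
Definition good_positions (a b L : R) (T0 J : nat) : Prop :=
  [/\ forall v, on_sphere (tnth x v),
    forall v, exists ij, cell ij 0 (tnth x v),
    forall ij t, (t <= n)%N -> (occ (cell ij 2) x t)%:R <= b * (r ^+ 2 * t%:R) + 10 * L,
    forall ij t, (t <= n)%N ->
      (occ (cell ij J) x t)%:R <= b * J.+1%:R ^+ 2 * r ^+ 2 * t%:R + 10 * L &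
    forall ij t, (T0 <= t <= n)%N ->
      a * (r ^+ 2 * t%:R) <= (occ (cell ij 0) x t)%:R].

Hypothesis r_gt0 : 0 < r.
Hypothesis r_le1 : r <= 1.

Let Q ij j : pred 'I_n := fun v => `[< cell ij j (tnth x v) >].

Variables (a b L : R) (T0 l : nat).
Hypothesis a_gt0 : 0 < a.
Hypothesis a_le1 : a <= 1.
Hypothesis b_ge20 : 20 <= b.
Let J := (l * l).*2.
Let rho : R := b * J.+1%:R ^+ 2 * r ^+ 2.
Hypothesis good : good_positions a b L T0 J.

Let sphere v : on_sphere (tnth x v). Proof. by case: good. Qed.

Let near_box u w : near x r u w -> box (tnth x u) (tnth x w) (rad * r).
Proof. by case/andP => _; exact: angle_box. Qed.

Let QS ij j u w : Q ij j u -> [|| u == w, near x r u w | near x r w u] -> Q ij j.+1 w.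
Proof.
move=> /asboolP Qu uw; apply/asboolP; rewrite /cell /cube /=.
rewrite (_ : rad * (r * (16^-1 + j.+1%:R)) =
  rad * (r * (16^-1 + j%:R)) + rad * r); last by rewrite -natr1; ring.
apply: box_trans Qu _.
case/or3P: uw => [/eqP ->|/near_box//|/near_box]; last by rewrite box_sym.
by apply: boxxx; rewrite mulr_ge0 ?ltW// radius_gt0.
Qed.

Let Qnear ij u w : Q ij 0 u -> Q ij 0 w -> (u < w)%N -> near x r u w.
Proof.
move=> /asboolP Qu /asboolP Qw uw; rewrite /near uw /=.
apply: box_angle => //; first by rewrite ltW.
move: Qu; rewrite /cell /cube /= box_sym => Qu; have := box_trans Qu Qw.
(* Both points are within 1/16 of the centre, in units of [rad * r], hence within the 1/8 that
   [box_angle] requires. *)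
apply: box_le; rewrite addr0 -mulrA -mulrDr.
by apply: ler_wpM2l; [exact/ltW/radius_gt0|lra].
Qed.

Let Qmono ij i j v : (i <= j)%N -> Q ij i v -> Q ij j v.
Proof.
move=> /subnK <-; elim: (j - i)%N => // k IH /IH Qv.
by apply: QS Qv _; rewrite eqxx.
Qed.

Let N ij j t := cnt (Q ij j) t.

Let occN ij j t : occ (cell ij j) x t = N ij j t. Proof. by []. Qed.

Let N_mono ij i j t : (i <= j)%N -> (N ij i t <= N ij j t)%N.
Proof. by move=> ij'; apply: sub_cnt => v; exact: Qmono. Qed.

Hypothesis L_ge1 : 1 <= L.

Let L_gt0 : 0 < L. Proof. exact: lt_le_trans ltr01 L_ge1. Qed.

Let L_le_sqr : L <= L ^+ 2.
Proof. by rewrite expr2 ler_peMr ?(ltW L_gt0). Qed.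

Hypothesis T0_ge : 20 * L <= a * (r ^+ 2 * T0%:R).
Hypothesis T0_le : a * (r ^+ 2 * T0%:R) <= 21 * L.

Let r2_gt0 : 0 < r ^+ 2. Proof. by rewrite exprn_gt0. Qed.

Let N2_le ij t : (T0 <= t <= n)%N -> (N ij 2 t)%:R <= (b + 1) * (r ^+ 2 * t%:R).
Proof.
move=> /andP[Tt tn]; case: good => _ _ /(_ ij t tn) + _ _.
have y0 : 0 <= r ^+ 2 * T0%:R by rewrite mulr_ge0 ?(ltW r2_gt0).
have : r ^+ 2 * T0%:R <= r ^+ 2 * t%:R by rewrite ler_pM2l// ler_nat.
rewrite occN; have := ler_wpM2r y0 a_le1; move: T0_ge.
move: (r ^+ 2 * T0%:R) (r ^+ 2 * t%:R) y0 => y z y0; lra.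
Qed.

Let N0_ge ij t : (T0 <= t <= n)%N -> a * (r ^+ 2 * t%:R) <= (N ij 0 t)%:R.
Proof. by case: good => _ _ _ _; apply. Qed.

Let T0_gt0 : (0 < T0)%N.
Proof.
rewrite lt0n; apply: contraTneq T0_ge => ->.
by rewrite !mulr0 -ltNge mulr_gt0.
Qed.

Let N0_gt0 ij t : (T0 <= t <= n)%N -> (0 < N ij 0 t)%N.
Proof.
move=> Tt; have := N0_ge ij Tt; rewrite -(ltr0n R); apply: lt_le_trans.
rewrite !mulr_gt0// ltr0n; case/andP: Tt => + _.
by apply: leq_trans; exact: T0_gt0.
Qed.

(* [kappa] bounds the ratio of the counts in the concentric cubes [2] and [0]. *)
Let kappa : R := (b + 1) / a.

Let b1_gt0 : 0 < b + 1.
Proof. by rewrite ltr_wpDl// (le_trans _ b_ge20). Qed.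

Let kappa_gt0 : 0 < kappa. Proof. by rewrite divr_gt0. Qed.

Let N2_N0 ij t : (T0 <= t <= n)%N -> (N ij 2 t)%:R <= kappa * (N ij 0 t)%:R.
Proof.
move=> Tt; rewrite /kappa [leRHS]mulrAC ler_pdivlMr//.
have := ler_wpM2r (ltW a_gt0) (N2_le ij Tt).
have := ler_wpM2l (ltW b1_gt0) (N0_ge ij Tt); lra.
Qed.

Variable k : nat.
Hypothesis k_ge : 21 * (b + 1) + 20 * a <= k%:R * a.
Hypothesis kT0 : (k * T0 <= n)%N.

Let k_gt0 : (0 < k)%N.
Proof.
rewrite lt0n; apply: contraTneq k_ge => ->.
by rewrite mul0r -ltNge addr_gt0// mulr_gt0.
Qed.

Let T0kT0 : (T0 <= k * T0)%N. Proof. by rewrite leq_pmull. Qed.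

Let kappa2 : R := (b + 1) * 21 * k%:R / a.

Let kappa2_gt0 : 0 < kappa2.
Proof. by rewrite divr_gt0// !mulr_gt0 ?ltr0n. Qed.

Let N2_early ij t : (t <= k * T0)%N -> (N ij 2 t)%:R <= kappa2 * L.
Proof.
move=> tk; apply: (@le_trans _ _ (N ij 2 (k * T0))%:R); first by rewrite ler_nat leq_cnt.
have Tk : (T0 <= k * T0 <= n)%N by rewrite T0kT0.
apply: le_trans (N2_le ij Tk) _; rewrite natrM /kappa2.
have k0 : 0 <= k%:R :> R by [].
rewrite [leRHS]mulrAC ler_pdivlMr//; have := ler_wpM2l (mulr_ge0 (ltW b1_gt0) k0) T0_le.
by move: (r ^+ 2) (k%:R) (T0%:R) => y z w; lra.
Qed.

(** The origin of [k]: with y = r^2 T0, the count is at least a k y at time [k * T0], against at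
    most (b + 1) y at time [T0]. *)
Let many_between ij : 20 * L <= (N ij 0 (k * T0))%:R - (N ij 0 T0)%:R.
Proof.
have Tk : (T0 <= k * T0 <= n)%N by rewrite T0kT0.
have TT : (T0 <= T0 <= n)%N by rewrite leqnn (leq_trans T0kT0).
have E : r ^+ 2 * (k * T0)%:R = k%:R * (r ^+ 2 * T0%:R) by rewrite natrM; ring.
have y0 : 0 <= r ^+ 2 * T0%:R by rewrite mulr_ge0 ?(ltW r2_gt0).
have := N0_ge ij Tk; have := N2_le ij TT; rewrite E.
have : (N ij 0 T0)%:R <= (N ij 2 T0)%:R :> R by rewrite ler_nat N_mono.
have := ler_wpM2r y0 k_ge; have := mulr_ge0 (ltW b1_gt0) y0; move: T0_ge L_gt0.
move: (r ^+ 2 * T0%:R) (k%:R) => y z.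
by move: (N ij 0 T0)%:R (N ij 2 T0)%:R (N ij 0 (k * T0))%:R => u v w; clear E y0; lra.
Qed.

Hypothesis m_ge : (20 * kappa + 8 * kappa2 + 1) * L <= m%:R.

Let m_gt0 : (0 < m)%N.
Proof.
rewrite -(ltr0n R); apply: lt_le_trans m_ge; rewrite mulr_gt0//.
by rewrite ltr_wpDl// addr_ge0// mulr_ge0// ltW.
Qed.

Variable delta : R.
Hypothesis delta_gt0 : 0 < delta.

Let B1 ij t v : Q ij 0 t -> near x r v t -> Q ij 2 v.
Proof.
by move=> Qt vt; apply: (@Qmono ij 1%N) => //; apply: QS Qt _; rewrite vt !orbT.
Qed.

Let B2 ij t v w : Q ij 0 t -> near x r v t -> near x r v w -> Q ij 2 w.
Proof.
move=> Qt vt vw; apply: (@QS ij 1%N v); last by rewrite vw orbT.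
by apply: QS Qt _; rewrite vt !orbT.
Qed.

(** Each contact falls in the cell with probability at least [1 / (4 * kappa)], and there are at
    least [20 * kappa * L] contacts. *)
Let late_step ij (t : 'I_n) G : Q ij 0 t -> (T0 <= t)%N -> local_inv x r m t G ->
  dexp (base_step x r m delta t G) (fun G' =>
    (misses t [pred y : 'I_n | Q ij 0 y && (y < t)%N] G')%:R) <= expR (- (5 * L)).
Proof.
move=> Qt Tt GI; set E := [pred y | _].
have Ttn : (T0 <= t <= n)%N by rewrite Tt ltnW.
apply: le_trans (base_step_misses delta_gt0 m_gt0 GI (B := Q ij 2) _ _ _) _.
- by move=> v; exact: B1.
- by move=> v w; exact: B2.
- by move=> v /andP[Qv vt] _; exact: Qnear Qv Qt vt.
have -> : cnt E t = N ij 0 t.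
  by apply: eq_card => v; rewrite !inE -andbA andbb.
have N0 := N0_gt0 ij Ttn; have N02 := @N_mono ij 0 2 t isT.
have N2 : 0 < 4 * (N ij 2 t)%:R :> R by rewrite mulr_gt0// ltr0n (leq_trans N0).
rewrite -/(N ij 2 t); apply: le_trans (exprBn_le_expR _ _) _.
  rewrite divr_ge0 ?(ltW N2)//= ler_pdivrMr// mul1r.
  by rewrite -natrM ler_nat (leq_trans N02)// leq_pmull.
rewrite ler_expR lerN2.
have kg : 0 < 4 * kappa by rewrite mulr_gt0.
have : (4 * kappa)^-1 <= (N ij 0 t)%:R / (4 * (N ij 2 t)%:R).
  rewrite -[leLHS]mul1r ler_pdivrMr// mulrAC ler_pdivlMr// mul1r.
  by have := N2_N0 ij Ttn; lra.
move=> h; have m0 : 0 <= m%:R :> R by [].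
apply: le_trans (ler_wpM2r m0 h).
rewrite [leRHS]mulrC ler_pdivlMr//; apply: le_trans m_ge.
by have := mulr_gt0 kappa2_gt0 L_gt0; have := L_gt0; lra.
Qed.

(** The target is now a single vertex. Before [k * T0] only [kappa2 * L] vertices compete with it,
    so [8 * kappa2 * L] contacts miss it with probability at most exp (-2). *)
Let early_step ij (u t : 'I_n) G : Q ij 0 u -> Q ij 0 t -> (u < T0)%N ->
  (T0 <= t < k * T0)%N -> local_inv x r m t G ->
  dexp (base_step x r m delta t G) (fun G' => (misses t (pred1 u) G')%:R) <= 4^-1.
Proof.
move=> Qu Qt uT /andP[Tt tk] GI; have ut := leq_trans uT Tt.
have nut := Qnear Qu Qt ut.
apply: le_trans (base_step_misses delta_gt0 m_gt0 GI (B := Q ij 2) _ _ _) _.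
- by move=> v; exact: B1.
- by move=> v w; exact: B2.
- by move=> v /eqP -> _.
have -> : cnt (pred1 u) t = 1%N.
  rewrite -[RHS](card1 u); apply: eq_card => v; rewrite !inE.
  by case: eqP => // ->.
have N2 : (0 < N ij 2 t)%N.
  by apply/card_gt0P; exists u; rewrite inE (B1 Qt nut).
have N2R : 0 < 4 * (N ij 2 t)%:R :> R by rewrite mulr_gt0// ltr0n.
rewrite -/(N ij 2 t) mul1r; apply: le_trans (exprBn_le_expR _ _) _.
  by rewrite invr_ge0 ltW//= invf_le1// -natrM ler1n muln_gt0.
have e2 : expR (-2) <= 4^-1 :> R.
  rewrite expRN lef_pV2 ?posrE ?expR_gt0//.
  have e1 := expR1_ge2 R.
  by rewrite (_ : 2 = 1 + 1 :> R) ?expRD//; nra.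
apply: le_trans e2; rewrite ler_expR lerN2 [leRHS]mulrC ler_pdivlMr//.
apply: le_trans m_ge; have := N2_early ij (ltnW tk).
by have := mulr_gt0 kappa_gt0 L_gt0; have := L_gt0; lra.
Qed.

Variable step : 'I_n -> mgraph n * mgraph n -> dist R (mgraph n * mgraph n).
Variable Inv : nat -> mgraph n * mgraph n -> Prop.
Hypothesis H : layered x r m delta step Inv.

Let D := chain step ([::], [::]).

Let bad_late ij (t : 'I_n) (s : mgraph n * mgraph n) : bool :=
  [&& Q ij 0 t, (T0 <= t)%N & misses t [pred y : 'I_n | Q ij 0 y && (y < t)%N] s.1].

Let bad_late_le ij t : dexp D (fun s => (bad_late ij t s)%:R) <= expR (- (5 * L)).
Proof.
have dD := layered_chain_dist H.
have [/andP[Qt Tt]|nQ] := boolP (Q ij 0 t && (T0 <= t)%N); last first.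
  rewrite (dexp_eq _ (g := fun=> 0)) ?dexp_cst ?expR_ge0// => s.
  by rewrite /bad_late andbA (negbTE nQ).
have := layered_chain_fail delta_gt0 H (I := pred1 t) (b := expR (- (5 * L)))
  (fail := fun u => misses u [pred y : 'I_n | Q ij 0 y && (y < u)%N]) (expR_ge0 _).
rewrite card1 expr1 => /(_ _ _); rewrite (dexp_eq _ (g := fun s => (bad_late ij t s)%:R)).
  apply; first by move=> t' u ys G ut; rewrite misses_cat.
  by move=> t' G /eqP -> GI; exact: late_step.
move=> s; congr (nat_of_bool _)%:R; rewrite /bad_late Qt Tt /=.
by apply/forallP/idP => [/(_ t)|ms u]; [rewrite eqxx|apply/implyP => /eqP ->].
Qed.

Let bad_early ij (u w : 'I_n) (s : mgraph n * mgraph n) : bool :=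
  [&& Q ij 0 u, Q ij 0 w, (u < T0)%N, (w < T0)%N &
    [forall t : 'I_n, (Q ij 0 t && (T0 <= t < k * T0)%N) ==>
       (misses t (pred1 u) s.1 || misses t (pred1 w) s.1)]].

(** A vertex of the window fails to join [u] and [w] with conditional probability at most 1/4 + 1/4,
    and the window holds at least [20 * L] vertices of the cell. *)
Let bad_early_le ij u w : dexp D (fun s => (bad_early ij u w s)%:R) <= expR (- (5 * L)).
Proof.
have dD := layered_chain_dist H.
have [/and4P[Qu Qw uT wT]|nQ] := boolP [&& Q ij 0 u, Q ij 0 w, (u < T0)%N & (w < T0)%N];
    last first.
  rewrite (dexp_eq _ (g := fun=> 0)) ?dexp_cst ?expR_ge0// => s.
  rewrite /bad_early; move: nQ.
  by case: (Q ij 0 u) (Q ij 0 w) (u < T0)%N (w < T0)%N => [] [] [] [].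
pose I : pred 'I_n := [pred t | Q ij 0 t && (T0 <= t < k * T0)%N].
have := layered_chain_fail delta_gt0 H (I := I) (b := 2^-1)
  (fail := fun t G => misses t (pred1 u) G || misses t (pred1 w) G).
rewrite (dexp_eq _ (g := fun s => (bad_early ij u w s)%:R)); last first.
  by move=> s; rewrite /bad_early Qu Qw uT wT.
move=> /(_ _ _ _) h; apply: le_trans (h _ _ _) _.
- by rewrite invr_ge0.
- by move=> t t' ys G ta; rewrite !misses_cat.
- move=> t G /andP[Qt tT] GI.
  apply: (@le_trans _ _ (dexp (base_step x r m delta t G) (fun G' =>
    (misses t (pred1 u) G')%:R + (misses t (pred1 w) G')%:R))).
    apply: (dexp_le (P := fun=> True)); [exact: base_step_dist|exact: dall_true|].
    by move=> G' _; case: (misses t _ _); case: (misses t _ _); rewrite /= ?addr0 ?add0r// lerDl.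
  rewrite dexpD (_ : 2^-1 = 4^-1 + 4^-1); last by field.
  by apply: lerD; [exact: early_step Qu Qt uT tT GI|exact: early_step Qw Qt wT tT GI].
have cI : (N ij 0 (k * T0) - N ij 0 T0 = #|I|)%N.
  have <- : (N ij 0 T0 + #|I| = N ij 0 (k * T0))%N; last by rewrite addKn.
  rewrite -[RHS](cardID [pred v : 'I_n | (v < T0)%N]); congr (_ + _)%N.
    apply: eq_card => v; rewrite !inE; case: (ltnP v T0) => vT; rewrite ?andbF ?andbT//.
    by rewrite (leq_trans vT T0kT0) ?andbT.
  by apply: eq_card => v; rewrite !inE -leqNgt andbCA.
have := many_between ij; rewrite -natrB ?leq_cnt// cI => cI20.
have e1 := expR_half_le2 R.
apply: (@le_trans _ _ (expR (- 2^-1) ^+ #|I|)).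
  by rewrite lerXn2r ?nnegrE ?invr_ge0 ?expR_ge0// expRN lef_pV2 ?posrE ?expR_gt0.
rewrite -expRM_natr ler_expR mulNr lerN2.
rewrite ler_pdivlMl//; apply: le_trans cI20.
by rewrite mulrA ler_wpM2r ?(ltW L_gt0)// -natrM ler_nat.
Qed.

Let bad_long ij (s : mgraph n * mgraph n) : bool :=
  12 * (rho * n%:R) <= (touching (Q ij J) s.2)%:R.

Hypothesis rn_ge : L ^+ 2 <= r ^+ 2 * n%:R.
Hypothesis n_le : n%:R <= expR L.

Let rho_ge : 20 * L ^+ 2 <= rho * n%:R.
Proof.
rewrite /rho -[leRHS]mulrA ler_pM ?sqr_ge0//.
by apply: (le_trans b_ge20); rewrite ler_peMr ?exprn_ege1 ?ler1n// (le_trans _ b_ge20).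
Qed.

Let rho_ge0 : 0 <= rho.
Proof. by rewrite mulr_ge0 ?(ltW r2_gt0)// mulr_ge0 ?exprn_ge0// (le_trans _ b_ge20). Qed.

Let NJ_le ij t : (t <= n)%N -> (N ij J t)%:R <= rho * t%:R + 10 * L.
Proof. by move=> tn; case: good => _ _ _ + _; apply. Qed.

(** Markov's inequality for the exponential moment of [touching]. The slack [10 * L] in the counts
    turns into a harmonic sum of order L^2, which [rho * n%:R] absorbs. *)
Let bad_long_le ij : dexp D (fun s => (bad_long ij s)%:R) <= expR (- (5 * L)).
Proof.
have dD := layered_chain_dist H.
have L0 := ltW L_gt0.
have e1 := expR_half_le2 R; have e2 := expR1_ge2 R.
apply: (@le_trans _ _ (dexp D (fun s =>
    expR (- (6 * (rho * n%:R))) * 2 ^+ touching (Q ij J) s.2))).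
  apply: (dexp_le dD (dall_true _ (fun=> I))) => s _.
  rewrite /bad_long; case: (leP (12 * _)) => h /=; last first.
    by rewrite mulr_ge0 ?expR_ge0 ?exprn_ge0.
  apply: (@le_trans _ _ (expR (- (6 * (rho * n%:R))) * expR 2^-1 ^+ touching (Q ij J) s.2)).
    rewrite -expRM_natr -expRD -[leLHS]expR0 ler_expR addrC subr_ge0.
    by rewrite ler_pdivlMl//; apply: le_trans h; rewrite [leLHS]mulrA -natrM.
  by rewrite ler_wpM2l ?expR_ge0// lerXn2r ?nnegrE ?expR_ge0.
rewrite dexpZ; apply: le_trans (ler_wpM2l (expR_ge0 _) (layered_chain_long H (Q ij J))) _.
rewrite -/(N ij J n).
have h1 : 2 ^+ N ij J n <= expR (rho * n%:R + 10 * L) :> R.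
  apply: (@le_trans _ _ (expR 1 ^+ N ij J n)); first by rewrite lerXn2r ?nnegrE ?expR_ge0.
  by rewrite -expRM_natr mul1r ler_expR NJ_le.
have h2 : \prod_(t < n) (1 + 2 * (cnt (Q ij J) t)%:R / t%:R) <=
    expR (2 * (rho * n%:R) + 20 * L * (1 + L)).
  apply: (@le_trans _ _ (\prod_(t < n) expR (2 * rho + 20 * L * t%:R^-1))).
    apply: ler_prod => t _; apply/andP; split.
      by rewrite addr_ge0// divr_ge0// mulr_ge0.
    apply: le_trans (expR_ge1Dx _) _; rewrite ler_expR.
    have [t0|t0] := posnP (nat_of_ord t).
      by rewrite t0 invr0 !mulr0 addr0 mulr_ge0.
    have := NJ_le ij (ltnW (ltn_ord t)); rewrite -/(N ij J t) => h.
    have tR : 0 < t%:R :> R by rewrite ltr0n.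
    rewrite ler_pdivrMr// [leRHS]mulrDl -[X in _ <= _ + X]mulrA mulVf ?gt_eqF// mulr1.
    apply: (le_trans (ler_wpM2l (ler0n R 2) h)).
    by rewrite le_eqVlt; apply/orP; left; apply/eqP; ring.
  rewrite -expR_sum ler_expR big_split /= sumr_const card_ord -mulr_sumr lerD//.
    by rewrite le_eqVlt; apply/orP; left; apply/eqP; rewrite -mulr_natr; ring.
  by rewrite ler_wpM2l ?mulr_ge0//; exact: harmonic_le.
apply: le_trans (ler_wpM2l (expR_ge0 _) (ler_pM _ _ h1 h2)) _.
- exact: exprn_ge0.
- by apply: prodr_ge0 => t _; rewrite addr_ge0// divr_ge0// mulr_ge0.
by rewrite -!expRD ler_expR; apply: exponent_le; [exact: L_le_sqr|exact: rho_ge].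
Qed.

Hypothesis l_gt0 : (0 < l)%N.
Hypothesis l_large : 2 * b * J.+1%:R ^+ 2 < 2 ^+ l * a.
Hypothesis rho_small : 4 * rho <= 1.
Hypothesis T0n : (T0 <= n)%N.

Let NJn ij : (N ij J n)%:R <= 2 * (rho * n%:R).
Proof.
apply: le_trans (NJ_le ij (leqnn n)) _; rewrite [leRHS]mulr_natl mulr2n lerD2l.
by apply: le_trans rho_ge; apply: ler_pM; rewrite ?ler_nat ?(ltW L_gt0).
Qed.

Definition small_around (G : mgraph n) (v : 'I_n) (S : {set 'I_n}) : bool :=
  [&& v \in S, connected_set G S,
    a * (r ^+ 2 * n%:R) <= #|S|%:R <= 2 * b * J.+1%:R ^+ 2 * (r ^+ 2 * n%:R) &
    conductance R G S <= 2 / l%:R + 12 * b * J.+1%:R ^+ 2 / (a * m%:R)].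

Lemma small_around_prob :
  1 - 3 * n.+1%:R ^+ 2 * n%:R ^+ 2 * expR (- (5 * L)) <=
  dprob D (fun s => [forall v, exists S, small_around (s.1 ++ s.2) v S]).
Proof.
(* A single index set, a grid point and a pair of vertices, serves the three kinds of bad event; two
   of them ignore some of the vertices. *)
pose bad (i : ('I_n.+1 * 'I_n.+1) * ('I_n * 'I_n)) s :=
  [|| bad_late i.1 i.2.1 s, bad_early i.1 i.2.1 i.2.2 s | bad_long i.1 s].
have dD := layered_chain_dist H.
have bad_le i : dexp D (fun s => (bad i s)%:R) <= 3 * expR (- (5 * L)).
  apply: (@le_trans _ _ (dexp D (fun s => (bad_late i.1 i.2.1 s)%:R +
    ((bad_early i.1 i.2.1 i.2.2 s)%:R + (bad_long i.1 s)%:R)))).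
    apply: (dexp_le dD (dall_true _ (fun=> I))) => s _; rewrite /bad.
    rewrite -!natrD ler_nat.
    by case: bad_late; case: bad_early; case: bad_long.
  rewrite !dexpD; have := bad_late_le i.1 i.2.1; have := bad_early_le i.1 i.2.1 i.2.2.
  by have := bad_long_le i.1; lra.
apply: le_trans (layered_prob_ge H (bad := bad) (eps := fun=> 3 * expR (- (5 * L))) bad_le _).
  rewrite lerD2l lerN2 sumr_const !card_prod !card_ord -[leLHS]mulr_natl !natrM.
  by rewrite le_eqVlt; apply/orP; left; apply/eqP; ring.
move=> s LI nbad; apply/forallP => v; apply/existsP.
have [ij Qv] : exists ij, Q ij 0 v.
  by case: good => _ /(_ v)[ij ?] _ _ _; exists ij; apply/asboolP.
have late t : Q ij 0 t -> (T0 <= t)%N ->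
    ~~ misses t [pred y : 'I_n | Q ij 0 y && (y < t)%N] s.1.
  move=> Qt Tt; have := nbad (ij, (t, t)); rewrite !negb_or => /and3P[+ _ _].
  by rewrite /bad_late /= Qt Tt.
have early u w : Q ij 0 u -> Q ij 0 w -> (u < T0)%N -> (w < T0)%N ->
    exists2 t : 'I_n, Q ij 0 t & ~~ misses t (pred1 u) s.1 && ~~ misses t (pred1 w) s.1.
  move=> Qu Qw uT wT; have := nbad (ij, (u, w)); rewrite !negb_or => /and3P[_ + _].
  rewrite /bad_early /= Qu Qw uT wT /= => /forallPn[t].
  by rewrite negb_imply negb_or => /andP[/andP[Qt _] mm]; exists t.
have long : (touching (Q ij J) s.2)%:R <= 12 * (rho * n%:R).
  have := nbad (ij, (v, v)); rewrite !negb_or => /and3P[_ _].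
  by rewrite /bad_long -ltNge => /ltW.
have TTn : (T0 <= n <= n)%N by rewrite T0n leqnn.
have N0n := N0_ge ij TTn; have N0n_gt0 := N0_gt0 ij TTn.
have n_gt0 : 0 < n%:R :> R by rewrite ltr0n (leq_trans _ T0n).
have y0 : 0 < r ^+ 2 * n%:R by rewrite mulr_gt0.
have J0 : 0 < J.+1%:R ^+ 2 :> R by rewrite exprn_gt0// ltr0n.
have [||S [S1 S2 S3 S4]] := @grow_community R n x r m s.1 s.2 (Q ij) T0 LI (@QS ij)
  late early l l_gt0 m_gt0.
- rewrite -(ltr_nat R) natrM natrX; apply: le_lt_trans (NJn ij) _.
  rewrite -/(N ij 0 n); apply: lt_le_trans (ler_wpM2l _ N0n); last exact: exprn_ge0.
  rewrite [ltRHS]mulrA (_ : 2 * (rho * n%:R) = 2 * b * J.+1%:R ^+ 2 * (r ^+ 2 * n%:R)).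
    by rewrite ltr_pM2r.
  by rewrite /rho; ring.
- rewrite -(ler_nat R) natrM; have := NJn ij; have := ler_wpM2r (ltW n_gt0) rho_small.
  by rewrite -/(N ij J n) mul1r; lra.
exists S; apply/and4P; split => //.
- exact: S1.
- case/andP: S3 => S3 S3'; apply/andP; split.
    by apply: le_trans N0n _; rewrite ler_nat.
  apply: (@le_trans _ _ (N ij J n)%:R); first by rewrite ler_nat.
  by apply: le_trans (NJn ij) _; rewrite /rho; lra.
apply: le_trans S4 _; rewrite lerD2l -/(N ij 0 n).
have mR : 0 < m%:R :> R by rewrite ltr0n.
have N0R : 0 < (N ij 0 n)%:R :> R by rewrite ltr0n.
rewrite ler_pdivrMr ?mulr_gt0// mulrAC ler_pdivlMr ?mulr_gt0//.
have m0 := ltW mR; apply: le_trans (ler_wpM2r (mulr_ge0 (ltW a_gt0) m0) long) _.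
rewrite [leLHS](_ : _ = 12 * b * J.+1%:R ^+ 2 * m%:R * (a * (r ^+ 2 * n%:R))); last first.
  by rewrite /rho; ring.
rewrite [leRHS]mulrA; apply: ler_wpM2l N0n; apply: mulr_ge0 => //.
by apply: mulr_ge0 (ltW J0); rewrite mulr_ge0// (le_trans _ b_ge20).
Qed.

End fixed_configuration.

(** * Typical configurations *)

Section typical_configuration.
Variables (R : realType) (n : nat) (r : R).

Local Notation rad := (@Defs.radius R).
Local Notation area := (@sphere_area R).

Hypothesis n_gt0 : (0 < n)%N.
Hypothesis r_gt0 : 0 < r.
Hypothesis r_le1 : r <= 1.
Hypothesis nr_large : 80 <= (n%:R * (r / 16)) ^+ 2.

Let grid_dom (ij : 'I_n.+1 * 'I_n.+1) :
  0 <= (grid R ij).1 <= pi /\ 0 <= (grid R ij).2 <= 2 * pi.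
Proof.
have n0 : 0 < n%:R :> R by rewrite ltr0n.
have p0 := @pi_ge0 R; have pp0 : 0 <= 2 * pi :> R by rewrite mulr_ge0.
have le (i : 'I_n.+1) (c : R) : 0 <= c -> 0 <= c * i%:R / n%:R <= c.
  move=> c0; rewrite divr_ge0 ?mulr_ge0//= ler_pdivrMr// ler_wpM2l// ler_nat.
  by rewrite -ltnS.
by split; exact: le.
Qed.

Lemma exists_grid_coordinate (c y : R) : 0 < c -> 0 <= y <= c ->
  exists i : 'I_n.+1, `|c * i%:R / n%:R - y| <= c / n%:R.
Proof.
move=> c0 /andP[y0 yc]; have n0 : 0 < n%:R :> R by rewrite ltr0n.
pose z := y * n%:R / c.
have z0 : 0 <= z by rewrite divr_ge0 ?(ltW c0)// mulr_ge0.
have zn : z <= n%:R by rewrite ler_pdivrMr// mulrC ler_wpM2l.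
have /andP[t1 t2] := truncn_itv z0.
have tn : (Num.truncn z < n.+1)%N.
  by rewrite ltnS -(ler_nat R) (le_trans t1).
exists (Ordinal tn) => /=.
have -> : y = c * z / n%:R by rewrite /z; field; rewrite !gt_eqF.
rewrite -mulrBl -mulrBr normrM (gtr0_norm (_ : 0 < n%:R^-1)) ?invr_gt0//.
rewrite normrM (gtr0_norm c0) ler_wpM2r ?invr_ge0 ?(ltW n0)//.
rewrite -[leRHS]mulr1 ler_wpM2l ?(ltW c0)// distrC ger0_norm ?subr_ge0//.
by rewrite lerBlDr addrC natr1 ltW.
Qed.

(** Rounding the two angles costs pi / n and 2 pi / n, whose squares add up to 5 pi^2 / n^2. With pi
    < 4 this is the origin of the constant 80. *)
Lemma cell_cover (q : R * R) : 0 <= q.1 <= pi -> 0 <= q.2 <= 2 * pi ->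
  exists ij : 'I_n.+1 * 'I_n.+1, cell r ij 0 (spherical q).
Proof.
move=> q1 q2; have n0 : 0 < n%:R :> R by rewrite ltr0n.
have p0 := @pi_gt0 R.
have [i hi] := exists_grid_coordinate p0 q1.
have pp0 : 0 < 2 * pi :> R by rewrite mulr_gt0.
have [j hj] := exists_grid_coordinate pp0 q2.
exists (i, j); rewrite /cell addr0.
have [/= g1 _] := grid_dom (i, j).
have s1 : 0 <= sin (grid R (i, j)).1 by exact: sin_ge0_pi.
have s2 : 0 <= sin q.1 by exact: sin_ge0_pi.
apply: cube_spherical; [by rewrite mulr_ge0 ?(ltW r_gt0)|exact: mulr_ge0|].
have sq (u v : R) : `|u| <= v -> u ^+ 2 <= v ^+ 2.
  by move=> uv; rewrite -[leLHS]real_normK ?num_real// lerXn2r// nnegrE (le_trans _ uv).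
have h1 := sq _ _ hi; have h2 := sq _ _ hj.
have ss : sin (grid R (i, j)).1 * sin q.1 <= 1.
  by rewrite -[leRHS]mulr1 ler_pM// sin_le1.
apply: (@le_trans _ _ ((pi / n%:R) ^+ 2 + (2 * pi / n%:R) ^+ 2)).
  apply: lerD; first exact: h1.
  rewrite -[leRHS]mul1r; apply: ler_pM h2 => //; [exact: mulr_ge0|exact: sqr_ge0].
have -> : (pi / n%:R) ^+ 2 + (2 * pi / n%:R) ^+ 2 = 5 * pi ^+ 2 / n%:R ^+ 2 :> R.
  by field; rewrite gt_eqF.
rewrite ler_pdivrMr ?exprn_gt0// -exprMn [_ * n%:R]mulrC.
apply: le_trans nr_large; have := @pihalf_lt2 R; have := @pi_gt0 R.
move: (@pi R) => p pg pl; have : p ^+ 2 <= 4 ^+ 2 by rewrite lerXn2r ?nnegrE//; lra.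
lra.
Qed.

Let mcell ij j : measurable (cell r (ij : 'I_n.+1 * 'I_n.+1) j).
Proof. exact: measurable_cube. Qed.

Lemma cell_area_le (ij : 'I_n.+1 * 'I_n.+1) j :
  (area (cell r ij j) <= (300 * (r * (16^-1 + j%:R)) ^+ 2)%:E)%E.
Proof.
have [g1 g2] := grid_dom ij; apply: cube_area_le => //.
by rewrite mulr_gt0// ltr_pwDl.
Qed.

Lemma cell_area_ge (ij : 'I_n.+1 * 'I_n.+1) :
  (((r / 16) ^+ 2 / 1024)%:E <= area (cell r ij 0))%E.
Proof.
have [g1 g2] := grid_dom ij; rewrite /cell addr0; apply: cube_area_ge => //.
rewrite divr_gt0//= ler_pdivrMr// mul1r (le_trans r_le1)//.
by rewrite ler1n.
Qed.

Let msphere : measurable [set u : vec3 R | on_sphere u].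
Proof.
pose f (u : vec3 R) : R := u.1.1 ^+ 2 + u.1.2 ^+ 2 + u.2 ^+ 2.
have mf : measurable_fun setT f.
  apply: measurable_funD; first apply: measurable_funD.
  - by apply: measurable_funX; exact: measurableT_comp.
  - by apply: measurable_funX; exact: measurableT_comp.
  - exact: measurable_funX.
have -> : [set u : vec3 R | on_sphere u] = f @^-1` [set rad ^+ 2] by [].
by rewrite -[X in measurable X]setTI; exact: mf.
Qed.

Definition uncovered : set (vec3 R) :=
  ~` ([set u | on_sphere u] `&`
      \bigcup_(ij in [set: 'I_n.+1 * 'I_n.+1]) cell r ij 0).

Let muncovered : measurable uncovered.
Proof.
apply: measurableC; apply: measurableI; first exact: msphere.
by apply: fin_bigcup_measurable => [|ij _]; [exact: finite_finset|exact: mcell].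
Qed.

Lemma uncovered_area : area uncovered = 0%E.
Proof.
rewrite /sphere_area (_ : _ `&` _ = set0) ?integral_set0//.
apply/seteqP; split=> // q [[/= q1 q2]]; apply; split; first exact: on_sphere_spherical.
rewrite /= !in_itv/= in q1 q2.
by have [ij Hij] := cell_cover q1 q2; exists ij.
Qed.

Variables (L : R) (T0 J : nat).
Hypothesis L_ge0 : 0 <= L.

Let law := iid (@sphere_area R) n.

(** Chernoff's bound at s = 1/2, where exp s - 1 <= 1: the mean is at most half of the main term, so
    only -5 L remains in the exponent. *)
Let occ_le j (c : R) (ij : 'I_n.+1 * 'I_n.+1) t : (t <= n)%N ->
  300 * (16^-1 + j%:R) ^+ 2 <= c / 2 ->
  (law [set x | (2^-1 * (c * (r ^+ 2 * t%:R) + 10 * L) <=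
     2^-1 * (occ (cell r ij j) x t)%:R)%R] <= (expR (- (5 * L)))%:E)%E.
Proof.
move=> tn jc; have Af := fin_num_measure (@sphere_area R) _ (mcell ij j).
have Ap := fineK Af; set p := fine _ in Ap.
apply: le_trans (iid_chernoff _ _ (mcell ij j) tn (esym Ap)) _.
rewrite lee_fin ler_expR.
have p1 : p <= 300 * (r * (16^-1 + j%:R)) ^+ 2 by rewrite -lee_fin Ap cell_area_le.
have p0 : 0 <= p by rewrite -lee_fin Ap.
have p2 : p <= c / 2 * r ^+ 2.
  apply: le_trans p1 _; rewrite exprMn mulrCA mulrC ler_wpM2r// sqr_ge0//.
have e1 : expR 2^-1 - 1 <= 1 :> R by have := expR_half_le2 R; lra.
have t0 : 0 <= t%:R :> R by [].
have h1 := ler_wpM2r t0 (ler_wpM2r p0 e1).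
have h2 := ler_wpM2r t0 p2.
apply: (@le_trans _ _ (c / 2 * r ^+ 2 * t%:R - 2^-1 * (c * (r ^+ 2 * t%:R) + 10 * L))).
  by rewrite lerD2r (le_trans h1)// mul1r.
by rewrite le_eqVlt; apply/orP; left; apply/eqP; field.
Qed.

Let a : R := 16^-1 ^+ 2 / 1024 / 4.

(** Chernoff's bound at s = -1, where 1 - exp s >= 1/2. Since [a * r ^+ 2] is a quarter of the lower
    bound on the area, the exponent is at most -2 + 1 = -1 times the threshold. *)
Let occ_ge (ij : 'I_n.+1 * 'I_n.+1) t : (t <= n)%N ->
  20 * L <= a * (r ^+ 2 * t%:R) ->
  (law [set x | (- (a * (r ^+ 2 * t%:R)) <= -1 * (occ (cell r ij 0) x t)%:R)%R] <=
    (expR (- (5 * L)))%:E)%E.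
Proof.
move=> tn Lt; have Af := fin_num_measure (@sphere_area R) _ (mcell ij 0).
have Ap := fineK Af; set p := fine _ in Ap.
apply: le_trans (iid_chernoff _ _ (mcell ij 0) tn (esym Ap)) _.
rewrite lee_fin ler_expR opprK.
have p1 : (r / 16) ^+ 2 / 1024 <= p by rewrite -lee_fin Ap cell_area_ge.
have p4 : 4 * (a * r ^+ 2) <= p.
  by apply: le_trans p1; rewrite /a le_eqVlt; apply/orP; left; apply/eqP; field.
have p0 : 0 <= p by rewrite -lee_fin Ap.
have e1 : 2^-1 <= 1 - expR (- 1) :> R.
  rewrite expRN; have : (expR 1)^-1 <= 2^-1 :> R.
    by rewrite lef_pV2 ?posrE ?expR_gt0// expR1_ge2.
  lra.
have t0 : 0 <= t%:R :> R by [].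
have h1 := ler_wpM2r t0 (ler_wpM2r p0 e1).
have h2 := ler_wpM2r t0 p4.
move: h1 h2 Lt L_ge0; move: (expR _) (a) (r ^+ 2) t%:R => e y z s; lra.
Qed.

Hypothesis T0_ge : 20 * L <= a * (r ^+ 2 * T0%:R).

Let bad_cell (i : ('I_n.+1 * 'I_n.+1) * 'I_n.+1) : set (n.-tuple (vec3 R)) :=
  [set x | (2^-1 * (3000 * (r ^+ 2 * i.2%:R) + 10 * L) <=
     2^-1 * (occ (cell r i.1 2) x i.2)%:R)%R] `|`
  ([set x | (2^-1 * (3000 * J.+1%:R ^+ 2 * (r ^+ 2 * i.2%:R) + 10 * L) <=
     2^-1 * (occ (cell r i.1 J) x i.2)%:R)%R] `|`
   (if (T0 <= i.2)%N then
     [set x | (- (a * (r ^+ 2 * i.2%:R)) <= -1 * (occ (cell r i.1 0) x i.2)%:R)%R]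
    else set0)).

Let mocc A t (s B : R) : measurable A ->
  measurable [set x : n.-tuple (vec3 R) | B <= s * (occ A x t)%:R].
Proof.
move=> mA.
have -> : [set x : n.-tuple (vec3 R) | B <= s * (occ A x t)%:R] =
    (fun x => expR (s * (occ A x t)%:R)) @^-1` `[expR B, +oo[.
  by apply/seteqP; split=> x /=; rewrite in_itv /= andbT ler_expR.
by rewrite -[X in measurable X]setTI; exact: measurable_exp_occ.
Qed.

Let mbad_cell i : measurable (bad_cell i).
Proof.
apply: measurableU; first by apply: mocc; exact: mcell.
apply: measurableU; first by apply: mocc; exact: mcell.
by case: (T0 <= _)%N => //; apply: mocc; exact: mcell.
Qed.

Let bad_cell_le i : (law (bad_cell i) <= (3 * expR (- (5 * L)))%:E)%E.
Proof.
have tn : (i.2 <= n)%N by rewrite -ltnS.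
rewrite (_ : 3 * expR (- (5 * L)) =
  expR (- (5 * L)) + (expR (- (5 * L)) + expR (- (5 * L)))); last by ring.
rewrite !EFinD; apply: le_trans (measureU2 _ _ _) _.
- by apply: mocc; exact: mcell.
- apply: measurableU; first by apply: mocc; exact: mcell.
  by case: (T0 <= _)%N => //; apply: mocc; exact: mcell.
(* The constant 3000 is chosen so that its half exceeds [300 * (16^-1 + 2) ^+ 2]. *)
apply: leeD; first by apply: occ_le => //; lra.
apply: le_trans (measureU2 _ _ _) _.
- by apply: mocc; exact: mcell.
- by case: (T0 <= _)%N => //; apply: mocc; exact: mcell.
apply: leeD.
  apply: occ_le => //; have j0 : 0 <= J%:R :> R by [].
  have : (16^-1 + J%:R) ^+ 2 <= J.+1%:R ^+ 2 :> R.
    rewrite lerXn2r ?nnegrE ?addr_ge0//.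
    by rewrite -[J.+1%:R]natr1 addrC lerD2l invf_le1 ?ler1n.
  by move=> h; have := sqr_ge0 (J.+1%:R : R); lra.
case: ifP => Ti; last by rewrite measure0 lee_fin expR_ge0.
apply: occ_ge => //; apply: (le_trans T0_ge).
rewrite ler_wpM2l ?ler_wpM2l ?sqr_ge0 ?ler_nat//.
by rewrite /a; do 2 (apply: divr_ge0; last exact: ler0n); exact: sqr_ge0.
Qed.

(** It contains the event that some sample falls in the null set [uncovered]. Written with [occ], it
    is covered by the Chernoff bound with mean 0. *)
Let bad_cover : set (n.-tuple (vec3 R)) :=
  [set x | (5 * L <= 5 * L * (occ uncovered x n)%:R)%R].

Let bad_cover_le : (law bad_cover <= (expR (- (5 * L)))%:E)%E.
Proof.
apply: le_trans (iid_chernoff _ _ muncovered (leqnn n) uncovered_area) _.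
by rewrite mulr0 mul0r sub0r.
Qed.

Lemma measure_bigsetU_le d (T : measurableType d) (mu : {measure set T -> \bar R})
    (I : Type) (s : seq I) (B : I -> set T) (e : R) :
  (forall i, measurable (B i)) -> (forall i, mu (B i) <= e%:E)%E ->
  (mu (\big[setU/set0]_(i <- s) B i) <= (e *+ size s)%:E)%E.
Proof.
move=> mB Be; elim: s => [|i s IH]; first by rewrite big_nil measure0 mulr0n.
rewrite big_cons /= mulrS EFinD; apply: le_trans (measureU2 _ _ _) _ => //.
  by apply: bigsetU_measurable => j _.
exact: (leeD (Be i) IH).
Qed.

(** A measurable set inside the good configurations is enough to bound the integral over positions
    from below. *)
Lemma good_positions_prob : exists G : set (n.-tuple (vec3 R)),
  [/\ measurable G, G `<=` [set x | good_positions x r a 3000 L T0 J] &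
    ((1 - 4 * n.+1%:R ^+ 3 * expR (- (5 * L)))%:E <= law G)%E].
Proof.
pose B := bad_cover `|`
  \big[setU/set0]_(i <- index_enum (('I_n.+1 * 'I_n.+1) * 'I_n.+1)%type) bad_cell i.
have mB : measurable B.
  apply: measurableU; first by apply: mocc; exact: muncovered.
  by apply: bigsetU_measurable => i _; exact: mbad_cell.
exists (~` B); split; first exact: measurableC.
- move=> x /=; rewrite /B => nB.
  have nbad ij (t : nat) (tn : (t <= n)%N) : ~ bad_cell (ij, Ordinal (tn : (t < n.+1)%N)) x.
    move=> bx; apply: nB; right; rewrite -bigcup_seq /=.
    by exists (ij, Ordinal (tn : (t < n.+1)%N)) => //=; rewrite mem_index_enum.
  have cov v : ~ uncovered (tnth x v).
    move=> uv; apply: nB; left; rewrite /bad_cover /= ler_peMr ?mulr_ge0//.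
    rewrite ler1n; apply/card_gt0P; exists v.
    by rewrite inE ltn_ord andbT; apply/asboolP.
  split.
  + by move=> v; have /contrapT[] := cov v.
  + by move=> v; have /contrapT[_ [ij _ ?]] := cov v; exists ij.
  + move=> ij t tn; rewrite leNgt; apply/negP => lt; apply: (nbad ij t tn); left => /=.
    by rewrite ler_pM2l// ltW.
  + move=> ij t tn; rewrite leNgt; apply/negP => lt; apply: (nbad ij t tn); right; left => /=.
    by rewrite ler_pM2l// ltW// [in ltLHS]mulrA.
  + move=> ij t /andP[Tt tn]; rewrite leNgt; apply/negP => lt.
    apply: (nbad ij t tn); right; right => /=; rewrite Tt /=.
    by rewrite mulN1r lerN2 ltW.
rewrite probability_setC// EFinB leeD2l// leeN2.
apply: le_trans (measureU2 _ _ _) _.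
- apply: mocc; exact: muncovered.
- by apply: bigsetU_measurable => i _; exact: mbad_cell.
apply: le_trans (leeD bad_cover_le (measure_bigsetU_le _ mbad_cell bad_cell_le)) _.
rewrite -EFinD lee_fin -[_ *+ size _]mulr_natl.
have -> : size (index_enum (('I_n.+1 * 'I_n.+1) * 'I_n.+1)%type) = (n.+1 * n.+1 * n.+1)%N.
  by rewrite -[in RHS](card_ord n.+1) -!card_prod cardT enumT.
rewrite !natrM; have e0 := expR_ge0 (- (5 * L)).
have n1 : 1 <= n.+1%:R ^+ 3 :> R by rewrite exprn_ege1// ler1n.
have := ler_wpM2r e0 n1; move: (expR _) (n.+1%:R) => e z; lra.
Qed.

End typical_configuration.

(** * Asymptotics *)

Section model_probability.
Variables (R : realType).

(* No measurability is assumed: the probability of an event given the positions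
   is not shown to be a measurable function of the positions. *)
Lemma ge0_le_integral_any d (T : measurableType d) (mu : {measure set T -> \bar R})
    (f g : T -> \bar R) : (forall x, 0 <= f x)%E -> (forall x, f x <= g x)%E ->
  (\int[mu]_x f x <= \int[mu]_x g x)%E.
Proof.
move=> f0 fg; have g0 x : (0 <= g x)%E := le_trans (f0 x) (fg x).
rewrite !ge0_integralE//; apply: le_ereal_sup => _ [h /= hf <-]; exists h => //= x.
by apply: le_trans (hf x) _; rewrite !patch_setT.
Qed.

Lemma model_prob_le1 n (M : model_on R n) (E : pred (mgraph n)) :
  (forall x, is_dist (M x)) -> (model_prob M E <= 1)%E.
Proof.
move=> dM; apply: (@le_trans _ _ (\int[iid (@sphere_area R) n]_x 1)%E); last first.
  by rewrite integral_cst// mul1e probability_le1.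
apply: ge0_le_integral_any => x; rewrite lee_fin dprobE.
  exact: dexp_ge0.
rewrite -[leRHS](dexp_cst 1 (dM x)).
by apply: (dexp_le (dM x) (dall_true _ (fun=> I))) => G _; case: (E G).
Qed.

Lemma model_prob_ge n (M : model_on R n) (E : pred (mgraph n)) G (e1 e2 : R) :
  (forall x, is_dist (M x)) -> measurable G -> 0 <= e2 <= 1 ->
  ((1 - e1)%:E <= iid (@sphere_area R) n G)%E ->
  (forall x, G x -> 1 - e2 <= dprob (M x) E) ->
  (((1 - e2) * (1 - e1))%:E <= model_prob M E)%E.
Proof.
move=> dM mG /andP[e20 e21] PG ME; have e2' : 0 <= 1 - e2 by rewrite subr_ge0.
apply: (@le_trans _ _ (\int[iid (@sphere_area R) n]_x ((1 - e2)%:E * (\1_G x)%:E))%E).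
  rewrite ge0_integralZl//; last exact/measurable_EFinP.
  by rewrite integral_indic// setIT EFinM lee_wpmul2l.
apply: ge0_le_integral_any => x; first by rewrite mule_ge0.
rewrite -EFinM lee_fin indicE; case: (boolP (x \in G)) => [|_]; rewrite ?mulr1 ?mulr0.
  by rewrite inE => /ME.
by rewrite dprobE; exact: dexp_ge0.
Qed.

End model_probability.

Lemma position_constants (R : realType) : exists a b : R,
  [/\ 0 < a, a <= 1 & 20 <= b] /\
  forall n (r L : R) (T0 J : nat), (0 < n)%N -> 0 < r -> r <= 1 ->
    80 <= (n%:R * (r / 16)) ^+ 2 -> 0 <= L -> 20 * L <= a * (r ^+ 2 * T0%:R) ->
    exists G : set (n.-tuple (vec3 R)),
    [/\ measurable G, G `<=` [set x | good_positions x r a b L T0 J] &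
      ((1 - 4 * n.+1%:R ^+ 3 * expR (- (5 * L)))%:E <= iid (@sphere_area R) n G)%E].
Proof.
exists (16^-1 ^+ 2 / 1024 / 4), 3000; split; last first.
  by move=> n r L T0 J n0 r0 r1 nr L0 LT; exact: good_positions_prob.
have c0 : 0 < 16^-1 :> R by rewrite invr_gt0 ltr0n.
split; last by rewrite ler_nat.
- by do 2 (apply: divr_gt0; last by rewrite ltr0n); exact: exprn_gt0.
- do 2 (rewrite ler_pdivrMr ?ltr0n// mul1r; apply: (@le_trans _ _ 1); last by rewrite ler1n).
  by rewrite exprn_ile1 ?(ltW c0)// invf_le1 ?ltr0n// ler1n.
Qed.

Section growth.
Variable R : realType.

Lemma near_ln_ge (B : R) : \forall n \near \oo, B <= ln n%:R.
Proof.
have := nbhs_infty_gtr (expR B); apply: filterS => n Bn.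
rewrite -[leLHS]expRK ler_ln ?posrE ?expR_gt0 ?(ltW Bn)//.
exact: lt_trans (expR_gt0 _) Bn.
Qed.

Lemma near_powR_ln_le (p C : R) : \forall n \near \oo, C * ln n%:R `^ p <= n%:R.
Proof.
pose q := (Num.truncn `|p|).+1.
have pq : p <= q%:R by apply: le_trans (ler_norm _) _; exact/ltW/truncnS_gt.
have f0 : 0 < q.+1`!%:R :> R by rewrite ltr0n fact_gt0.
near=> n.
have L1 : 1 <= ln n%:R :> R by near: n; exact: near_ln_ge.
have CL : `|C| * q.+1`!%:R <= ln n%:R by near: n; exact: near_ln_ge.
have L0 : 0 < ln n%:R :> R by exact: lt_le_trans ltr01 L1.
have n0 : 0 < n%:R :> R.
  by rewrite ltr0n lt0n; apply: contraTneq L0 => ->; rewrite ln0// ltxx.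
rewrite -[leRHS](@lnK R n%:R) ?posrE//; move: (ln n%:R) L1 CL L0 => L L1 CL L0.
apply: (@le_trans _ _ (`|C| * L ^+ q)).
  apply: (@le_trans _ _ (`|C| * L `^ p)); first by rewrite ler_wpM2r ?powR_ge0 ?ler_norm.
  by rewrite ler_wpM2l// -powR_mulrn ?(ltW L0)// ler_powR.
apply: le_trans (expR_ge1Dxn q (ltW L0)).
apply: (@le_trans _ _ (L ^+ q.+1 / q.+1`!%:R)); last by rewrite lerDr.
by rewrite ler_pdivlMr// mulrAC exprS ler_wpM2r ?exprn_ge0 ?(ltW L0).
Unshelve. all: by end_near.
Qed.

(** 2^l is at least exp (l / 2), which exceeds the fifth Taylor term at l / 2. *)
Lemma two_pow_gt (C : R) (l : nat) : 0 <= C -> (0 < l)%N ->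
  C * 2 ^+ 5 * 5`!%:R < l%:R -> C * l%:R ^+ 4 < 2 ^+ l.
Proof.
move=> C0 l0 Cl; have lR : 0 < l%:R :> R by rewrite ltr0n.
have f0 : 0 < 5`!%:R :> R by rewrite ltr0n fact_gt0.
apply: (@lt_le_trans _ _ (expR 2^-1 ^+ l)); last first.
  by rewrite lerXn2r ?nnegrE ?expR_ge0 ?expR_half_le2.
rewrite -expRM_natr; have h0 : 0 <= 2^-1 * l%:R :> R by rewrite mulr_ge0.
apply: lt_le_trans (expR_ge1Dxn 4 h0); apply: (@lt_le_trans _ _ ((2^-1 * l%:R) ^+ 5 / 5`!%:R)).
  rewrite ltr_pdivlMr// exprMn exprVn ltr_pdivlMl ?exprn_gt0// [ltRHS]exprS.
  rewrite (_ : 2 ^+ 5 * _ = C * 2 ^+ 5 * 5`!%:R * l%:R ^+ 4); last by ring.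
  by rewrite ltr_pM2r ?exprn_gt0.
by rewrite lerDr.
Qed.

Lemma start_time (a r L : R) : 0 < a -> a <= 1 -> 0 < r -> r <= 1 -> 1 <= L ->
  exists T0 : nat, 20 * L <= a * (r ^+ 2 * T0%:R) <= 21 * L.
Proof.
move=> a0 a1 r0 r1 L1; have r2 : 0 < r ^+ 2 by rewrite exprn_gt0.
have ar : 0 < a * r ^+ 2 by rewrite mulr_gt0.
have ar1 : a * r ^+ 2 <= 1 by rewrite mulr_ile1 ?(ltW a0) ?(ltW r2)// exprn_ile1 ?(ltW r0).
have y0 : 0 <= 20 * L / (a * r ^+ 2).
  by rewrite divr_ge0 ?(ltW ar)// mulr_ge0// (le_trans ler01).
have /andP[t1 t2] := truncn_itv y0.
exists (Num.truncn (20 * L / (a * r ^+ 2))).+1; rewrite mulrA; apply/andP; split.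
  by rewrite [leRHS]mulrC -ler_pdivrMr// ltW.
rewrite -[_.+1%:R]natr1 mulrDr mulr1; move: t1; rewrite ler_pdivlMr//.
rewrite [X in X <= _ -> _]mulrC; lra.
Qed.

(** Any root of order at least 5 yields the bound l^5 <= L that the long edges call for. *)
Lemma truncn_root8 (L : R) : 1 <= L -> let l := Num.truncn (L `^ (1 / 8)) in
  [/\ (0 < l)%N, l%:R ^+ 8 <= L, L < l.+1%:R ^+ 8 & L `^ (1 / 8) <= 2 * l%:R].
Proof.
move=> L1 /=; have L0 : 0 < L by exact: lt_le_trans ltr01 L1.
set y := L `^ (1 / 8); have y1 : 1 <= y.
  by rewrite -[leLHS](powRr0 L) ler_powR.
have y8 : y ^+ 8 = L.
  by rewrite -powR_mulrn ?powR_ge0// -powRrM mul1r mulVf// powRr1// ltW.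
have y0 : 0 <= y by exact: powR_ge0.
have /andP[t1 t2] := truncn_itv y0.
have l1 : (0 < Num.truncn y)%N by rewrite truncn_ge_nat.
split=> //.
- by rewrite -[leRHS]y8 lerXn2r ?nnegrE.
- by rewrite -[ltLHS]y8 ltrXn2r ?nnegrE//.
- apply: (le_trans (ltW t2)); rewrite -natrM ler_nat; lia.
Qed.

End growth.

(** * Choice of the scales and of the exponents *)

Section main_estimate.
Variable R : realType.

(** With L = ln n the factor exp (-5 L) is n^-5. From n + 1 <= 2 n, the two errors are at most 32 /
    n and 12 / n. *)
Lemma error_le (n : nat) : (44 <= n)%N ->
  let e1 := 4 * n.+1%:R ^+ 3 * expR (- (5 * ln n%:R)) in
  let e2 := 3 * n.+1%:R ^+ 2 * n%:R ^+ 2 * expR (- (5 * ln n%:R)) in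
  0 <= e2 <= 1 /\ 1 - 44 / n%:R <= (1 - e2) * (1 - e1) :> R.
Proof.
move=> n44 e1 e2; have n0 : 0 < n%:R :> R by rewrite ltr0n (leq_trans _ n44).
have E : expR (- (5 * ln n%:R)) = n%:R ^- 5 :> R.
  by rewrite expRN mulrC expRM_natr lnK ?posrE.
have s0 : 0 <= n.+1%:R :> R by [].
have s2 : n.+1%:R <= 2 * n%:R :> R by rewrite -natrM ler_nat; lia.
have p2 : n.+1%:R ^+ 2 <= (2 * n%:R) ^+ 2 :> R by rewrite lerXn2r ?nnegrE ?mulr_ge0.
have p3 : n.+1%:R ^+ 3 <= (2 * n%:R) ^+ 3 :> R by rewrite lerXn2r ?nnegrE ?mulr_ge0.
have i5 : 0 <= n%:R ^- 5 :> R by rewrite invr_ge0 exprn_ge0.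
have e1_le : e1 <= 32 / n%:R.
  apply: (@le_trans _ _ (4 * (2 * n%:R) ^+ 3 * n%:R ^- 5)).
    by rewrite /e1 E ler_wpM2r// ler_wpM2l.
  rewrite (_ : _ * _ = 32 / n%:R / n%:R); last by field; rewrite gt_eqF.
  by rewrite ler_pdivrMr// ler_peMr ?divr_ge0// ler1n (leq_trans _ n44).
have e2_le : e2 <= 12 / n%:R.
  apply: (@le_trans _ _ (3 * (2 * n%:R) ^+ 2 * n%:R ^+ 2 * n%:R ^- 5)).
    by rewrite /e2 E ler_wpM2r// ler_wpM2r ?exprn_ge0// ler_wpM2l.
  by rewrite le_eqVlt; apply/orP; left; apply/eqP; field; rewrite gt_eqF.
have e10 : 0 <= e1 by rewrite /e1 mulr_ge0 ?expR_ge0// mulr_ge0 ?exprn_ge0.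
have e20 : 0 <= e2 by rewrite /e2 !mulr_ge0 ?expR_ge0 ?exprn_ge0.
split; last first.
  have -> : 44 / n%:R = 12 / n%:R + 32 / n%:R :> R by rewrite -mulrDl -natrD.
  have := mulr_ge0 e20 e10; lra.
rewrite e20/=; apply: (le_trans e2_le); rewrite ler_pdivrMr// mul1r ler_nat.
exact: leq_trans n44.
Qed.

Lemma sqr_double_sqr_le (l : nat) : (0 < l)%N ->
  (l * l).*2.+1%:R ^+ 2 <= 9 * l%:R ^+ 4 :> R.
Proof.
move=> l0; have ll : (0 < l * l)%N by rewrite muln_gt0 l0.
rewrite (_ : 9 * _ = (3 * (l * l)%:R) ^+ 2); last by rewrite natrM; ring.
rewrite lerXn2r ?nnegrE ?mulr_ge0// -natrM ler_nat.
by move: (l * l)%N ll => q; lia.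
Qed.

(** Here r^2 n = L^(2 c0) and (J + 1)^2 <= 9 l^4 <= 9 L, whence the size bound. The exponent beta is
    chosen so that |S|^beta is at most of order L^(1/8), hence of order l, while l^5 <= L <= m
    brings the conductance down to order 1 / l. *)
Lemma small_around_community (n m l : nat) (r a b K L c0 : R) (G : mgraph n) v S :
  0 < a -> 20 <= b -> 1 <= K -> 1 <= L -> a^-1 <= L -> 1 <= c0 -> K * L <= m%:R ->
  r ^+ 2 * n%:R = (L `^ c0) ^+ 2 ->
  [/\ (0 < l)%N, l%:R ^+ 8 <= L & L `^ (1 / 8) <= 2 * l%:R] ->
  small_around r m a b l G v S ->
  (v \in S) && community (2 * (2 + 108 * b / a) * (18 * b) `^ (8 * (2 * c0 + 1))^-1)
    (8 * (2 * c0 + 1))^-1 L (18 * b * L `^ (2 * c0 + 1)) G S.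
Proof.
move=> a0 b20 K1 L1 aL c1 Km rn [l0 l8 lL] /and4P[-> S1 /andP[S2 S3] S4] /=.
have L0 : 0 < L by exact: lt_le_trans ltr01 L1.
have b0 : 0 < b by apply: lt_le_trans b20; rewrite ltr0n.
have lR : 0 < l%:R :> R by rewrite ltr0n.
have l1 : 1 <= l%:R :> R by rewrite ler1n.
have J3 := sqr_double_sqr_le l0.
have l4L : l%:R ^+ 4 <= L.
  by apply: le_trans l8; rewrite -[leLHS]mulr1 (exprD _ 4 4) ler_wpM2l ?exprn_ge0 ?exprn_ege1.
have l5L : l%:R ^+ 5 <= L.
  by apply: le_trans l8; rewrite -[leLHS]mulr1 (exprD _ 5 3) ler_wpM2l ?exprn_ge0 ?exprn_ege1.
have Lc : (L `^ c0) ^+ 2 * L = L `^ (2 * c0 + 1).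
  rewrite powRD; last by rewrite (gt_eqF L0) implybT.
  rewrite powRr1 ?(ltW L0)//; congr (_ * _).
  by rewrite [2 * c0]mulrC powRrM powR_mulrn ?powR_ge0.
have Lc1 : L <= L `^ c0 by rewrite -[leLHS]powRr1 ?(ltW L0)// ler_powR.
have hi : #|S|%:R <= 18 * b * L `^ (2 * c0 + 1).
  apply: (le_trans S3); rewrite rn -Lc; have := sqr_ge0 (L `^ c0).
  move: ((L `^ c0) ^+ 2) => X X0; rewrite [X * L]mulrC [leRHS]mulrA ler_wpM2r//.
  apply: (@le_trans _ _ (2 * b * (9 * L))); last first.
    by rewrite le_eqVlt; apply/orP; left; apply/eqP; ring.
  rewrite ler_wpM2l ?mulr_ge0 ?(ltW b0)// (le_trans J3)// ler_wpM2l//.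
have lo : L <= #|S|%:R.
  apply: le_trans S2; rewrite rn.
  apply: (@le_trans _ _ (a * L ^+ 2)).
    by rewrite expr2 mulrA ler_peMl ?(ltW L0)// -[leLHS](mulfV (lt0r_neq0 a0)) ler_wpM2l ?(ltW a0).
  by rewrite ler_wpM2l ?(ltW a0)// lerXn2r ?nnegrE ?powR_ge0 ?(ltW L0).
rewrite /community S1 lo hi /=.
set beta := (8 * (2 * c0 + 1))^-1.
have g0 : 0 < 2 * c0 + 1 by rewrite ltr_wpDl// mulr_ge0// (le_trans ler01).
have beta0 : 0 <= beta by rewrite invr_ge0 mulr_ge0 ?(ltW g0).
have S0 : 0 < #|S|%:R :> R by exact: lt_le_trans L0 lo.
have C0 : 0 <= 2 + 108 * b / a.
  by rewrite addr_ge0// divr_ge0 ?(ltW a0)// mulr_ge0 ?(ltW b0).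
have mR : L <= m%:R by apply: le_trans Km; rewrite ler_peMl ?(ltW L0).
have m0 : 0 < m%:R :> R by exact: lt_le_trans L0 mR.
apply: (@le_trans _ _ ((2 + 108 * b / a) / l%:R)).
  apply: (le_trans S4); rewrite [leRHS]mulrDl lerD2l.
  have am : 0 < a * m%:R by rewrite mulr_gt0.
  rewrite ler_pdivrMr//.
  rewrite (_ : 108 * b / a / l%:R * (a * m%:R) = 12 * b * (9 * (m%:R / l%:R))); last first.
    by field; rewrite !gt_eqF.
  rewrite ler_wpM2l ?mulr_ge0 ?(ltW b0)// (le_trans J3)// ler_wpM2l//.
  by rewrite ler_pdivlMr// -exprSr (le_trans l5L).
have Y0 : 0 < #|S|%:R `^ beta :> R by exact: powR_gt0.
have hY : #|S|%:R `^ beta <= (18 * b) `^ beta * (2 * l%:R).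
  apply: (@le_trans _ _ ((18 * b * L `^ (2 * c0 + 1)) `^ beta)).
    by rewrite ge0_ler_powR ?nnegrE ?mulr_ge0 ?powR_ge0 ?(ltW b0) ?(ltW S0).
  rewrite powRM ?mulr_ge0 ?powR_ge0 ?(ltW b0)// -powRrM.
  have -> : (2 * c0 + 1) * beta = 1 / 8 by rewrite /beta; field; exact: lt0r_neq0.
  by rewrite ler_wpM2l ?powR_ge0.
rewrite -/beta [leRHS](_ : _ = (2 + 108 * b / a) *
  (2 * (18 * b) `^ beta / #|S|%:R `^ beta)); last by ring.
rewrite ler_wpM2l// ler_pdivlMr// mulrC ler_pdivrMr// (le_trans hY)//.
by rewrite le_eqVlt; apply/orP; left; apply/eqP; ring.
Qed.

(** The threshold on [n] precedes [m], [r], [delta] and [step]: sequences can be substituted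
    pointwise, and the same constants serve both models. *)
Lemma near_layered_model : exists K : R, 1 <= K /\
  forall c0 : R, 1 <= c0 -> exists alpha beta gamma C : R,
  [/\ 0 < alpha, 0 < beta & 0 < gamma] /\
  \forall n \near \oo, forall (m : nat) (r : R), K * ln n%:R <= m%:R ->
  r = n%:R `^ (- (1 / 2)) * ln n%:R `^ c0 ->
  forall (delta : R) (step : n.-tuple (vec3 R) ->
    'I_n -> mgraph n * mgraph n -> dist R (mgraph n * mgraph n))
    (Inv : n.-tuple (vec3 R) -> nat -> mgraph n * mgraph n -> Prop), 0 < delta ->
  (forall x, layered x r m delta (step x) (Inv x)) ->
  ((1 - 44 / n%:R)%:E <= model_prob (fun x => run (step x))
    (fun G => [forall v : 'I_n, exists S : {set 'I_n},
      (v \in S) && community alpha beta (ln n%:R) (C * ln n%:R `^ gamma) G S]) <= 1)%E.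
Proof.
have [a [b [[a0 a1 b20] positions]]] := position_constants R.
have b0 : 0 < b by apply: lt_le_trans b20; rewrite ltr0n.
pose k := (Num.truncn ((21 * (b + 1) + 20 * a) / a)).+1.
have k_ge : 21 * (b + 1) + 20 * a <= k%:R * a.
  by rewrite -ler_pdivrMr//; exact/ltW/truncnS_gt.
have b1 : 0 <= b + 1 by rewrite addr_ge0 ?(ltW b0).
(* The contacts required by [late_step] and [early_step], with [kappa] and [kappa2] written out; the
   summand 1 gives m >= L. *)
pose K := 20 * ((b + 1) / a) + 8 * ((b + 1) * 21 * k%:R / a) + 1.
have K1 : 1 <= K.
  by rewrite lerDr addr_ge0// mulr_ge0// divr_ge0 ?(ltW a0)// !mulr_ge0.
exists K; split => // c0 c1.
exists (2 * (2 + 108 * b / a) * (18 * b) `^ (8 * (2 * c0 + 1))^-1),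
  (8 * (2 * c0 + 1))^-1, (2 * c0 + 1), (18 * b).
have g0 : 0 < 2 * c0 + 1 by rewrite ltr_wpDl// mulr_ge0// (le_trans ler01).
split.
  split => //; last by rewrite invr_gt0 mulr_gt0.
  rewrite mulr_gt0 ?powR_gt0 ?mulr_gt0// ltr_wpDr// divr_ge0 ?(ltW a0)//.
  by rewrite mulr_ge0 ?(ltW b0).
near=> n.
have L1 : 1 <= ln n%:R :> R by near: n; exact: near_ln_ge.
have La : a^-1 <= ln n%:R by near: n; exact: near_ln_ge.
have Lk : 21 * k%:R / a <= ln n%:R by near: n; exact: near_ln_ge.
(* Taking eighth roots, this makes [l] large enough for [two_pow_gt]; the 2 covers the rounding of
   [l]. *)
have Ll : ((18 * b / a) * 2 ^+ 5 * 5`!%:R + 2) ^+ 8 <= ln n%:R.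
  by near: n; exact: near_ln_ge.
have nL : 36 * b * ln n%:R `^ (2 * c0 + 1) <= n%:R by near: n; exact: near_powR_ln_le.
have n20 : 80 * 16 ^+ 2 <= n%:R :> R.
  by near: n; apply: filterS (nbhs_infty_gtr _) => n; exact: ltW.
have n44 : (44 <= n)%N by near: n; exact: nbhs_infty_ge.
move=> m r Km rE delta step Inv d0 H.
move LE : (ln n%:R) => L; rewrite LE in L1 La Lk Ll nL Km rE.
have L0 : 0 < L by exact: lt_le_trans ltr01 L1.
have n_gt0 : (0 < n)%N by exact: leq_trans n44.
have n0 : 0 < n%:R :> R by rewrite ltr0n.
have r0 : 0 < r by rewrite rE mulr_gt0 ?powR_gt0.
have rn : r ^+ 2 * n%:R = (L `^ c0) ^+ 2.
  rewrite rE exprMn -[(n%:R `^ _) ^+ 2]powR_mulrn ?powR_ge0// -powRrM mulNr.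
  by rewrite mulfVK// powRN powRr1 ?(ltW n0)// mulrAC mulVf ?gt_eqF// mul1r.
have Lc1 : L <= L `^ c0 by rewrite -[leLHS]powRr1 ?(ltW L0)// ler_powR.
have L2 : L ^+ 2 <= r ^+ 2 * n%:R.
  by rewrite rn lerXn2r ?nnegrE ?powR_ge0 ?(ltW L0).
have Lc : (L `^ c0) ^+ 2 * L = L `^ (2 * c0 + 1).
  rewrite powRD; last by rewrite (gt_eqF L0) implybT.
  rewrite powRr1 ?(ltW L0)//; congr (_ * _).
  by rewrite [2 * c0]mulrC powRrM powR_mulrn ?powR_ge0.
have [l0 l8 l9 lL] := truncn_root8 L1.
set l := Num.truncn _ in l0 l8 l9 lL.
have lR : 0 < l%:R :> R by rewrite ltr0n.
have l1 : 1 <= l%:R :> R by rewrite ler1n.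
have J3 := sqr_double_sqr_le l0.
have l4L : l%:R ^+ 4 <= L.
  by apply: le_trans l8; rewrite -[leLHS]mulr1 (exprD _ 4 4) ler_wpM2l ?exprn_ge0 ?exprn_ege1.
have rho : 4 * (b * (l * l).*2.+1%:R ^+ 2 * r ^+ 2) <= 1.
  rewrite -(ler_pM2r n0) mul1r; apply: le_trans nL; rewrite -Lc -rn.
  rewrite (_ : 4 * _ * _ = 4 * b * (r ^+ 2 * n%:R) * (l * l).*2.+1%:R ^+ 2); last by ring.
  rewrite (_ : 36 * _ * _ = 4 * b * (r ^+ 2 * n%:R) * (9 * L)); last by ring.
  rewrite ler_wpM2l ?(le_trans J3) ?ler_wpM2l//.
  apply: mulr_ge0; first exact: mulr_ge0 _ (ltW b0).
  by apply: mulr_ge0; [exact: sqr_ge0|exact: ltW].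
have r1 : r <= 1.
  rewrite -(ler_pXn2r (n := 2)) ?nnegrE ?(ltW r0)// expr1n; apply: le_trans rho.
  rewrite mulrA ler_peMl ?sqr_ge0// mulrA; apply: mulr_ege1.
    by apply: mulr_ege1; rewrite ?ler1n// (le_trans _ b20)// ler1n.
  by rewrite exprn_ege1// ler1n.
have [T0 /andP[T1 T2]] := start_time a0 a1 r0 r1 L1.
have kT : (k * T0 <= n)%N.
  have ar : 0 < a * r ^+ 2 by rewrite mulr_gt0 ?exprn_gt0.
  rewrite -(ler_nat R) natrM -(ler_pM2l ar).
  apply: (@le_trans _ _ (k%:R * (21 * L))).
    by rewrite mulrCA ler_wpM2l// -mulrA.
  rewrite -[leRHS]mulrA; apply: (@le_trans _ _ (a * L ^+ 2)); last by rewrite ler_wpM2l ?(ltW a0).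
  move: Lk; rewrite ler_pdivrMr// => h; have := ler_wpM2r (ltW L0) h.
  have -> : k%:R * (21 * L) = 21 * k%:R * L by ring.
  by have -> : a * L ^+ 2 = L * a * L by ring.
have T0n : (T0 <= n)%N by apply: leq_trans kT; rewrite leq_pmull.
have large : 2 * b * (l * l).*2.+1%:R ^+ 2 < 2 ^+ l * a.
  rewrite -ltr_pdivrMr//; apply: (@le_lt_trans _ _ (18 * b / a * l%:R ^+ 4)).
    rewrite mulrAC [leRHS](_ : _ = 2 * b / a * (9 * l%:R ^+ 4)); last by ring.
    by rewrite ler_wpM2l// divr_ge0 ?(ltW a0)// mulr_ge0 ?(ltW b0).
  apply: two_pow_gt => //; first by rewrite divr_ge0 ?(ltW a0)// mulr_ge0 ?(ltW b0).
  set C := _ * 5`!%:R in Ll *; have C0 : 0 <= C.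
    by rewrite /C mulr_ge0// mulr_ge0 ?exprn_ge0// divr_ge0 ?(ltW a0)// mulr_ge0 ?(ltW b0).
  have : C + 2 < l.+1%:R.
    rewrite -(ltr_pXn2r (n := 8)) ?nnegrE ?addr_ge0//.
    exact: le_lt_trans Ll l9.
  by rewrite -natr1; lra.
have nr80 : 80 <= (n%:R * (r / 16)) ^+ 2.
  rewrite (_ : _ ^+ 2 = n%:R * (r ^+ 2 * n%:R) / 16 ^+ 2); last by field.
  rewrite ler_pdivlMr ?exprn_gt0//; apply: (le_trans n20).
  by rewrite ler_peMr ?(ltW n0)// (le_trans _ L2)// exprn_ege1.
have [G [mG GP PG]] := positions n r L T0 (l * l).*2 n_gt0 r0 r1 nr80 (ltW L0) T1.
have [e2 err] := error_le n44; rewrite LE in e2 err.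
have chain_run x : run (step x) = dbind (chain (step x) ([::], [::]))
    (fun s => dret R (s.1 ++ s.2)) by [].
have dM x : is_dist (run (step x)).
  rewrite chain_run; apply: is_dist_bind (layered_chain_local (H x)) _.
    exact: layered_chain_dist (H x).
  by move=> s _; exact: is_dist_ret.
apply/andP; split; last exact: model_prob_le1.
apply: le_trans (model_prob_ge dM mG e2 PG _); first by rewrite lee_fin.
move=> x /GP good.
have := small_around_prob r0 r1 a0 a1 b20 good L1 T1 T2 k_ge kT Km d0 (H x) L2 _ l0 large rho T0n.
rewrite -[X in _ <= expR X -> _]LE lnK ?posrE// lexx => /(_ isT) /le_trans; apply.
rewrite chain_run !dprobE dexp_bind.
apply: (dexp_le (layered_chain_dist (H x)) (dall_true _ (fun=> I))) => s _.
rewrite dexp_ret ler_nat; case: (boolP [forall v, _]) => //= /forallP h.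
rewrite (_ : [forall v, _] = true)//; apply/forallP => v.
have /existsP[S HS] := h v; apply/existsP; exists S.
by apply: (small_around_community a0 b20 K1 L1 La c1 Km rn _ HS); split.
Unshelve. all: by end_near.
Qed.

End main_estimate.

Lemma small_communities_of_bounds (R : realType) (alpha beta gamma C : R)
    (M : forall n, model_on R n) :
  (\forall n \near \oo, ((1 - 44 / n%:R)%:E <= model_prob (M n)
    (fun G => [forall v : 'I_n, exists S : {set 'I_n},
      (v \in S) && community alpha beta (ln n%:R) (C * ln n%:R `^ gamma) G S]) <= 1)%E) ->
  small_communities alpha beta gamma M.
Proof.
(* The logarithm itself is the lower bound on sizes that tends to infinity. *)
move=> H; exists (fun n => ln n%:R), C; split.
  by apply/cvgryPge => A; exact: near_ln_ge.
apply: (squeeze_cvge (f := fun n => (1 - 44 / n%:R)%:E) (h := fun=> 1%E)) => //; last first.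
  exact: cvg_cst.
apply: cvg_EFin; first by near=> n.
apply/cvgrPdist_le => e e0 /=; near=> n.
have n0 : 0 < n%:R :> R by near: n; exact: nbhs_infty_gtr.
have ne : 44 / e <= n%:R by near: n; apply: filterS (nbhs_infty_gtr _) => n; exact: ltW.
rewrite opprB addrC subrK ger0_norm ?divr_ge0 ?(ltW n0)//.
by rewrite ler_pdivrMr// mulrC -ler_pdivrMr.
Unshelve. all: by end_near.
Qed.

Theorem theorem2 (R : realType) (xi : R) (xi_gt0 : 0 < xi) :
  exists c K2 : R, forall c0 : R, c <= c0 ->
  let r (n : nat) : R := n%:R `^ (- (1 / 2)) * ln n%:R `^ c0 in
  forall m : nat -> nat,
  (forall n, (0 < n)%N -> (0 < m n)%N /\ K2 * ln n%:R <= (m n)%:R) ->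
  exists alpha beta gamma : R,
    [/\ 0 < alpha, 0 < beta & 0 < gamma] /\
    small_communities alpha beta gamma
      (fun n x => hybrid_model x (r n) (m n) (xi * (m n)%:R)) /\
    (forall delta : nat -> nat,
      (forall n, (0 < n)%N ->
        (2 <= delta n)%N /\ (delta n)%:R = xi * (m n)%:R) ->
      small_communities alpha beta gamma
        (fun n x => selfloop_model x (r n) (m n) (delta n))).
Proof.
(* c0 >= 1 ensures r^2 n >= L^2. The constant [K] is absolute, since [delta] cancels in
   [base_step_misses]. *)
have [K [K1 HK]] := near_layered_model R; exists 1, K => c0 c1 r m Hm.
have [alpha [beta [gamma [C [pos near_M]]]]] := HK c0 c1.
exists alpha, beta, gamma; split=> //; split=> [|delta Hdelta].
  apply: (@small_communities_of_bounds _ _ _ _ C); near=> n.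
  have n0 : (0 < n)%N by near: n; exact: nbhs_infty_gt.
  have [m0 Km] := Hm n n0.
  have d0 : 0 < xi * (m n)%:R by rewrite mulr_gt0 ?ltr0n.
  move: Km d0; near: n; apply: filterS near_M => n near_M Km d0.
  exact: near_M _ _ Km erefl _ _ _ d0 (fun x => hybrid_layered x (r n) (m n) d0).
apply: (@small_communities_of_bounds _ _ _ _ C); near=> n.
have n0 : (0 < n)%N by near: n; exact: nbhs_infty_gt.
have [m0 Km] := Hm n n0; have [d2 dE] := Hdelta n n0.
(* [selfloop_layered] asks for 4 rather than 2; this holds eventually because delta = xi m is at
   least xi K ln n. *)
have d4 : (4 <= delta n)%N.
  have Ln : 4 / (xi * K) <= ln n%:R by near: n; exact: near_ln_ge.
  have xK : 0 < xi * K by rewrite mulr_gt0// (lt_le_trans ltr01).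
  rewrite -(ler_nat R) dE; apply: (@le_trans _ _ (xi * (K * ln n%:R))).
    by rewrite mulrA [leRHS]mulrC -ler_pdivrMr.
  by rewrite ler_wpM2l ?(ltW xi_gt0).
have d0 : 0 < (delta n)%:R :> R by rewrite ltr0n (leq_trans _ d4).
move: Km d0 d4 {d2 dE}; near: n; apply: filterS near_M => n near_M Km d0 d4.
exact: near_M _ _ Km erefl _ _ _ d0 (fun x => selfloop_layered x (r n) (m n) d4).
Unshelve. all: by end_near.
Qed.
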